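(* Let $G$ be a quasi-reductive supergroup with Lie superalgebra $\mathfrak g=\mathrm{Lie}(G)=\mathfrak g_{\bar 0}\oplus\mathfrak g_{\bar 1}$, and let $x\in\mathfrak g_{\bar 1}$. Then there exists a decomposition $x=x_{bal}+x_{neat}$ with $x_{bal},x_{neat}\in\mathfrak g_{\bar 1}$ such that $x_{bal}$ is balanced, $x_{neat}$ is neat, and $[x_{bal},x_{neat}]=0$.
   Context: Base field $\Bbbk$: algebraically closed of characteristic $0$. An algebraic supergroup $G$ is given by a Harish-Chandra pair $(G_{\bar 0},\mathfrak g)$: $\mathfrak g$ is a finite-dimensional Lie superalgebra, $G_{\bar 0}$ is an affine algebraic group with $\mathrm{Lie}(G_{\bar 0})=\mathfrak g_{\bar 0}$, and the adjoint action of $\mathfrak g_{\bar 0}$ on $\mathfrak g_{\bar 1}$ integrates to $G_{\bar 0}$. $\mathrm{Rep}(G)$ is the category of finite-dimensional $\mathfrak g$-modules (vector superspaces, parity-preserving morphisms) on which the $\mathfrak g_{\bar 0}$-action integrates to $G_{\bar 0}$. $G$ is quasi-reductive if $G_{\bar 0}$ is reductive (i.e. its finite-dimensional rational representations form a semisimple category). Every element of the reductive Lie algebra $\mathfrak g_{\bar 0}$ has a Jordan decomposition into commuting semisimple and nilpotent parts (central elements are semisimple; nilpotent elements lie in $[\mathfrak g_{\bar 0},\mathfrak g_{\bar 0}]$). An odd nilpotent operator on a finite-dimensional vector superspace is called neat if all its Jordan blocks have odd size, and balanced if each of its Jordan blocks has size $1$ or even size. Let $x\in\mathfrak g_{\bar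 1}$ and let $\frac12[x,x]=s+f$ be the Jordan decomposition ($s$ semisimple, $f$ nilpotent). For $M\in\mathrm{Rep}(G)$ put $M^s=\mathrm{Ker}(s|_M)$; $x$ acts on $M^s$ by an odd nilpotent operator. The element $x$ is ad-nilpotent if $s=0$. It is neat if it is ad-nilpotent and $x|_M$ is a neat operator for every $M\in\mathrm{Rep}(G)$. It is balanced if $x|_{M^s}$ is a balanced operator for every $M\in\mathrm{Rep}(G)$. (So $0$ is both neat and balanced.) *)

(* Defs.v *)
From HB Require Import structures.
From mathcomp Require Import all_boot all_algebra.

Set Implicit Arguments.
Unset Strict Implicit.
Unset Printing Implicit Defensive.

Import GRing.Theory.
Local Open Scope ring_scope.

(** In all gradings [false] is even and [true] is odd. *)

Record superspace (k : fieldType) := Superspace {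
  super_vect :> vectType k;
  homog : bool -> {vspace super_vect};
  homog_full : (homog false + homog true = fullv)%VS;
  homog_direct : (homog false :&: homog true = 0)%VS
}.

Record lieSuperalgebra (k : fieldType) := LieSuperalgebra {
  lie_super :> superspace k;
  ad : {linear lie_super -> 'End(lie_super)};
  ad_homog : forall a b x y, x \in homog lie_super a -> y \in homog lie_super b ->
    ad x y \in homog lie_super (a (+) b);
  ad_antisym : forall a b x y,
    x \in homog lie_super a -> y \in homog lie_super b ->
    ad x y = - ((-1) ^+ (a && b) *: ad y x);
  ad_jacobi : forall a b x y z,
    x \in homog lie_super a -> y \in homog lie_super b ->
    ad x (ad y z) = ad (ad x y) z + (-1) ^+ (a && b) *: ad y (ad x z)
}.

Definition brk (k : fieldType) (L : lieSuperalgebra k) (x y : L) : L := ad L x y.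

Section Jordan.
Context (k : fieldType) (L : lieSuperalgebra k).
Implicit Types s f X : L.

(** Semisimple and nilpotent elements of the even part, regarded as a reductive
    Lie algebra: central elements are semisimple, and nilpotent elements are
    required to lie in the derived algebra.  Over an algebraically closed field
    a semisimple endomorphism is one with a basis of eigenvectors. *)
Definition semisimple_elt s : Prop :=
  s \in homog L false /\
  exists2 b : seq L, basis_of (homog L false) b &
    forall v, v \in b -> exists c : k, brk s v = c *: v.

Definition in_derived_even f : Prop :=
  exists2 r : seq (L * L),
    (forall p, p \in r -> p.1 \in homog L false /\ p.2 \in homog L false) &
    f = \sum_(p <- r) brk p.1 p.2.

Definition nilpotent_elt f : Prop :=
  in_derived_even f /\
  exists n : nat, forall y, y \in homog L false -> iter n (brk f) y = 0.

Definition jordan_decomposition X s f : Prop :=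
  [/\ semisimple_elt s, nilpotent_elt f, brk s f = 0 & X = s + f].

End Jordan.

Section NilpotentOperators.
Context (k : fieldType) (V : vectType k).

(** [T] preserves [U] and is nilpotent on it, with Jordan blocks of sizes [sz]:
    [U] has a basis made of chains v, T v, ..., T^(n-1) v with T^n v = 0, the
    pair (v, n) running through [c] and [sz] listing the n's.  Block sizes do not
    depend on the grading, so chains need not be homogeneous. *)
Definition jordan_blocks (T : 'End(V)) (U : {vspace V}) (sz : seq nat) : Prop :=
  exists c : seq (V * nat),
    [/\ [seq p.2 | p <- c] = sz,
        forall p, p \in c -> (0 < p.2)%N /\ iter p.2 T p.1 = 0 &
        basis_of U (flatten [seq [seq iter j T p.1 | j <- iota 0 p.2] | p <- c])].

Definition neat_on (T : 'End(V)) (U : {vspace V}) : Prop :=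
  exists2 sz, jordan_blocks T U sz & all odd sz.

Definition balanced_on (T : 'End(V)) (U : {vspace V}) : Prop :=
  exists2 sz, jordan_blocks T U sz & all (fun n => (n == 1)%N || ~~ odd n) sz.

End NilpotentOperators.

(** Over an algebraically closed field of characteristic 0, where every affine
    algebraic group is reduced, such a group is its group of points together
    with its coordinate ring: a finitely generated algebra of functions on the
    group, stable under the comultiplication and the antipode, whose algebra
    characters are exactly the evaluations at the points. *)
Record affineGroup (k : fieldType) := AffineGroup {
  points :> groupType;
  coord : comAlgType k;
  ev : points -> {lrmorphism coord -> k^o};
  coord_fun : forall a b : coord, (forall g, ev g a = ev g b) -> a = b;
  ev_inj : forall g h, ev g =1 ev h -> g = h;
  ev_surj : forall phi : {lrmorphism coord -> k^o}, exists g, phi =1 ev g;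
  coord_fingen : exists gens : seq coord, forall P : coord -> Prop,
    (forall a, a \in gens -> P a) -> P 1 ->
    (forall (c : k) a b, P a -> P b -> P (c *: a + b)) ->
    (forall a b, P a -> P b -> P (a * b)) -> forall a, P a;
  coord_comul : forall a : coord, exists r : seq (coord * coord),
    forall g h, ev (g * h)%g a = \sum_(p <- r) ev g p.1 * ev h p.2;
  coord_antipode : forall a : coord, exists b : coord,
    forall g, ev g b = ev (g^-1)%g a
}.

Section Representations.
Context (k : fieldType) (G : affineGroup k).

Definition rational_rep (V : vectType k) (rho : G -> 'End(V)) : Prop :=
  [/\ rho 1%g = \1%VF,
      forall g h, rho (g * h)%g = (rho g \o rho h)%VF &
      forall (phi : 'Hom(V, k^o)) (v : V),
        exists a : coord G, forall g, ev g a = phi (rho g v)].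

Definition stable (V : vectType k) (rho : G -> 'End(V)) (U : {vspace V}) : Prop :=
  forall g, (rho g @: U <= U)%VS.

Definition reductive : Prop :=
  forall (V : vectType k) (rho : G -> 'End(V)), rational_rep rho ->
  forall U : {vspace V}, stable rho U ->
  exists W : {vspace V}, [/\ stable rho W, (U + W = fullv)%VS & (U :&: W = 0)%VS].

(** Elements of Lie(G), as derivations of the coordinate ring at the identity. *)
Definition point_derivation (d : coord G -> k) : Prop :=
  forall a b, d (a * b) = d a * ev 1%g b + ev 1%g a * d b.

(** [tg] identifies the even part of [L] with Lie(G).  The bracket of Lie(G) is
    the commutator of the convolution product (X (x) Y) o Delta.  The values of
    [tg] outside the even part are irrelevant. *)
Definition identifies_Lie (L : lieSuperalgebra k)
    (tg : L -> {linear coord G -> k^o}) : Prop :=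
  [/\ forall (c : k) X Y, X \in homog L false -> Y \in homog L false ->
        forall a, tg (c *: X + Y) a = c * tg X a + tg Y a,
      forall X, X \in homog L false -> tg X =1 (fun=> 0) -> X = 0,
      forall X, X \in homog L false -> point_derivation (tg X),
      forall d : {linear coord G -> k^o}, point_derivation d ->
        exists2 X, X \in homog L false & d =1 tg X &
      forall X Y, X \in homog L false -> Y \in homog L false ->
        forall (a : coord G) (r : seq (coord G * coord G)),
        (forall g h, ev (g * h)%g a = \sum_(p <- r) ev g p.1 * ev h p.2) ->
        tg (brk X Y) a =
          \sum_(p <- r) (tg X p.1 * tg Y p.2 - tg Y p.1 * tg X p.2)].

(** [act], a map of the even part of [L] to endomorphisms of [V], is the
    differential of [rho]: the matrix coefficients of [act X] are obtained by
    applying the derivation [X] to those of [rho]. *)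
Definition differential (L : lieSuperalgebra k)
    (tg : L -> {linear coord G -> k^o}) (V : vectType k)
    (rho : G -> 'End(V)) (act : L -> V -> V) : Prop :=
  forall X, X \in homog L false ->
  forall (phi : 'Hom(V, k^o)) (v : V) (a : coord G),
    (forall g, ev g a = phi (rho g v)) -> phi (act X v) = tg X a.

End Representations.

(** An action of the even part of the Lie superalgebra integrates to the even
    group when it is the differential of some rational representation.  No
    compatibility of that representation with the odd part is imposed; for a
    connected group it is automatic. *)
Record supergroup (k : fieldType) := Supergroup {
  even_group : affineGroup k;
  Lie : lieSuperalgebra k;
  tangent : Lie -> {linear coord even_group -> k^o};
  tangentP : identifies_Lie tangent;
  ad_odd_integrates :
    exists2 rho : even_group -> 'End(subvs_of (homog Lie true)), rational_rep rho &
      differential tangent rho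
        (fun X v => vsproj (homog Lie true) (brk X (vsval v)))
}.

Definition quasi_reductive (k : fieldType) (G : supergroup k) : Prop :=
  reductive (even_group G).

Record Rep (k : fieldType) (G : supergroup k) := MkRep {
  rep_space :> superspace k;
  act : {linear Lie G -> 'End(rep_space)};
  act_homog : forall a b x v,
    x \in homog (Lie G) a -> v \in homog rep_space b ->
    act x v \in homog rep_space (a (+) b);
  act_brk : forall a b x y v,
    x \in homog (Lie G) a -> y \in homog (Lie G) b ->
    act (brk x y) v = act x (act y v) - (-1) ^+ (a && b) *: act y (act x v);
  act_integrates : exists rho : even_group G -> 'End(rep_space),
    [/\ rational_rep rho,
        forall b, stable rho (homog rep_space b) &
        differential (@tangent k G) rho (fun X => act X)]
}.

Section Elements.
Context (k : fieldType) (G : supergroup k).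
Implicit Types x : Lie G.

Definition half_square x : Lie G := 2%:R^-1 *: brk x x.

Definition ad_nilpotent x : Prop :=
  exists f, jordan_decomposition (half_square x) 0 f.

Definition neat x : Prop :=
  ad_nilpotent x /\ forall M : Rep G, neat_on (act M x) fullv.

Definition balanced x : Prop :=
  exists s f, jordan_decomposition (half_square x) s f /\
    forall M : Rep G, balanced_on (act M x) (lker (act M s)).

End Elements.

(* Main.v *)
Require Import Defs.
From HB Require Import structures.
From mathcomp Require Import all_boot all_algebra.
From mathcomp Require Import ring.
From Stdlib Require Import Classical ClassicalEpsilon.
Set Implicit Arguments. Unset Strict Implicit. Unset Printing Implicit Defensive.
Import GRing.Theory Num.Theory.
Local Open Scope ring_scope.

(** Reductivity of the even group makes g_0 act completely reducibly on g and on End(g); this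
    gives Jordan decompositions inside g_0, as polynomials in the adjoint operators, and the
    Jacobson-Morozov theorem.  Write 1/2 [x, x] = s + e and complete e to an sl2-triple
    (e, h, f) commuting with s; the rest takes place in the centralizer of s.  There x is a
    sum of parts x_i of h-weight i >= 0, and x_0 squares to s, so that [ad x_0] is a
    differential.  A Levi argument on its even cycles splits e, up to an inner automorphism,
    as e_K + e_J, with commuting sl2-triples K and J in the cycles, J acting by zero on
    homology.  The Casimir operator of J then corrects x_1, modulo boundaries, to a
    J-invariant z of square e_K, and z together with [f_K, z] generates a copy of osp(1|2).
    Its Scasimir operator splits off the invariants in the remaining part of x, and gauging
    by exponentials of even elements of positive h-weight removes the non-invariant
    components, leaving x = z + b with [z, b] = 0.

    The odd element y of osp(1|2) with [z^2, y] = z forces all Jordan blocks of z to have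
    odd size.  The element b squares to s + e_J, and its part of weight zero is an odd
    element commuting with J and having e_J in the image of its adjoint action, which
    forces the nontrivial Jordan blocks of b on Ker s to have even size. *)

(** Once s is central, bracketing with x_0 is a differential, and comparing h-weights in [x, x] =
    2(s + e) shows that x_1 squares to e only up to a boundary. This is the obstacle: e is a square
    in homology, not in the algebra. The part e_J acting by zero on homology has to come from the
    balanced summand, as a bracket of x_0 with an odd element, and only e_K can be the square of the
    neat one; the Levi argument separates the two. It is carried out relative to the ideal of even
    cycles acting by zero on homology, through a maximal toral element of that ideal and the trace
    form of the adjoint action.

    Semisimple parts are kept as polynomials without constant term in an adjoint operator, so they
    stay in every stable subspace and kill whatever the original element kills. The result is
    recorded as a finite list of bracket identities, [splits], which survive automorphisms,
    embeddings and representations; modules enter only through two criteria on Jordan blocks. The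
    adjoint action of g_0 may have a kernel, hence identities found in End(g) are lifted only up to
    elements acting by zero. *)

(** * Endomorphism rings and stable subspaces *)

HB.instance Definition _ (k : fieldType) (V : vectType k) :=
  GRing.Zmodule_isPzRing.Build 'End(V)
    (@comp_lfunA _ _ _ _ _) (@comp_lfun1l _ _ _) (@comp_lfun1r _ _ _)
    (@comp_lfunDl _ _ _ _) (@comp_lfunDr _ _ _ _).

Section Endomorphisms.
Variables (k : fieldType) (V : vectType k).
Implicit Types (f g : 'End(V)) (A : {vspace V}).

Lemma mulE f g v : (f * g) v = f (g v).
Proof. exact: comp_lfunE. Qed.

Lemma oneE v : (1 : 'End(V)) v = v.
Proof. exact: id_lfunE. Qed.

Lemma addE f g v : (f + g) v = f v + g v. Proof. exact: add_lfunE. Qed.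
Lemma oppE f v : (- f) v = - f v. Proof. exact: opp_lfunE. Qed.
Lemma scaleE c f v : (c *: f) v = c *: f v. Proof. exact: scale_lfunE. Qed.

Definition endE := (mulE, oneE, addE, oppE, scaleE).

Lemma exprE f n v : (f ^+ n) v = iter n f v.
Proof. by elim: n v => [|n IH] v; rewrite ?expr0 ?oneE // exprS mulE IH. Qed.

Lemma mulEZl c f g : (c *: f) * g = c *: (f * g).
Proof. exact/esym/comp_lfunZl. Qed.
Lemma mulEZr c f g : f * (c *: g) = c *: (f * g).
Proof. exact/esym/comp_lfunZr. Qed.

Definition stab f A := forall v, v \in A -> f v \in A.

Lemma stabP f A : (f @: A <= A)%VS <-> stab f A.
Proof.
split=> [sA v vA|sA]; first by apply: (subvP sA); apply: memv_img.
by apply/subvP=> _ /memv_imgP [v vA ->]; apply: sA.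
Qed.

Lemma stabM f g A : stab f A -> stab g A -> stab (f * g) A.
Proof. by move=> sf sg v vA; rewrite mulE; apply/sf/sg. Qed.
Lemma stabD f g A : stab f A -> stab g A -> stab (f + g) A.
Proof. by move=> sf sg v vA; rewrite addE rpredD ?sf ?sg. Qed.
Lemma stabN f A : stab f A -> stab (- f) A.
Proof. by move=> sf v vA; rewrite oppE rpredN sf. Qed.
Lemma stabZ c f A : stab f A -> stab (c *: f) A.
Proof. by move=> sf v vA; rewrite scaleE rpredZ ?sf. Qed.
Lemma stab1 A : stab 1 A. Proof. by move=> v vA; rewrite oneE. Qed.
Lemma stabX f n A : stab f A -> stab (f ^+ n) A.
Proof. by move=> sf; elim: n => [|n IH]; [exact: stab1|rewrite exprS; exact: stabM]. Qed.

(** Vectors satisfying [P] are adjoined to a subspace inside [P] until none is left; the dimension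
    bounds the number of steps. Subspaces described by arbitrary propositions are obtained from this
    lemma throughout. *)
Lemma vspace_of_pred (P : V -> Prop) :
  P 0 -> (forall c u v, P u -> P v -> P (c *: u + v)) ->
  exists U : {vspace V}, forall v, v \in U <-> P v.
Proof.
move=> P0 PL.
have H n : forall U : {vspace V}, (forall v, v \in U -> P v) ->
    (\dim {:V} - \dim U <= n)%N -> exists U' : {vspace V}, forall v, v \in U' <-> P v.
  elim: n => [|n IH] U UP dU.
    exists U => v; split; first exact: UP.
    suff -> : U = fullv by rewrite memvf.
    by apply/eqP; rewrite eqEdim subvf -subn_eq0 -leqn0.
  have [[v [Pv nUv]]|Hn] := classic (exists v, P v /\ v \notin U); last first.
    exists U => v; split; first exact: UP.
    by move=> Pv; apply/negPn/negP => nU; apply: Hn; exists v.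
  apply: (IH (<[v]> + U)%VS) => [w /memv_addP [w1 /vlineP [c ->] [w2 /UP P2 ->]]|].
    exact: PL.
  have dlt : (\dim U < \dim (<[v]> + U))%N.
    rewrite ltnNge; apply/negP => dle.
    have eU : U = (<[v]> + U)%VS by apply/eqP; rewrite eqEdim addvSr.
    by move: nUv; rewrite eU (subvP (addvSl _ _)) ?memv_line.
  move: dU; rewrite !leq_subLR => dU; apply: leq_trans dU _.
  by rewrite addnS -addSn leq_add2r.
apply: (H (\dim {:V}) 0%VS) => [v|]; last by rewrite leq_subr.
by rewrite memv0 => /eqP ->.
Qed.

(** Coordinates separate vectors. The functional is offered as a bare function with its linearity
    laws as equations, so that [vring] can push it through an expression and leave a scalar identity
    to [ring]. *)
Lemma vec_ext (u v : V) :
  (forall phi : V -> k, (forall a b, phi (a + b) = phi a + phi b) ->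
     (forall c a, phi (c *: a) = c * phi a) -> (forall a, phi (- a) = - phi a) ->
     phi 0 = 0 -> (forall a n, phi (a *+ n) = phi a *+ n) -> phi u = phi v) -> u = v.
Proof.
move=> H; rewrite (coord_vbasis (memvf u)) (coord_vbasis (memvf v)).
apply: eq_bigr => i _; congr (_ *: _); apply: H => *.
- exact: raddfD.
- exact: scalarZ.
- exact: raddfN.
- exact: raddf0.
- exact: raddfMn.
Qed.

Lemma eq_on_basis (W : vectType k) (phi psi : 'Hom(V, W)) b : basis_of {:V} b ->
  (forall v, v \in b -> phi v = psi v) -> phi = psi.
Proof.
move=> bb H; apply/lfunP => v.
have vb : v \in <<in_tuple b>>%VS by rewrite (span_basis bb) memvf.
rewrite (coord_span vb) !linear_sum.
by apply: eq_bigr => i _; rewrite !linearZ /= H // mem_nth.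
Qed.

End Endomorphisms.

(* Decides linear identities between vectors by evaluating arbitrary linear forms. *)
Ltac vring :=
  let phi := fresh "phi" in let pD := fresh in let pZ := fresh in let pN := fresh in
  let p0 := fresh in let pM := fresh in
  apply: vec_ext => phi pD pZ pN p0 pM; rewrite ?(pD, pZ, pN, p0, pM); ring.

(** * Polynomials in an endomorphism *)

Section PolynomialAction.
Variables (k : fieldType) (V : vectType k).
Implicit Types (f g : 'End(V)) (p q : {poly k}) (A : {vspace V}).

Definition pact f p : 'End(V) := \sum_(i < size p) p`_i *: f ^+ i.

Lemma pactE f p n : (size p <= n)%N -> pact f p = \sum_(i < n) p`_i *: f ^+ i.
Proof.
move=> pn; rewrite /pact (big_ord_widen _ (fun i => p`_i *: f ^+ i) pn) [RHS](bigID (fun i : 'I_n => (i < size p)%N)) /=.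
rewrite [X in _ = _ + X]big1 ?addr0 // => i; rewrite -leqNgt => /(nth_default 0) ->.
by rewrite scale0r.
Qed.

Lemma pact0 f : pact f 0 = 0.
Proof. by rewrite /pact size_poly0 big_ord0. Qed.

Lemma pactD f p q : pact f (p + q) = pact f p + pact f q.
Proof.
pose n := maxn (size p) (size q).
rewrite (@pactE _ _ n) ?size_polyD // (@pactE _ p n) ?leq_maxl // (@pactE _ q n) ?leq_maxr //.
by rewrite -big_split; apply: eq_bigr => i _; rewrite coefD scalerDl.
Qed.

Lemma pactZ f c p : pact f (c *: p) = c *: pact f p.
Proof.
rewrite (@pactE _ _ (size p)) ?size_scale_leq // /pact scaler_sumr.
by apply: eq_bigr => i _; rewrite coefZ scalerA.
Qed.

Lemma pactC f c : pact f c%:P = c *: (1 : 'End(V)).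
Proof.
by rewrite (@pactE _ _ 1) ?size_polyC_leq1 // big_ord1 coefC expr0.
Qed.

Lemma pact1 f : pact f 1 = 1.
Proof. by rewrite -[1]/(1%:P) pactC scale1r. Qed.

Lemma pactMX f p : pact f (p * 'X) = pact f p * f.
Proof.
rewrite (@pactE _ _ (size p).+1); last by rewrite (leq_trans (size_polyMleq _ _)) // size_polyX addn2.
rewrite big_ord_recl coefMX eqxx scale0r add0r /pact mulr_suml.
by apply: eq_bigr => i _; rewrite coefMX /= mulEZl -exprSr.
Qed.

Lemma pactX f : pact f 'X = f.
Proof. by rewrite -[X in pact _ X]mul1r pactMX pact1 mul1r. Qed.

Lemma pactN f p : pact f (- p) = - pact f p.
Proof. by rewrite -scaleN1r pactZ scaleN1r. Qed.

Lemma pactB f p q : pact f (p - q) = pact f p - pact f q.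
Proof. by rewrite pactD pactN. Qed.

Lemma pactM f p q : pact f (p * q) = pact f p * pact f q.
Proof.
elim/poly_ind: q => [|q c IH]; first by rewrite mulr0 pact0 mulr0.
rewrite mulrDr mulrA !pactD pactMX IH pactMX pactC mulrDr mulrA mulrC mul_polyC pactZ.
by rewrite mulEZr mulr1.
Qed.

Lemma pact_comm f p q : pact f p * pact f q = pact f q * pact f p.
Proof. by rewrite -!pactM mulrC. Qed.

Lemma pactXn f p n : pact f (p ^+ n) = pact f p ^+ n.
Proof. by elim: n => [|n IH]; rewrite ?expr0 ?pact1 // !exprS pactM IH. Qed.

Lemma pactXsub f c : pact f ('X - c%:P) = f - c *: (1 : 'End(V)).
Proof. by rewrite pactB pactX pactC. Qed.

Lemma pact_stab f p A : stab f A -> stab (pact f p) A.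
Proof.
move=> sf; rewrite /pact; elim/big_rec: _ => [v vA|i g _ IH].
  by rewrite zero_lfunE mem0v.
by apply: stabD => //; apply/stabZ/stabX.
Qed.

Lemma pact_comm_with f g p : f * g = g * f -> pact f p * g = g * pact f p.
Proof.
move=> fg; rewrite /pact mulr_suml mulr_sumr; apply: eq_bigr => i _.
rewrite mulEZl mulEZr; congr (_ *: _).
elim: (val i) => [|n IH]; first by rewrite expr0 mul1r mulr1.
by rewrite exprS -mulrA IH !mulrA fg.
Qed.

Lemma pact_eigen f p v c : f v = c *: v -> pact f p v = p.[c] *: v.
Proof.
move=> fv; elim/poly_ind: p => [|p d IH]; first by rewrite pact0 horner0 scale0r zero_lfunE.
rewrite pactD pactMX pactC !endE fv linearZ /= IH hornerMXaddC scalerDl.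
by rewrite scalerA mulrC.
Qed.

(** More powers of [f] are taken than the dimension of the endomorphism space, so they are
    dependent. *)
Lemma annihilating_poly f : exists2 p : {poly k}, p != 0 & pact f p = 0.
Proof.
pose n := (\dim {:'End(V)}).+1; pose X := mkseq (fun i => f ^+ i) n.
have nf : ~~ free X.
  by apply/negP => /eqP fr; have := dimvS (subvf <<X>>%VS); rewrite fr size_mkseq ltnn.
have [c [c0 [i ci]]] : exists c : 'I_n -> k, \sum_(i < n) c i *: f ^+ i = 0 /\ exists i, c i != 0.
  apply: NNPP => H; move/negP: nf; apply.
  have -> : X = tval (mktuple (fun i : 'I_n => f ^+ i)).
    apply: (@eq_from_nth _ 0); rewrite ?size_mkseq ?size_tuple // => i lt.
    by rewrite nth_mkseq // -(nth_mktuple (fun i : 'I_n => f ^+ i) 0 (Ordinal lt)).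
  apply/freeP => c cs i; apply/eqP; case: (eqVneq (c i) 0) => // ci; case: H; exists c; split; last by exists i.
  by rewrite -[RHS]cs; apply: eq_bigr => j _; rewrite nth_mktuple.
pose p := \poly_(i < n) (if insub i is Some j then c j else 0).
exists p.
  apply/eqP => /(congr1 (fun p : {poly k} => p`_i)); rewrite coef_poly coef0 ltn_ord valK.
  exact/eqP.
rewrite (@pactE _ _ n) ?size_poly // -[RHS]c0; apply: eq_bigr => j _.
by rewrite coef_poly ltn_ord valK.
Qed.

End PolynomialAction.

(** * Chinese remainders for powers of linear factors *)

Section ChineseRemainder.
Variable k : fieldType.
Implicit Types (p q : {poly k}) (rs : seq k).

Lemma coprime_XsubX (r s : k) M N : r != s ->
  coprimep (('X - r%:P) ^+ M) (('X - s%:P) ^+ N).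
Proof.
by move=> rs; apply/coprimep_expl/coprimep_expr; rewrite coprimep_XsubC root_XsubC eq_sym.
Qed.

Lemma coprime_Xsub_prod (r : k) M N rs : r \notin rs ->
  coprimep (('X - r%:P) ^+ M) (\prod_(s <- rs) ('X - s%:P) ^+ N).
Proof.
elim: rs => [|s rs IH]; first by rewrite big_nil coprimep1.
by rewrite inE negb_or => /andP [rs' /IH]; rewrite big_cons coprimepMr => ->; rewrite coprime_XsubX.
Qed.

Lemma prod_dvd N rs p : uniq rs ->
  (forall r, r \in rs -> ('X - r%:P) ^+ N %| p) -> \prod_(s <- rs) ('X - s%:P) ^+ N %| p.
Proof.
elim: rs => [|s rs IH] /=; first by rewrite big_nil dvd1p.
move=> /andP [sr u] H; rewrite big_cons Gauss_dvdp ?coprime_Xsub_prod //.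
by rewrite H ?mem_head //= IH // => r rr; apply: H; rewrite inE rr orbT.
Qed.

(** Induction on the nodes: with a Bezout relation [a W + b Q = 1] between the new factor [W] and
    the product [Q] of the old ones, [p a W + t(s) b Q] has the required residues at all nodes. *)
Lemma chinese_poly N rs (t : k -> k) : uniq rs ->
  exists p, forall r, r \in rs -> ('X - r%:P) ^+ N %| p - (t r)%:P.
Proof.
elim: rs => [|s rs IH] /=; first by exists 0.
move=> /andP [sr u]; have [p Hp] := IH u.
have /Bezout_eq1_coprimepP [[a b] /= ab] := coprime_Xsub_prod N N sr.
set W := ('X - s%:P) ^+ N in ab *; set Q := \prod_(j <- rs) _ in ab.
exists (p * (a * W) + (t s)%:P * (b * Q)) => r.
rewrite inE => /orP [/eqP ->|rr].
  have -> : p * (a * W) + (t s)%:P * (b * Q) - (t s)%:P = (p - (t s)%:P) * a * W.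
    by rewrite -[X in _ - X]mulr1 -ab; ring.
  exact: dvdp_mulIr.
have -> : p * (a * W) + (t s)%:P * (b * Q) - (t r)%:P = (p - (t r)%:P) + ((t s)%:P - p) * b * Q.
  have -> : a * W = 1 - b * Q by rewrite -ab addrK.
  by ring.
rewrite dvdp_add ?Hp // dvdp_mull // /Q.
rewrite (big_rem r) //=; exact: dvdp_mulIl.
Qed.

End ChineseRemainder.

(** * Generalized eigenspaces *)

Section Spectral.
Variables (k : closedFieldType) (V : vectType k).
Implicit Types (f g : 'End(V)) (p : {poly k}) (A : {vspace V}).

Definition shift_pow f (r : k) N := pact f (('X - r%:P) ^+ N).

Lemma shift_powE f r N : shift_pow f r N = (f - r *: (1 : 'End(V))) ^+ N.
Proof. by rewrite /shift_pow pactXn pactXsub. Qed.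

Lemma shift_powS f r N v : shift_pow f r N.+1 v = shift_pow f r N (f v - r *: v).
Proof. by rewrite !shift_powE exprSr mulE !endE. Qed.

(** The annihilating polynomial divides the product of the [N]-th powers of its distinct linear
    factors, [N] bounding every multiplicity. Zero is added to the roots so that interpolating
    polynomials can be made to lack a constant term. *)
Lemma spectral f : exists (rs : seq k) (N : nat), [/\ uniq rs, 0 \in rs, (0 < N)%N,
  forall p, (forall r, r \in rs -> ('X - r%:P) ^+ N %| p) -> pact f p = 0 &
  forall r M w, shift_pow f r M w = 0 -> if r \in rs then shift_pow f r N w = 0 else w = 0].
Proof.
have [q q0 fq] := annihilating_poly f.
have [zs qE] := closed_field_poly_normal q.
pose rs := undup (0 :: zs); pose N := (size zs).+1.
pose Q := \prod_(r <- rs) ('X - r%:P) ^+ N.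
have qQ : q %| Q.
  rewrite qE dvdpZl ?lead_coef_eq0 //.
  apply: (@dvdp_trans _ (\prod_(z <- 0 :: zs) ('X - z%:P))).
    by rewrite big_cons dvdp_mulIr.
  rewrite -big_undup_iterop_count /Q /rs.
  elim/big_rec2: _ => [|i a b _ IH]; first exact: dvdpp.
  by rewrite dvdp_mul // -/(('X - i%:P) ^+ _) dvdp_exp2l // /N -[X in (_ <= X)%N]/(size (0 :: zs)) count_size.
have fQ : pact f Q = 0.
  by move/dvdpP: qQ => [a ->]; rewrite pactM fq mulr0.
have urs : uniq rs by apply: undup_uniq.
exists rs, N; split=> // [|p Hp|r M w fw].
- by rewrite mem_undup mem_head.
- by have /dvdpP [a ->] := prod_dvd urs Hp; rewrite pactM fQ mulr0.
case: ifP => [rr|/negbT nr]; last first.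
  have /Bezout_eq1_coprimepP [[a b] /= ab] := coprime_Xsub_prod M N nr.
  rewrite -[w]oneE -(pact1 f) -ab pactD !pactM !endE.
  by rewrite -/(shift_pow f r M) fw linear0 -/Q fQ zero_lfunE linear0 addr0.
have nr : r \notin rem r rs by rewrite mem_rem_uniqF.
have /Bezout_eq1_coprimepP [[a b] /= ab] := coprime_Xsub_prod M N nr.
rewrite -[w]oneE -(pact1 f) -ab pactD !pactM !endE -/(shift_pow f r M) fw linear0 add0r.
have := fQ; rewrite /Q (big_rem r) //= => /lfunP/(_ w).
set Q' := \prod_(_ <- _) _ => fQ'.
transitivity (pact f (b * (('X - r%:P) ^+ N * Q')) w).
  by rewrite /shift_pow -!mulE -!pactM; congr (pact f _ w); ring.
by rewrite pactM mulE fQ' zero_lfunE linear0.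
Qed.

Lemma dvd_pact f p q v : p %| q -> pact f p v = 0 -> pact f q v = 0.
Proof. by move=> /dvdpP [a ->] fp; rewrite pactM mulE fp linear0. Qed.

Definition geigen f (r : k) v := exists M, shift_pow f r M v = 0.

(** Interpolation of [t] at the eigenvalues modulo high powers. Zero is one of the nodes and
    [t 0 = 0], which removes the constant term. These are Chevalley's replicas of [f]. *)
Lemma replica f (t : k -> k) : t 0 = 0 -> exists p, p`_0 = 0 /\
  (forall r v, geigen f r v -> pact f p v = t r *: v).
Proof.
move=> t0; have [rs [N [urs r0 N0 fQ H]]] := spectral f.
have [p Hp] := chinese_poly N t urs.
exists p; split.
  have d := Hp 0 r0; rewrite t0 polyC0 !subr0 in d.
  have : 'X - 0%:P %| p by rewrite subr0; apply: dvdp_trans d; rewrite -{1}['X]expr1 dvdp_exp2l.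
  by rewrite dvdp_XsubCl /root horner_coef0 => /eqP.
move=> r v [M fv]; have := H r M v fv; case: ifP => [rr fN|_ ->]; last by rewrite linear0 scaler0.
have : pact f (p - (t r)%:P) v = 0 by apply: dvd_pact (Hp r rr) fN.
by rewrite pactB pactC !endE => /eqP; rewrite subr_eq0 => /eqP.
Qed.

(** Interpolating the indicator function of each eigenvalue gives the spectral projections as
    polynomials in [f]; hence they preserve stable subspaces and commute with everything commuting
    with [f]. *)
Lemma geigen_decomp f : exists (rs : seq k) (P : k -> {poly k}), [/\ uniq rs,
  forall v, v = \sum_(r <- rs) pact f (P r) v,
  forall r v, r \in rs -> geigen f r (pact f (P r) v) &
  forall r v, geigen f r v -> if r \in rs then pact f (P r) v = v else v = 0].
Proof.
have [rs [N [urs r0 N0 fQ H]]] := spectral f.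
have Pex r : exists p, forall s, s \in rs -> ('X - s%:P) ^+ N %| p - (s == r)%:R%:P.
  exact: (chinese_poly N (fun s => (s == r)%:R) urs).
pose P r := sval (constructive_indefinite_description _ (Pex r)).
have HP r := svalP (constructive_indefinite_description _ (Pex r)).
exists rs, P; split=> // [v|r v rr|r v [M fv]].
- have -> : \sum_(r <- rs) pact f (P r) v = pact f (\sum_(r <- rs) P r) v.
    by elim/big_rec2: _ => [|r a b _ ->]; rewrite ?pact0 ?zero_lfunE // pactD addE.
  apply/eqP; rewrite -{1}[v]oneE -(pact1 f) -subr_eq0 -oppE -pactN -addE -pactD; apply/eqP.
  rewrite fQ ?zero_lfunE // => s sr.
  have -> : 1 - \sum_(r <- rs) P r = - \sum_(r <- rs) (P r - (s == r)%:R%:P).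
    rewrite sumrB (_ : \sum_(r <- rs) ((s == r)%:R)%:P = 1 :> {poly k}) ?opprB //.
    rewrite (bigD1_seq s) //= eqxx big1 ?addr0 // => r ns.
    by rewrite eq_sym (negPf ns) polyC0.
  rewrite dvdpNr; elim/big_ind: _ => [|a b|r _]; rewrite ?dvdp0 //; [exact: dvdp_add|exact: HP].
- exists N; rewrite /shift_pow -mulE -pactM fQ ?zero_lfunE // => s sr.
  have [->|ns] := eqVneq s r; first exact: dvdp_mulIl.
  by have := HP r s sr; rewrite (negPf ns) polyC0 subr0 => d; apply: dvdp_mull.
have := H r M v fv; case: ifP => // rr fN.
have : pact f (P r - 1) v = 0 by apply: dvd_pact fN; have := HP r r rr; rewrite eqxx.
by rewrite pactB pact1 !endE => /eqP; rewrite subr_eq0 => /eqP.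
Qed.

End Spectral.

(** * Diagonalizable and nilpotent endomorphisms *)

Section Diagonalizable.
Variables (k : closedFieldType) (V : vectType k).
Implicit Types (f g : 'End(V)) (p : {poly k}) (A : {vspace V}).

Definition nilp f := exists n, f ^+ n = 0.

(** Diagonalizability is tested vector by vector and relative to a subspace, a form that restricts
    to stable subspaces without choosing bases. *)
Definition eigsum f A v := exists (rs : seq k) (w : k -> V), [/\ uniq rs,
  v = \sum_(r <- rs) w r & forall r, f (w r) = r *: w r /\ w r \in A].

Definition diagz f := forall v, eigsum f fullv v.

(** Applying [f - s] removes the component of eigenvalue [s] and multiplies the others by nonzero
    scalars, whence an induction on the number of components. *)
Lemma eig_extract f A rs (w : k -> V) : uniq rs -> stab f A ->
  (forall r, f (w r) = r *: w r) -> \sum_(r <- rs) w r \in A ->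
  forall r, r \in rs -> w r \in A.
Proof.
move=> u sA; elim: rs w u => [//|s rs IH] w /= /andP [sr u] fw SA r.
have wA r' : r' \in rs -> w r' \in A.
  move=> r'rs; have : (r' - s) *: w r' \in A.
    apply: (IH (fun r => (r - s) *: w r)) => // [t|].
      by rewrite linearZ /= fw !scalerA mulrC.
    have := rpredB (sA _ SA) (rpredZ s SA); rewrite linear_sum scaler_sumr -sumrB big_cons /=.
    rewrite fw subrr add0r; congr (_ \in A); apply: eq_bigr => t _.
    by rewrite fw scalerBl.
  rewrite rpredZeq subr_eq0 => /orP [/eqP e|//].
  by move: sr; rewrite -e r'rs.
rewrite inE => /orP [/eqP ->|]; last exact: wA.
move: SA; rewrite big_cons rpredDr // big_seq_cond; apply: rpred_sum => t /andP [tr _].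
exact: wA.
Qed.

Lemma eigsum_eig f A r v : v \in A -> f v = r *: v -> eigsum f A v.
Proof.
move=> vA fv; exists [:: r], (fun s => if s == r then v else 0); split=> //.
  by rewrite big_seq1 eqxx.
move=> s; case: eqP => [->//|_]; by rewrite linear0 scaler0 mem0v.
Qed.

Lemma eigsum0 f A : eigsum f A 0.
Proof. by apply: (@eigsum_eig _ _ 0); rewrite ?mem0v // linear0 scaler0. Qed.

Lemma eigsumD f A u v : eigsum f A u -> eigsum f A v -> eigsum f A (u + v).
Proof.
have widen rs rs' (w : k -> V) : uniq rs -> uniq rs' -> {subset rs <= rs'} ->
    \sum_(r <- rs) w r = \sum_(r <- rs') (if r \in rs then w r else 0).
  move=> u1 u2 s12; rewrite -big_mkcond /= -[RHS]big_filter; apply: perm_big.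
  apply: uniq_perm; rewrite ?filter_uniq // => x; rewrite mem_filter.
  by case: (boolP (x \in rs)) => // /s12 ->.
move=> [r1 [w1 [u1 -> H1]]] [r2 [w2 [u2 -> H2]]].
pose rs := undup (r1 ++ r2).
exists rs, (fun r => (if r \in r1 then w1 r else 0) + (if r \in r2 then w2 r else 0)); split.
- exact: undup_uniq.
- by rewrite big_split -!widen ?undup_uniq // => x; rewrite mem_undup mem_cat => ->; rewrite ?orbT.
move=> r; have [[a1 b1] [a2 b2]] := (H1 r, H2 r).
by case: ifP; case: ifP => _ _; rewrite linearD ?linear0 /= ?a1 ?a2 scalerDr ?scaler0 rpredD ?mem0v.
Qed.

Lemma eigsum_sum f A (I : Type) (s : seq I) (P : pred I) (F : I -> V) :
  (forall i, P i -> eigsum f A (F i)) -> eigsum f A (\sum_(i <- s | P i) F i).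
Proof.
by move=> H; elim/big_ind: _ => [|u v|//]; [exact: eigsum0|exact: eigsumD].
Qed.

Lemma diag_eigsum f A v : diagz f -> stab f A -> v \in A -> eigsum f A v.
Proof.
move=> df sA vA; have [rs [w [u e H]]] := df v.
rewrite e; rewrite big_seq; apply: eigsum_sum => r rr.
apply: (@eigsum_eig _ _ r); last by case: (H r).
by apply: (eig_extract u sA) => // [s|]; [case: (H s)|rewrite -e].
Qed.

(** Induction on the factors: the components of [f v - s v], divided by [r - s] and subtracted from
    [v], leave an eigenvector of eigenvalue [s]. *)
Lemma prod_eigsum f A rs v : uniq rs -> stab f A -> v \in A ->
  pact f (\prod_(r <- rs) ('X - r%:P)) v = 0 ->
  exists w : k -> V, v = \sum_(r <- rs) w r /\ forall r, f (w r) = r *: w r /\ w r \in A.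
Proof.
move=> u sA; elim: rs u v => [|s rs IH] /= u v vA.
  rewrite big_nil pact1 oneE => ->; exists (fun _ => 0); split; first by rewrite big_nil.
  by move=> r; rewrite linear0 scaler0 mem0v.
move: u => /andP [sr u]; rewrite big_cons mulrC pactM mulE pactXsub !endE => H.
have [|w [e Hw]] := IH u (f v - s *: v) _ H; first by rewrite rpredB ?sA ?rpredZ.
pose w1 r := if r \in rs then (r - s)^-1 *: w r else 0.
have w1P r : f (w1 r) = r *: w1 r /\ w1 r \in A.
  rewrite /w1; case: ifP => _; last by rewrite linear0 scaler0 mem0v.
  by have [a b] := Hw r; rewrite linearZ /= a !scalerA mulrC; split=> //; apply: rpredZ.
pose w2 := v - \sum_(r <- rs) w1 r.
have fw2 : f w2 = s *: w2.
  have e1 : f (\sum_(r <- rs) w1 r) - s *: \sum_(r <- rs) w1 r = f v - s *: v.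
    rewrite e linear_sum scaler_sumr -sumrB big_seq [RHS]big_seq /=; apply: eq_bigr => r rr.
    have [-> _] := w1P r; rewrite -scalerBl /w1 rr scalerA divff ?scale1r // subr_eq0.
    by apply: contraNneq sr => <-.
  rewrite /w2 linearB /=; move: (f v) (f _) e1 => a b e1.
  have -> : a = b - s *: \sum_(r <- rs) w1 r + s *: v by rewrite e1 subrK.
  by vring.
exists (fun r => if r == s then w2 else w1 r); split.
  rewrite big_cons eqxx /w2 -[LHS](subrK (\sum_(r <- rs) w1 r)); congr (_ + _).
  by rewrite big_seq [RHS]big_seq; apply: eq_bigr => r rr; case: eqP => // e'; rewrite -e' rr in sr.
move=> r; case: eqP => [->|_]; last exact: w1P.
by split=> //; rewrite /w2 rpredB // rpred_sum // => t _; case: (w1P t).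
Qed.

Lemma mkhom (K : fieldType) (U W : vectType K) (F : U -> W) : linear F ->
  {f : 'Hom(U, W) | forall v, f v = F v}.
Proof.
move=> linF; pose flM := GRing.isLinear.Build _ _ _ _ F linF.
by pose fL : {linear U -> W} := HB.pack F flM; exists (linfun fL) => v; rewrite lfunE.
Qed.

Lemma nilpP f : (forall v, exists n, iter n f v = 0) -> nilp f.
Proof.
move=> H; pose n v := sval (constructive_indefinite_description _ (H v)).
have nP v : iter (n v) f v = 0 := svalP (constructive_indefinite_description _ (H v)).
pose N := \sum_(v <- vbasis {:V}) n v.
exists N; apply: (eq_on_basis (vbasisP fullv)) => v vb.
have -> : N = (N - n v + n v)%N by rewrite subnK // /N (big_rem v) //= leq_addr.
by rewrite exprE iterD nP zero_lfunE -exprE linear0.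
Qed.

Lemma nilpM f g : f * g = g * f -> nilp f -> nilp (f * g).
Proof. by move=> fg [m fm]; exists m; rewrite exprMn_comm // fm mul0r. Qed.

(** The semisimple part is the replica of [f] for the identity function of the eigenvalues. *)
Lemma jordan_chevalley f : exists p : {poly k},
  [/\ p`_0 = 0, diagz (pact f p), nilp (f - pact f p) &
      forall r v, geigen f r v -> pact f p v = r *: v].
Proof.
have [p [p0 Hp]] := @replica _ _ f id (erefl _).
have [rs [P [urs vE Pg _]]] := geigen_decomp f.
exists p; split=> // [v|].
  rewrite {1}[v]vE big_seq; apply: eigsum_sum => r rr.
  apply: (@eigsum_eig _ _ r); rewrite ?memvf //.
  exact/Hp/Pg.
apply: nilpP => v; rewrite [v]vE.
have H r : r \in rs -> exists n, iter n (f - pact f p) (pact f (P r) v) = 0.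
  move=> rr; have [M HM] := Pg r v rr; exists M.
  move: (pact f (P r) v) HM => w; elim: M w => [|M IH] w.
    by rewrite /shift_pow expr0 pact1 oneE.
  rewrite shift_powS => Hw; rewrite iterSr; apply: etrans (IH _ Hw).
  have gw : geigen f r w by exists M.+1; rewrite shift_powS.
  by rewrite !endE (Hp r w gw).
move: (f - _) H => g; elim: rs {urs vE Pg} => [|r rs IH] H; first by exists 0; rewrite big_nil.
have [n Hn] := IH (fun t tr => H t (@mem_behead _ (r :: rs) t tr)); have [m Hm] := H r (mem_head _ _).
exists (n + m)%N; rewrite big_cons -exprE linearD /= !exprE iterD Hm addnC iterD Hn.
by rewrite -!exprE !linear0 addr0.
Qed.

Lemma diag_ker_im f A v : diagz f -> stab f A -> v \in A ->
  exists u w, [/\ u \in A, w \in A, f u = 0 & v = u + f w].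
Proof.
move=> df sA vA; have [rs [w [u e H]]] := diag_eigsum df sA vA.
exists (\sum_(r <- rs | r == 0) w r), (\sum_(r <- rs | r != 0) r^-1 *: w r); split.
- by apply: rpred_sum => r _; case: (H r).
- by apply: rpred_sum => r _; apply: rpredZ; case: (H r).
- by rewrite linear_sum; apply: big1 => r /eqP -> /=; have [-> _] := H 0; rewrite scale0r.
rewrite e (bigID (fun r => r == 0)) /=; congr (_ + _); rewrite linear_sum; apply: eq_bigr => r r0 /=.
by have [e' _] := H r; rewrite linearZ /= e' scalerA mulVf ?scale1r.
Qed.

Lemma diag_ker2 f w : diagz f -> f (f w) = 0 -> f w = 0.
Proof.
move=> df; have [rs [u [urs e H]]] := df w; rewrite e !linear_sum => H0.
have H' r : r \in rs -> r ^+ 2 *: u r = 0.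
  move=> rr; apply/eqP; rewrite -memv0.
  apply: (@eig_extract f _ rs (fun r => r ^+ 2 *: u r)) => // [v|s|].
  - by rewrite memv0 => /eqP ->; rewrite linear0 mem0v.
  - by have [e' _] := H s; rewrite linearZ /= e' !scalerA mulrC.
  rewrite memv0 -[X in _ == X]H0; apply/eqP; apply: eq_bigr => s _ /=.
  by have [e' _] := H s; rewrite e' linearZ /= e' scalerA.
rewrite big_seq; apply: big1 => r rr; have [e' _] := H r; rewrite /= e'.
have /eqP := H' r rr; rewrite scaler_eq0 expf_eq0 /= => /orP [/eqP ->|/eqP ->]; by rewrite ?scale0r ?scaler0.
Qed.

Definition eigenv f r : {vspace V} := lker (f - r *: (1 : 'End(V))).

Lemma eigenvP f r v : (v \in eigenv f r) = (f v == r *: v).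
Proof. by rewrite memv_ker !endE subr_eq0. Qed.

Lemma comm_eigenv f g r : f * g = g * f -> stab g (eigenv f r).
Proof.
move=> fg v; rewrite !eigenvP => /eqP fv.
by rewrite -mulE fg mulE fv linearZ.
Qed.

Lemma comm_ker f g : f * g = g * f -> stab g (lker f).
Proof. by move=> fg v; rewrite !memv_ker => /eqP fv; rewrite -mulE fg mulE fv linear0. Qed.

Lemma eigenvalues_finite f : exists rs : seq k, forall r v, f v = r *: v -> v != 0 -> r \in rs.
Proof.
have [rs [N [_ _ _ _ H]]] := spectral f; exists rs => r v fv v0.
have := H r 1%N v; rewrite shift_powE expr1 !endE fv subrr => /(_ erefl).
by case: ifP => // _ v0'; rewrite v0' eqxx in v0.
Qed.

Lemma diag_comb f g c : diagz f -> diagz g -> f * g = g * f -> diagz (f + c *: g).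
Proof.
move=> df dg fg v; have [rs [w [urs -> H]]] := df v.
apply: eigsum_sum => r _; have [fw _] := H r.
have wE : w r \in eigenv f r by rewrite eigenvP fw.
have [rs' [w' [_ -> H']]] := diag_eigsum dg (comm_eigenv fg) wE.
apply: eigsum_sum => s _; have [gw] := H' s; rewrite eigenvP => /eqP fw'.
by apply: (@eigsum_eig _ _ (r + c * s)); rewrite ?memvf // !endE gw fw' scalerA scalerDl.
Qed.

End Diagonalizable.

(** * Consequences of characteristic zero *)

Section CharacteristicZero.
Variables (k : closedFieldType) (V : vectType k).
Implicit Types (f g : 'End(V)) (A : {vspace V}).
Hypothesis char0 : [pchar k] =i pred0.

Lemma natf_neq0 n : (n.+1%:R : k) != 0.
Proof. by have /pcharf0P -> := char0. Qed.

Lemma natf_inj m n : (m%:R : k) = n%:R -> m = n.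
Proof.
wlog le : m n / (m <= n)%N.
  by move=> H e; have [le|/ltnW le] := leqP m n; [apply: H|apply/esym/H].
move/eqP; rewrite eq_sym -subr_eq0 -natrB // (pcharf0P _).1 // subn_eq0 => le'.
by apply/eqP; rewrite eqn_leq le le'.
Qed.

Lemma nat_avoid (s : seq k) : exists n, (n.+1%:R : k) \notin s.
Proof.
apply: NNPP => H; pose t := mkseq (fun n => n.+1%:R : k) (size s).+1.
have ut : uniq t by apply/mkseq_uniqP => i j _ _ /natf_inj [].
have ts : {subset t <= s}.
  move=> x /mapP [n _ ->]; apply/negPn/negP => ns; apply: H; by exists n.
by have := uniq_leq_size ut ts; rewrite size_mkseq ltnn.
Qed.

Lemma commutator_hom (h : 'End(V)) : {T : 'End(hom V V) | forall b, T b = h * b - b * h}.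
Proof.
apply: mkhom => c a b; rewrite mulrDr mulrDl mulEZl mulEZr.
by vring.
Qed.

(** The powers [a ^+ n] are eigenvectors of the commutator with [h] for the pairwise distinct
    eigenvalues [n c], so they cannot all be nonzero. *)
Lemma shift_nilp (h a : 'End(V)) (c : k) : h * a - a * h = c *: a -> c != 0 -> nilp a.
Proof.
move=> ha c0.
have [T TE] := commutator_hom h.
have Tn n : T (a ^+ n) = (n%:R * c) *: a ^+ n.
  elim: n => [|n IH]; first by rewrite TE expr0 mulr1 mul1r subrr mul0r scale0r.
  rewrite TE exprS; move: IH; rewrite TE => IH.
  have -> : h * (a * a ^+ n) - a * a ^+ n * h = (h * a - a * h) * a ^+ n + a * (h * a ^+ n - a ^+ n * h).
    by rewrite mulrBl mulrBr !mulrA addrA subrK.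
  by rewrite ha IH mulEZl mulEZr -scalerDl; congr (_ *: _); rewrite -natr1; ring.
have [rs H] := eigenvalues_finite T.
have Hn n : a ^+ n != 0 -> n%:R * c \in rs by move=> an; apply: H (Tn n) an.
apply: NNPP => nn.
have ut : uniq (mkseq (fun n => n%:R * c) (size rs).+1).
  by apply/mkseq_uniqP => i j _ _ /(mulIf c0) /natf_inj.
have := uniq_leq_size ut; rewrite size_mkseq => /(_ rs).
rewrite ltnn => Hs; have : false; last by [].
apply: Hs => x /mapP [n _ ->]; apply: Hn.
by apply: contra_notN nn => /eqP an; exists n.
Qed.

(** The integer [n + 1] is chosen outside the finitely many ratios [- a / b] of eigenvalues of [f]
    and [g], so the combination has no accidental kernel on joint eigenvectors. *)
Lemma joint_ker f g : diagz f -> diagz g -> f * g = g * f ->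
  exists n : nat, forall v, (f + n.+1%:R *: g) v = 0 -> f v = 0 /\ g v = 0.
Proof.
move=> df dg fg; have [rf Hf] := eigenvalues_finite f; have [rg Hg] := eigenvalues_finite g.
have [n Hn] := nat_avoid [seq - a / b | a <- rf, b <- rg].
exists n => v Hv; pose B := lker (f + n.+1%:R *: g).
have vB : v \in B by rewrite memv_ker Hv.
have cf : stab f B by apply: comm_ker; rewrite mulrDl mulrDr mulEZl mulEZr fg.
have [rs [w [_ vE H]]] := diag_eigsum df cf vB.
suff Hw r : f (w r) = 0 /\ g (w r) = 0.
  by rewrite vE !linear_sum; split; apply: big1 => r _; case: (Hw r).
have [fw] := H r; rewrite memv_ker !endE fw => /eqP e.
have gw : g (w r) = (- r / n.+1%:R) *: w r.
  have -> : g (w r) = n.+1%:R^-1 *: (n.+1%:R *: g (w r)) by rewrite scalerA mulVf ?natf_neq0 ?scale1r.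
  move/eqP: e; rewrite addrC addr_eq0 => /eqP ->.
  by rewrite -scaleNr scalerA mulrC.
have [w0|w0] := eqVneq (w r) 0; first by rewrite w0 !linear0.
have r0 : r = 0.
  apply/eqP/negPn/negP => r0; move/negP: Hn; apply; apply/allpairsP.
  exists (r, - r / n.+1%:R); split; [exact: Hf fw w0|exact: Hg gw w0|] => /=.
  by field; rewrite addrC natr1 natf_neq0 oppr_eq0 r0.
by rewrite gw r0 oppr0 mul0r !scale0r.
Qed.

End CharacteristicZero.

(** * Rational linear functionals on finite sets of scalars *)

Section RationalEmbedding.
Variable (F : fieldType).
Hypothesis char0 : [pchar F] =i pred0.

Lemma intf_eq0 (z : int) : (z%:~R == 0 :> F) = (z == 0).
Proof.
have H n : (n%:R == 0 :> F) = (n == 0)%N by move/pcharf0P: char0; apply.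
by case: z => n; rewrite ?NegzE ?mulrNz ?oppr_eq0 -pmulrn H.
Qed.

Lemma ratr_div (a b : int) : b != 0 -> ratr (a%:~R / b%:~R) = a%:~R / b%:~R :> F.
Proof.
move=> b0; set x : rat := _ / _.
have bq : (b%:~R : rat) != 0 by rewrite intr_eq0.
have dq : ((denq x)%:~R : rat) != 0 by rewrite intr_eq0 denq_neq0.
have /eqP : numq x * b = a * denq x.
  apply: (@intr_inj rat); rewrite !intrM; apply: (mulIf (invr_neq0 bq)).
  by rewrite mulfK // -mulrA mulrCA -/x {1}numqE mulrC.
rewrite /ratr -(inj_eq (@intr_inj rat)) => /eqP/intr_inj e.
by apply/eqP; rewrite eqr_div ?intf_eq0 ?denq_neq0 // -!intrM e.
Qed.

Lemma ratrD x y : ratr (x + y) = ratr x + ratr y :> F.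
Proof.
have [dx dy] := (denq_neq0 x, denq_neq0 y).
have -> : x + y = (numq x * denq y + numq y * denq x)%:~R / (denq x * denq y)%:~R.
  rewrite -{1}[x]divq_num_den -{1}[y]divq_num_den intrD !intrM.
  by field; rewrite !intr_eq0 dx dy.
rewrite ratr_div ?mulf_neq0 // /ratr intrD !intrM.
by field; rewrite !intf_eq0 dx dy.
Qed.

Lemma ratrM x y : ratr (x * y) = ratr x * ratr y :> F.
Proof.
have [dx dy] := (denq_neq0 x, denq_neq0 y).
have -> : x * y = (numq x * numq y)%:~R / (denq x * denq y)%:~R.
  by rewrite -{1}[x]divq_num_den -{1}[y]divq_num_den !intrM invfM mulrACA.
by rewrite ratr_div ?mulf_neq0 // /ratr !intrM invfM mulrACA.
Qed.

Lemma ratr0 : ratr 0 = 0 :> F. Proof. exact: (ratr_nat F 0). Qed.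
Lemma ratr1 : ratr 1 = 1 :> F. Proof. exact: (ratr_nat F 1). Qed.

Lemma ratr_sum (I : Type) (s : seq I) (G : I -> rat) :
  ratr (\sum_(i <- s) G i) = \sum_(i <- s) ratr (G i) :> F.
Proof.
elim: s => [|i s IH]; first by rewrite !big_nil ratr0.
by rewrite !big_cons ratrD IH.
Qed.

(** [R] is the space of rational relations among the entries of [rs]. Reducing the unit vectors
    modulo [R] and reading a coordinate in which the class of [r0] survives gives a functional
    compatible with all relations. *)
Lemma rational_functional (rs : seq F) r0 : r0 \in rs -> r0 != 0 -> uniq rs ->
  exists th : F -> rat, th r0 != 0 /\
    forall c : F -> rat, \sum_(r <- rs) ratr (c r) * r = 0 -> \sum_(r <- rs) c r * th r = 0.
Proof.
move=> r0s r00 urs; pose n := size rs.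
have [R RP] : exists R : {vspace 'rV[rat]_n}, forall v, v \in R <->
    \sum_(i < n) ratr (v 0 i) * rs`_i = 0.
  apply: vspace_of_pred => [|c u v Hu Hv].
    by apply: big1 => i _; rewrite mxE ratr0 mul0r.
  have -> : \sum_(i < n) ratr ((c *: u + v) 0 i) * rs`_i =
     ratr c * (\sum_(i < n) ratr (u 0 i) * rs`_i) + \sum_(i < n) ratr (v 0 i) * rs`_i.
    by rewrite mulr_sumr -big_split; apply: eq_bigr => i _; rewrite !mxE ratrD ratrM /=; ring.
  by rewrite Hu Hv mulr0 addr0.
pose del r : 'rV[rat]_n := \row_i (index r rs == i)%:R.
have dE r : r \in rs -> \sum_(i < n) ratr (del r 0 i) * rs`_i = r.
  move=> rr; have lt : (index r rs < n)%N by rewrite index_mem.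
  rewrite (bigD1 (Ordinal lt)) //= big1 => [|i ni]; last first.
    rewrite mxE; case: (index r rs =P i) ni => [e|_ _]; last by rewrite mulr0n ratr0 mul0r.
    by case/eqP; apply/val_inj; rewrite /= -e.
  by rewrite mxE eqxx mulr1n ratr1 mul1r addr0 nth_index.
pose g w := w - projv R w.
have gR w : w \in R -> g w = 0 by move=> wR; rewrite /g projv_id ?subrr.
have [j gj] : exists j, (g (del r0)) 0 j != 0.
  apply: NNPP => H; have /RP : del r0 \in R; last by rewrite dE //; apply/eqP.
  have -> : del r0 = projv R (del r0).
    apply/eqP; rewrite -subr_eq0; apply/eqP/rowP => j; rewrite [RHS]mxE.
    by apply/eqP/negPn/negP => gj; apply: H; exists j.
  by rewrite memv_proj.
pose th r := g (del r) 0 j.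
exists th; split=> // c Hc; pose v := \sum_(r <- rs) c r *: del r.
have vR : v \in R.
  apply/RP; rewrite -[RHS]Hc.
  transitivity (\sum_(r <- rs) \sum_(i < n) ratr (c r) * (ratr (del r 0 i) * rs`_i)).
    rewrite exchange_big; apply: eq_bigr => i _ /=.
    by rewrite /v summxE ratr_sum mulr_suml; apply: eq_bigr => r _; rewrite !mxE ratrM mulrA.
  rewrite big_seq [RHS]big_seq; apply: eq_bigr => r rr.
  by rewrite -mulr_sumr dE.
transitivity (g v 0 j); last by rewrite gR // mxE.
rewrite /g /v linear_sum -sumrB summxE; apply: eq_bigr => r _.
by rewrite linearZ /= -scalerBr mxE.
Qed.

End RationalEmbedding.

(** * Traces of endomorphisms *)

Section Trace.
Import VectorInternalTheory.
Variables (k : closedFieldType) (V : vectType k).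
Implicit Types (f g : 'End(V)) (p : {poly k}) (A : {vspace V}).

Definition tr f : k := \tr (f2mx f).

Lemma f2mxE f u : f (r2v u) = r2v (u *m f2mx f).
Proof. by rewrite unlock /= r2vK. Qed.

Lemma f2mxM f g : f2mx (f * g) = f2mx g *m f2mx f.
Proof.
apply/row_matrixP => i; rewrite !rowE mulmxA; apply: (can_inj r2vK).
by rewrite -!f2mxE mulE.
Qed.

Lemma f2mx0 : f2mx (0 : 'End(V)) = 0.
Proof.
apply/row_matrixP => i; rewrite !rowE mulmx0; apply: (can_inj r2vK).
by rewrite -!f2mxE zero_lfunE linear0.
Qed.

Lemma f2mx1 : f2mx (1 : 'End(V)) = 1%:M.
Proof.
apply/row_matrixP => i; rewrite !rowE mulmx1; apply: (can_inj r2vK).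
by rewrite -!f2mxE oneE.
Qed.

Lemma trM f g : tr (f * g) = tr (g * f).
Proof. by rewrite /tr !f2mxM mxtrace_mulC. Qed.

Lemma trD f g : tr (f + g) = tr f + tr g.
Proof.
rewrite /tr -mxtraceD; congr (\tr _); apply/row_matrixP => i; rewrite !rowE mulmxDr.
by apply: (can_inj r2vK); rewrite linearD /= -!f2mxE addE.
Qed.

Lemma trZ c f : tr (c *: f) = c * tr f.
Proof.
rewrite /tr -mxtraceZ; congr (\tr _); apply/row_matrixP => i; rewrite !rowE -scalemxAr.
by apply: (can_inj r2vK); rewrite linearZ /= -!f2mxE scaleE.
Qed.

Lemma trN f : tr (- f) = - tr f. Proof. by rewrite -scaleN1r trZ mulN1r. Qed.
Lemma tr0 : tr 0 = 0. Proof. by rewrite -(scale0r 0) trZ mul0r. Qed.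
Lemma tr_sum (I : Type) (s : seq I) (G : I -> 'End(V)) : tr (\sum_(i <- s) G i) = \sum_(i <- s) tr (G i).
Proof. by elim: s => [|i s IH]; rewrite ?big_nil ?tr0 // !big_cons trD IH. Qed.

Lemma f2mxX f n : f2mx (f ^+ n) = (f2mx f) ^+ n.
Proof.
elim: n => [|n IH]; first by rewrite !expr0 f2mx1.
by rewrite exprSr f2mxM exprS -IH.
Qed.

(** All eigenvalues vanish, so the characteristic polynomial is a power of the variable, and its
    coefficient equal to minus the trace is zero. *)
Lemma mx_nilp_trace n (M : 'M[k]_n) N : M ^+ N = 0 -> \tr M = 0.
Proof.
case: n M => [|n] M MN; first by rewrite /mxtrace big_ord0.
have [zs zE] := closed_field_poly_normal (char_poly M).
rewrite (monicP (char_poly_monic M)) scale1r in zE.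
have z0 z : z \in zs -> z = 0.
  move=> zz; have : root (char_poly M) z by rewrite zE root_prod_XsubC.
  rewrite -eigenvalue_root_char => /eigenvalueP [v vM v0].
  have : v *m (M ^+ N) = z ^+ N *: v.
    elim: N {MN} => [|N IH]; first by rewrite !expr0 mulmx1 scale1r.
    by rewrite exprSr mulmxA IH -scalemxAl vM scalerA exprSr.
  rewrite MN mulmx0 => /esym/eqP; rewrite scaler_eq0 (negPf v0) orbF expf_eq0.
  by case/andP => _ /eqP.
have sz : size zs = n.+1.
  have := size_char_poly M; rewrite zE size_prod_XsubC => [[]] //.
have : char_poly M = 'X ^+ n.+1.
  rewrite zE -sz; elim: zs z0 {zE sz} => [|z zs IH] H; first by rewrite big_nil expr0.
  rewrite big_cons IH => [|y yy]; last by apply: H; rewrite inE yy orbT.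
  by rewrite (H z (mem_head _ _)) subr0 exprS.
move/(congr1 (fun p : {poly k} => p`_n)); rewrite (char_poly_trace M) // coefXn.
by rewrite ltn_eqF // => /eqP; rewrite oppr_eq0 => /eqP.
Qed.

Lemma nilp_tr f : nilp f -> tr f = 0.
Proof. move=> [n fn]; rewrite /tr; apply: (@mx_nilp_trace _ _ n); rewrite -f2mxX fn f2mx0; by []. Qed.

(** For an idempotent, a full-rank factorization [M = cb rb] satisfies [rb cb = 1], so the trace is
    the rank. *)
Lemma idem_tr f : f * f = f -> exists m, tr f = m%:R /\ (m = 0%N -> f = 0).
Proof.
move=> ff; pose M := f2mx f; have MM : M *m M = M by rewrite /M -f2mxM ff.
exists (\rank M); split; last first.
  move=> /eqP; rewrite mxrank_eq0 => /eqP M0; apply/lfunP => v.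
  by rewrite -[v]v2rK f2mxE -/M M0 mulmx0 linear0 zero_lfunE.
have := mulmx_base M; have := row_base_free M; have := col_base_full M.
move: (row_base M) (col_base M) => rb cb cbf rbf e.
have e1 : rb *m cb = 1%:M.
  have : cb *m (rb *m cb) *m rb = cb *m 1%:M *m rb.
    by rewrite mulmx1 mulmxA e -mulmxA e MM.
  by move/(row_free_inj rbf)/(row_full_inj cbf).
have -> : tr f = \tr (cb *m rb) by rewrite e.
by rewrite mxtrace_mulC e1 mxtrace1.
Qed.

End Trace.

(** * Cartan's criterion for nilpotency *)

Section Cartan.
Variables (k : closedFieldType) (V : vectType k).
Implicit Types (f g : 'End(V)) (p : {poly k}) (A : {vspace V}).
Hypothesis char0 : [pchar k] =i pred0.

Lemma fun_sum (I : Type) (s : seq I) (G : I -> 'End(V)) v :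
  (\sum_(i <- s) G i) v = \sum_(i <- s) G i v.
Proof. by elim: s => [|i s IH]; rewrite ?big_nil ?zero_lfunE // !big_cons addE IH. Qed.

(* Cartan's criterion: test [f] against the semisimple endomorphisms obtained by
   applying Q-linear maps to its eigenvalues. *)
Lemma cartan_nilp f :
  (forall (t : k -> k) p, p`_0 = 0 -> (forall r v, geigen f r v -> pact f p v = t r *: v) ->
    (forall r s u v w, u != 0 -> v != 0 -> w != 0 ->
       geigen f r u -> geigen f s v -> geigen f (r + s) w -> t (r + s) = t r + t s) ->
    tr (f * pact f p) = 0) -> nilp f.
Proof.
move=> H; have [rs [P [urs vE Pg Pid]]] := geigen_decomp f.
pose E r := pact f (P r).
have Eid r : r \in rs -> E r * E r = E r.
  move=> rr; apply/lfunP => v; rewrite mulE.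
  by have := Pid r (E r v) (Pg r v rr); rewrite rr.
have sumE : \sum_(r <- rs) E r = 1 by apply/lfunP => v; rewrite fun_sum oneE -vE.
have [[r0 [r0s r00 Er0]]|nex] := classic (exists r0, [/\ r0 \in rs, r0 != 0 & E r0 != 0]); last first.
  apply: nilpP => v.
  have Pv r : r \in rs -> r != 0 -> E r v = 0.
    move=> rr r0; suff -> : E r = 0 by rewrite zero_lfunE.
    by apply/eqP/negPn/negP => Er; apply: nex; exists r.
  have g0 : geigen f 0 v.
    rewrite [v]vE; have [z0|nz] := boolP (0 \in rs).
      rewrite (bigD1_seq 0) //= big_seq_cond big1 => [|r /andP [rr r0]]; last exact: Pv.
      by rewrite addr0; apply: Pg.
    rewrite big_seq big1 => [|r rr]; first by exists 0%N; rewrite linear0.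
    by apply: Pv => //; apply: contraNneq nz => <-.
  by case: g0 => n; rewrite shift_powE scale0r subr0 exprE; exists n.
have [th [th0 thP]] := rational_functional char0 r0s r00 urs.
(* The value at 0 is imposed because [replica] asks for it; when 0 is an eigenvalue it agrees with
   [th]. *)
pose t r : k := if r == 0 then 0 else ratr (th r).
have inrs r v : v != 0 -> geigen f r v -> r \in rs.
  by move=> v0 /Pid; case: ifP => // _ v0'; rewrite v0' eqxx in v0.
have one_rel (a b c : rat) x y z : x \in rs -> y \in rs -> z \in rs ->
    ratr a * x + ratr b * y + ratr c * z = 0 :> k -> a * th x + b * th y + c * th z = 0.
  move=> xr yr zr e.
  have sumd (G : k -> k) w a' : w \in rs -> \sum_(r <- rs) ratr (if r == w then a' else 0) * G r = ratr a' * G w.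
    move=> wr; rewrite (bigD1_seq w) //= eqxx big1 ?addr0 // => r /negPf ->.
    by rewrite ratr0 // mul0r.
  have sumq (G : k -> rat) w a' : w \in rs -> \sum_(r <- rs) (if r == w then a' else 0) * G r = a' * G w.
    move=> wr; rewrite (bigD1_seq w) //= eqxx big1 ?addr0 // => r /negPf ->.
    by rewrite mul0r.
  rewrite -(sumq th x a) // -(sumq th y b) // -(sumq th z c) // -!big_split /=.
  rewrite -[RHS](thP (fun r => (if r == x then a else 0) + (if r == y then b else 0) + (if r == z then c else 0))).
    by apply: eq_bigr => r _; rewrite !mulrDl.
  rewrite -[RHS]e -(sumd id x a) // -(sumd id y b) // -(sumd id z c) // -!big_split /=.
  by apply: eq_bigr => r _; rewrite !ratrD // !mulrDl.
have thz : 0 \in rs -> th 0 = 0.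
  move=> z; have := @one_rel 1 0 0 0 0 0 z z z; rewrite !mulr0 !addr0 => /(_ erefl).
  by rewrite !mul0r !addr0 mul1r.
have tE r : r \in rs -> t r = ratr (th r).
  by rewrite /t; case: eqP => // -> /thz ->; rewrite ratr0.
have [p [p0 Hp]] := @replica _ _ f t (ltac:(by rewrite /t eqxx)).
have tadd r s u v w : u != 0 -> v != 0 -> w != 0 ->
       geigen f r u -> geigen f s v -> geigen f (r + s) w -> t (r + s) = t r + t s.
  move=> u0 v0 w0 gu gv gw; have [rr ss] := (inrs _ _ u0 gu, inrs _ _ v0 gv).
  have qq := inrs _ _ w0 gw; rewrite !tE // -ratrD //; congr ratr.
  have := one_rel 1 1 (-1) r s (r + s) rr ss qq; rewrite !mul1r mulN1r.
  have rN1 : ratr (-1) = -1 :> k by apply: (addrI (ratr 1)); rewrite -ratrD // !subrr ratr0 // ratr1 // subrr.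
  rewrite ratr1 // rN1 !mul1r mulN1r subrr => /(_ erefl) /eqP.
  by rewrite subr_eq0 => /eqP.
have := H t p p0 Hp tadd.
have mex r : exists m, r \in rs -> tr (E r) = m%:R /\ (m = 0%N -> E r = 0).
  by case: (boolP (r \in rs)) => [rr|_]; [have [m Hm] := idem_tr (Eid r rr); exists m|exists 0%N].
pose m r := sval (constructive_indefinite_description _ (mex r)).
have mP r := svalP (constructive_indefinite_description _ (mex r)).
have -> : tr (f * pact f p) = \sum_(r <- rs) ratr ((m r)%:R * th r) * r.
  have -> : f * pact f p = \sum_(r <- rs) t r *: (f * E r).
    rewrite -[LHS]mulr1 -sumE mulr_sumr big_seq [RHS]big_seq; apply: eq_bigr => r rr.
    rewrite -mulrA -mulEZr; congr (f * _); apply/lfunP => v; rewrite mulE scaleE.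
    exact/Hp/Pg.
  rewrite tr_sum big_seq [RHS]big_seq; apply: eq_bigr => r rr.
  rewrite trZ tE // ratrM // ratr_nat.
  have [-> _] : tr (f * E r) = r * (m r)%:R /\ True.
    split=> //; have [<- _] := mP r rr.
    have -> : f * E r = r *: E r + (f - r *: (1 : 'End(V))) * E r.
      by rewrite mulrBl mulEZl mul1r addrC subrK.
    rewrite trD trZ [tr (_ * E r)]nilp_tr ?addr0 //; apply: nilpP => v.
    have [M] := Pg r v rr; rewrite shift_powE exprE => HM; exists M.+1.
    have cm : (f - r *: (1 : 'End(V))) * E r = E r * (f - r *: (1 : 'End(V))).
      by rewrite /E -pactXsub pact_comm.
    rewrite -exprE exprMn_comm // mulE -[E r ^+ _](_ : E r = _).
      by rewrite exprE iterS HM linear0.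
    by elim: M {HM} => [|M IH]; rewrite ?expr1 // exprS -IH Eid.
  by ring.
(* The vanishing trace is a rational relation among the eigenvalues. Applying [th] to it gives a sum
   of rational squares with the multiplicities as weights, so each term is zero. *)
move/thP; pose S := \sum_(r <- rs) (m r)%:R * th r ^+ 2.
have -> : \sum_(r <- rs) (m r)%:R * th r * th r = S by apply: eq_bigr => r _; ring.
move/eqP; rewrite /S psumr_eq0 => [|r _]; last by rewrite mulr_ge0 ?ler0n ?sqr_ge0.
move/allP/(_ r0 r0s) => /=; rewrite mulf_eq0 expf_eq0 /= (negPf th0) orbF pnatr_eq0.
by move=> /eqP m0; have [_ /(_ m0) e] := mP r0 r0s; rewrite e eqxx in Er0.
Qed.

End Cartan.

(** * Engel's theorem for weakly closed sets *)

Section Engel.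
Variables (k : closedFieldType) (V : vectType k).
Implicit Types (s t m : 'End(V)) (A : {vspace V}) (S : 'End(V) -> Prop).

(** This is the ascending flag of [S], starting at zero: [K i] consists of the vectors killed by all
    products of [i] elements of [S]. *)
Definition lower_central S (K : nat -> {vspace V}) :=
  (forall v, v \in K 0%N <-> v = 0) /\
  (forall i v, v \in K i.+1 <-> forall s, S s -> s v \in K i).

Lemma flag_exists S : exists K, lower_central S K.
Proof.
have ex (A : {vspace V}) : exists U : {vspace V}, forall v, v \in U <-> forall s, S s -> s v \in A.
  apply: vspace_of_pred => [s _|c u v Hu Hv s Ss]; first by rewrite linear0 mem0v.
  by rewrite linearP rpredD ?rpredZ ?Hu ?Hv.
pose nx A := sval (constructive_indefinite_description _ (ex A)).
have nxP A := svalP (constructive_indefinite_description _ (ex A)).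
exists (fun i => iter i nx 0%VS); split=> [v|i v]; last exact: nxP.
by rewrite memv0; split=> [/eqP|->].
Qed.

Lemma flag_mono S K i : lower_central S K -> (K i <= K i.+1)%VS.
Proof.
move=> [K0 KS]; elim: i => [|i IH]; apply/subvP => v.
  by move/K0 => ->; rewrite mem0v.
by move/KS => H; apply/KS => s Ss; apply: (subvP IH); apply: H.
Qed.

Lemma flag_mono_le S K i j : lower_central S K -> (i <= j)%N -> (K i <= K j)%VS.
Proof.
move=> F /subnKC <-; elim: (j - i)%N => [|n IH]; first by rewrite addn0.
by rewrite addnS; apply: subv_trans IH (flag_mono _ F).
Qed.

Lemma flag_full S K : lower_central S K ->
  (forall A, A != fullv -> (forall s, S s -> stab s A) ->
     exists2 w, w \notin A & forall s, S s -> s w \in A) ->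
  exists n, K n = fullv.
Proof.
move=> F Q; have [K0 KS] := F.
have H n : K n = fullv \/ (n <= \dim (K n))%N.
  elim: n => [|n [IH|IH]]; first by right.
    by left; apply/eqP; rewrite eqEsubv subvf /= -IH; apply: flag_mono F.
  have [->|ne] := eqVneq (K n.+1) fullv; [by left|right].
  have nK : K n != fullv.
    by apply: contraNneq ne => e; rewrite eqEsubv subvf /= -e; apply: flag_mono F.
  have [|w nw Hw] := Q (K n) nK.
    by move=> s Ss v vK; apply: (KS n v).1 => //; apply: (subvP (flag_mono n F)).
  have wK : w \in K n.+1 by apply/KS.
  apply: leq_ltn_trans IH _; rewrite ltnNge; apply/negP => le.
  have e : K n = K n.+1 by apply/eqP; rewrite eqEdim le (flag_mono _ F).
  by rewrite e wK in nw.
exists (\dim {:V}).+1; have [//|le] := H (\dim {:V}).+1.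
by have := leq_trans le (dimvS (subvf _)); rewrite ltnn.
Qed.

Lemma nilp_leave s A w : nilp s -> w \notin A -> exists n, iter n s w \notin A /\ s (iter n s w) \in A.
Proof.
move=> [N sN] wA; apply: NNPP => H.
have : forall n, iter n s w \notin A.
  elim=> [//|n IH]; apply/negP => sA; apply: H; by exists n.
by move/(_ N); rewrite -exprE sN zero_lfunE mem0v.
Qed.

(* Jacobson's weakly closed version of Engel's theorem. *)
Lemma engel S : (forall s, S s -> nilp s) ->
  (forall s t, S s -> S t -> S (s * t - t * s)) ->
  forall A, A != fullv -> (forall s, S s -> stab s A) ->
     exists2 w, w \notin A & forall s, S s -> s w \in A.
Proof.
move=> Sn Sb.
pose Q (M : {vspace 'End(V)}) := forall A, A != fullv -> (forall s, s \in M -> stab s A) ->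
     exists2 w, w \notin A & forall s, s \in M -> s w \in A.
(* The last clause says that [M] is spanned by its elements in [S], without choosing a spanning
   family. *)
pose good (M : {vspace 'End(V)}) := [/\ Q M,
  forall s t, s \in M -> t \in M -> s * t - t * s \in M &
  forall B : {vspace 'End(V)}, (forall s, S s -> s \in M -> s \in B) -> (M <= B)%VS].
suff [M [[QM Mb Ms] SM]] : exists M, good M /\ forall s, S s -> s \in M.
  move=> A A1 sA; have [s sM|w nw Hw] := QM A A1.
    have [B HB] : exists B : {vspace 'End(V)}, forall s, s \in B <-> stab s A.
      apply: vspace_of_pred => [v _|c s1 s2 H1 H2]; first by rewrite zero_lfunE mem0v.
      exact/stabD/H2/stabZ.
    have /subvP MB := Ms B (fun s Ss _ => (HB s).2 (sA s Ss)).
    by apply/HB/MB.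
  by exists w => // s Ss; apply/Hw/SM.
have Hstep n : forall M, good M -> (\dim {:'End(V)} - \dim M <= n)%N ->
    exists M, good M /\ forall s, S s -> s \in M.
  elim: n => [|n IH] M gM dM.
    exists M; split=> // s _; suff -> : M = fullv by rewrite memvf.
    by apply/eqP; rewrite eqEdim subvf -subn_eq0 -leqn0.
  have [HS|[s0 [Ss0 ns0]]] : (forall s, S s -> s \in M) \/ exists s, S s /\ s \notin M.
    have [H|H] := classic (exists s, S s /\ s \notin M); [by right|left=> s Ss].
    by apply/negPn/negP => ns; apply: H; exists s.
    by exists M.
  have [QM Mb Ms] := gM.
  have [K F] := flag_exists (fun s => s \in M); have [N KN] := flag_full F QM.
  have [K0 KS] := F.
  have [s [Ss ns HsM]] : exists s, [/\ S s, s \notin M & forall m, S m -> m \in M -> m * s - s * m \in M].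
    apply: NNPP => H.
    (* If no element of [S] outside [M] normalized [M], brackets with suitable elements of [M] would
       never lead into [M]. Each bracket improves by one the shift along the flag of [M], so after
       [2N] of them an element outside [M] would be zero. *)
    have Hj j : exists s, [/\ S s, s \notin M & forall i v, v \in K i -> s v \in K (i + N - j)%N].
      elim: j => [|j [s [Ss ns Hs]]].
        exists s0; split=> // i v _; rewrite subn0.
        by apply: (subvP (flag_mono_le F (leq_addl i N))); rewrite KN memvf.
      have [m [Sm mM nm]] : exists m, [/\ S m, m \in M & m * s - s * m \notin M].
        apply: NNPP => H'; apply: H; exists s; split=> // m Sm mM.
        by apply/negPn/negP => nm; apply: H'; exists m.
      exists (m * s - s * m); split=> //; first exact: Sb.
      have mK i v : v \in K i -> m v \in K i.-1.
        case: i => [/K0 ->|i /KS]; [by rewrite linear0 mem0v|exact].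
      move=> i v vK; rewrite !endE rpredB //.
        by rewrite subnS; apply/mK/Hs.
      case: i vK => [/K0 ->|i vK]; first by rewrite !linear0 mem0v.
      by have := Hs _ _ (mK _ _ vK); rewrite addSn subSS.
    have [s [Ss ns Hs]] := Hj (N + N)%N; move: ns; suff -> : s = 0 by rewrite mem0v.
    apply/lfunP => v; rewrite zero_lfunE; apply/K0.
    by have := Hs N v; rewrite KN memvf subnn => ->.
  have HsM' m : m \in M -> m * s - s * m \in M.
    have [B HB] : exists B : {vspace 'End(V)}, forall m, m \in B <-> m * s - s * m \in M.
      apply: vspace_of_pred => [|c s1 s2 H1 H2]; first by rewrite mul0r mulr0 subrr mem0v.
      have -> : (c *: s1 + s2) * s - s * (c *: s1 + s2) = c *: (s1 * s - s * s1) + (s2 * s - s * s2).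
        by rewrite mulrDl mulrDr mulEZl mulEZr; vring.
      by rewrite rpredD ?rpredZ.
    have /subvP MB := Ms B (fun m Sm mM => (HB m).2 (HsM m Sm mM)).
    by move=> mM; apply/HB/MB.
  apply: (IH (M + <[s]>)%VS); last first.
    move: dM; rewrite !leq_subLR => dM; apply: leq_trans dM _; rewrite addnS -addSn leq_add2r.
    rewrite ltnNge; apply/negP => dle.
    have eU : M = (M + <[s]>)%VS by apply/eqP; rewrite eqEdim addvSl.
    by move: ns; rewrite eU (subvP (addvSr _ _)) ?memv_line.
  split.
  - move=> A A1 sA.
    have sM m : m \in M -> m \in (M + <[s]>)%VS by apply/subvP/addvSl.
    have ss : s \in (M + <[s]>)%VS by apply: (subvP (addvSr _ _)); rewrite memv_line.
    have [B HB] : exists B : {vspace V}, forall v, v \in B <-> forall m, m \in M -> m v \in A.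
      apply: vspace_of_pred => [m _|c u v Hu Hv m mM]; first by rewrite linear0 mem0v.
      by rewrite linearP rpredD ?rpredZ ?Hu ?Hv.
    have [m mM|w nw Hw] := QM A A1; first exact/sA/sM.
    have sB : stab s B.
      move=> v /HB vB; apply/HB => m mM.
      have -> : m (s v) = s (m v) + (m * s - s * m) v by rewrite !endE addrC subrK.
      by apply: rpredD; [apply: sA => //; apply: vB|apply/vB/HsM'].
    (* The vectors sent into [A] by [M] form an [s]-stable space, so the last iterate of [w] under
       [s] outside [A] serves [M] and [s] together. *)
    have [p [np sp]] := nilp_leave (Sn s Ss) nw.
    exists (iter p s w) => // _ /memv_addP [m mM [_ /vlineP [c ->] ->]].
    rewrite addE scaleE rpredD ?rpredZ //.
    have : iter p s w \in B by elim: p {np sp} => [|p IHp]; [apply/HB|rewrite iterS; apply: sB].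
    by move/HB/(_ m mM).
  - move=> _ _ /memv_addP [m1 m1M [_ /vlineP [c1 ->] ->]] /memv_addP [m2 m2M [_ /vlineP [c2 ->] ->]].
    apply: (subvP (addvSl _ _)).
    have -> : (m1 + c1 *: s) * (m2 + c2 *: s) - (m2 + c2 *: s) * (m1 + c1 *: s) =
        (m1 * m2 - m2 * m1) + c2 *: (m1 * s - s * m1) - c1 *: (m2 * s - s * m2).
      rewrite !mulrDl !mulrDr !mulEZl !mulEZr.
      by vring.
    by apply: rpredB; [apply: rpredD; [exact: Mb|]|]; apply: rpredZ; apply: HsM'.
  move=> B HB; rewrite subv_add Ms /=; last by move=> t St tM; apply/HB/(subvP (addvSl _ _)).
  by rewrite -memvE HB // (subvP (addvSr _ _)) ?memv_line.
apply: (Hstep (\dim {:'End(V)}) 0%VS); last by rewrite leq_subr.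
split.
- move=> A A1 _; have [w nw] : exists w, w \notin A.
    apply: NNPP => H; move/negP: A1; apply; rewrite eqEsubv subvf /=; apply/subvP => v _.
    by apply/negPn/negP => nv; apply: H; exists v.
  by exists w => // s; rewrite memv0 => /eqP ->; rewrite zero_lfunE mem0v.
- by move=> s t; rewrite !memv0 => /eqP -> /eqP ->; rewrite mul0r subrr.
by move=> B _; rewrite sub0v.
Qed.

Lemma engel_flag S : (forall s, S s -> nilp s) ->
  (forall s t, S s -> S t -> S (s * t - t * s)) ->
  exists K n, lower_central S K /\ K n = fullv.
Proof.
move=> Sn Sb; have [K F] := flag_exists S; have [n Kn] := flag_full F (engel Sn Sb).
by exists K, n.
Qed.

End Engel.

(** * Linearity rules, and splitting into kernel and image *)

Section HomLinear.
Variables (k : fieldType) (U W : vectType k) (f : 'Hom(U, W)).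
Lemma homD u v : f (u + v) = f u + f v. Proof. exact: linearD. Qed.
Lemma homN u : f (- u) = - f u. Proof. exact: linearN. Qed.
Lemma homZ c u : f (c *: u) = c *: f u. Proof. exact: linearZ. Qed.
Lemma hom0 : f 0 = 0. Proof. exact: linear0. Qed.
End HomLinear.
Definition homE := (homD, homN, homZ, hom0).

Section KernelImage.
Variables (k : fieldType) (V : vectType k).
Implicit Types (f : 'End(V)) (A : {vspace V}).

(** Write the annihilating polynomial as [m X^n] with [m(0)] nonzero. The hypothesis brings [n] down
    to one, so [m(f)] maps into the kernel, while [m - m(0)] is divisible by [X]; both components
    are polynomials in [f] applied to [v] and stay in [A]. *)
Lemma ker_im_split f A v : (forall w, f (f w) = 0 -> f w = 0) -> stab f A -> v \in A ->
  exists u w, [/\ u \in A, w \in A, f u = 0 & v = u + f w].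
Proof.
move=> f2 sA vA; have [p p0 fp] := annihilating_poly f.
have fX n w : (f ^+ n) w = 0 -> f w = 0.
  elim: n w => [|n IH] w; first by rewrite expr0 oneE => ->; rewrite linear0.
  by rewrite exprSr mulE => /IH /f2.
have [n [m m0 pE]] := multiplicity_XsubC p 0; rewrite p0 /= subr0 in m0 pE.
have fm w : f (pact f m w) = 0.
  apply: (fX n); have := fp; rewrite pE pactM pact_comm pactXn pactX => /lfunP/(_ w).
  by rewrite mulE zero_lfunE.
move: m0; rewrite /root => m0.
have /factor_theorem [q qE] : root (m - (m.[0])%:P) 0 by rewrite /root !hornerE subrr.
rewrite subr0 in qE.
exists (m.[0]^-1 *: pact f m v), (- m.[0]^-1 *: pact f q v); split.
- by rewrite rpredZ // pact_stab.
- by rewrite rpredZ // pact_stab.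
- by rewrite linearZ /= fm scaler0.
have mv : pact f m v = f (pact f q v) + m.[0] *: v.
  rewrite -{1}[m](subrK (m.[0])%:P) qE pactD pactMX pactC.
  by rewrite (pact_comm_with q (erefl (f * f))) !endE.
by rewrite linearZ /= mv scalerDr scalerA mulVf // scale1r addrAC scaleNr subrr add0r.
Qed.

End KernelImage.

(** * The filtration by natural weights *)

Section Weights.
Variables (k : closedFieldType) (V : vectType k).
Hypothesis char0 : [pchar k] =i pred0.
Implicit Types (A : {vspace V}) (H : 'End(V)).

(** The weight filtration of [H], restricted to natural weights. The witness is a list with
    repetitions allowed, so that sums are concatenations. *)
Definition hge H (i : nat) v := exists s : seq (nat * V),
  v = \sum_(t <- s) t.2 /\
  forall t, t \in s -> H t.2 = t.1%:R *: t.2 /\ (i <= t.1)%N.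

Lemma hge0 H i : hge H i 0.
Proof. by exists [::]; rewrite big_nil. Qed.

Lemma hgeD H i u v : hge H i u -> hge H i v -> hge H i (u + v).
Proof.
move=> [s [-> Hs]] [t [-> Ht]]; exists (s ++ t); split; first by rewrite big_cat.
by move=> x; rewrite mem_cat => /orP [/Hs|/Ht].
Qed.

Lemma hge_eig H i j v : H v = j%:R *: v -> (i <= j)%N -> hge H i v.
Proof.
move=> Hv ij; exists [:: (j, v)]; split; first by rewrite big_seq1.
by move=> t; rewrite inE => /eqP ->.
Qed.

Lemma hge_sum H i (I : eqType) (r : seq I) (F : I -> V) :
  (forall x, x \in r -> hge H i (F x)) -> hge H i (\sum_(x <- r) F x).
Proof.
move=> HF; rewrite big_seq; elim/big_ind: _ => //; [exact: hge0|exact: hgeD].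
Qed.

Lemma hgeZ H i c v : hge H i v -> hge H i (c *: v).
Proof.
move=> [s [-> Hs]]; rewrite scaler_sumr; apply: hge_sum => t /Hs [e le].
by apply: (@hge_eig _ _ t.1); rewrite // linearZ /= e !scalerA mulrC.
Qed.

Lemma hgeN H i v : hge H i v -> hge H i (- v).
Proof. by rewrite -scaleN1r; apply: hgeZ. Qed.

Lemma hgeB H i u v : hge H i u -> hge H i v -> hge H i (u - v).
Proof. by move=> Hu /hgeN; apply: hgeD. Qed.

Lemma hge_le H i j v : (i <= j)%N -> hge H j v -> hge H i v.
Proof.
move=> ij [s [-> Hs]]; exists s; split=> // t /Hs [e le]; split=> //.
exact: leq_trans le.
Qed.

Lemma hge_split H i v : hge H i v -> exists u w, [/\ H u = i%:R *: u, hge H i.+1 w & v = u + w].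
Proof.
move=> [s [-> Hs]]; rewrite (bigID (fun t => t.1 == i)) /=; eexists; eexists; split; last by [].
  rewrite linear_sum scaler_sumr big_seq_cond [RHS]big_seq_cond; apply: eq_bigr => t /andP [ts /eqP ti] /=.
  by have [-> _] := Hs t ts; rewrite ti.
rewrite -big_filter; apply: hge_sum => t; rewrite mem_filter => /andP [ti /Hs [e le]].
by apply: hge_eig e _; rewrite ltn_neqAle eq_sym ti.
Qed.

(** The polynomial whose roots are the weights occurring in the expansion of [v] kills [v], yet acts
    on it by a nonzero scalar if [v] has weight [i]. *)
Lemma hge_eig0 H i j v : hge H j v -> H v = i%:R *: v -> (i < j)%N -> v = 0.
Proof.
move=> [s [vE Hs]] Hv ij; pose q : {poly k} := \prod_(t <- s) ('X - (t.1%:R)%:P).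
have q0 : q.[i%:R] != 0.
  rewrite /q horner_prod prodf_seq_neq0; apply/allP => t /Hs [_ le] /=.
  rewrite !hornerE subr_eq0; apply/negP => /eqP /(natf_inj char0) e.
  by rewrite e in ij; rewrite leqNgt ij in le.
have : pact H q v = 0.
  rewrite vE linear_sum big_seq; apply: big1 => t ts /=; have [e _] := Hs t ts.
  rewrite (pact_eigen _ e) (_ : q.[_] = 0) ?scale0r // /q.
  by rewrite (big_rem t) //= hornerM !hornerE subrr mul0r.
by rewrite (pact_eigen _ Hv) => /eqP; rewrite scaler_eq0 (negPf q0) => /eqP.
Qed.

Lemma nat_bound (rs : seq k) : exists N, forall n, (N <= n)%N -> n%:R \notin rs.
Proof.
elim: rs => [|r rs [N IH]]; first by exists 0.
have [[n0 e]|ne] := classic (exists n, n%:R = r).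
  exists (maxn n0.+1 N) => n; rewrite geq_max inE negb_or => /andP [lt /IH ->].
  rewrite andbT -e; apply/negP => /eqP /(natf_inj char0) e'.
  by rewrite e' ltnn in lt.
exists N => n /IH; rewrite inE negb_or => ->; rewrite andbT.
by apply/negP => /eqP e; apply: ne; exists n.
Qed.

(** [H] has finitely many eigenvalues. This is what terminates the recursions along the
    filtration. *)
Lemma hge_top H : exists N, forall i v, (N <= i)%N -> hge H i v -> v = 0.
Proof.
have [rs Hrs] := eigenvalues_finite H; have [N HN] := nat_bound rs.
exists N => i v Ni [s [-> Hs]]; rewrite big_seq; apply: big1 => t /Hs [e le].
by apply/eqP/negPn/negP => t0; have := Hrs _ _ e t0; rewrite (negPf (HN _ (leq_trans Ni le))).
Qed.

Lemma hge_map H i (W : vectType k) (H' : 'End(W)) j (g : 'Hom(V, W)) v :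
  (forall n u, H u = n%:R *: u -> H' (g u) = (n + j)%:R *: g u) ->
  hge H i v -> exists s : seq (nat * W), g v = \sum_(t <- s) t.2 /\
    forall t, t \in s -> H' t.2 = t.1%:R *: t.2 /\ (i + j <= t.1)%N.
Proof.
move=> Hg [s [-> Hs]]; exists [seq ((t.1 + j)%N, g t.2) | t <- s].
split; first by rewrite linear_sum big_map.
by move=> _ /mapP [t /Hs [e le] ->] /=; rewrite (Hg _ _ e) leq_add2r.
Qed.

End Weights.

(** * Commutation formulas for sl2 and the Lefschetz decomposition *)

Section Sl2.
Variables (k : closedFieldType) (V : vectType k).
Hypothesis char0 : [pchar k] =i pred0.
Variables (E H F : 'End(V)).
Hypothesis HE : H * E - E * H = 2%:R *: E.
Hypothesis EF : E * F - F * E = H.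
Implicit Types (A : {vspace V}) (u v w : V).

Let HEv v : H (E v) = E (H v) + 2%:R *: E v.
Proof. by rewrite -scaleE -HE !endE addrC subrK. Qed.

Let EFv v : E (F v) = F (E v) + H v.
Proof. by rewrite -EF !endE addrC subrK. Qed.

Let ES n v : E ((E ^+ n) v) = (E ^+ n.+1) v.
Proof. by rewrite exprS mulE. Qed.

Let ESr n v : (E ^+ n) (E v) = (E ^+ n.+1) v.
Proof. by rewrite exprSr mulE. Qed.

Lemma sl2_HEn n v : H ((E ^+ n) v) = (E ^+ n) (H v) + (n.*2)%:R *: (E ^+ n) v.
Proof.
elim: n v => [|n IH] v; first by rewrite expr0 !oneE scale0r addr0.
rewrite !exprS !mulE HEv IH linearD linearZ /= -!mul2n mulnS natrD.
by vring.
Qed.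

Lemma sl2_EnF n v : (E ^+ n.+1) (F v) =
  F ((E ^+ n.+1) v) + n.+1%:R *: ((E ^+ n) (H v) + n%:R *: (E ^+ n) v).
Proof.
elim: n => [|n IH]; first by rewrite !expr1 expr0 !oneE EFv scale0r addr0 scale1r.
rewrite -ES IH linearD linearZ linearD linearZ /= EFv sl2_HEn !ES.
rewrite -(addn1 n.+1) -(addn1 n) -mul2n natrM !natrD.
by vring.
Qed.

Hypothesis En : nilp E.

(* The weights of [H] on [ker E] are natural numbers, and at least [i] on [im E^i]. *)
Lemma sl2_ker_poly : exists N, forall i w, (i <= N)%N -> E ((E ^+ i) w) = 0 ->
  pact H (\prod_(j <- iota i (N - i)) ('X - (j%:R)%:P)) ((E ^+ i) w) = 0.
Proof.
have [N EN] := En; exists N => i w iN.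
have [m e] : exists m, m = (N - i)%N by eexists.
rewrite -e; have {iN e} : (i + m = N)%N by rewrite e subnKC.
elim: m i w => [|m IH] i w.
  by rewrite addn0 => ->; rewrite EN !zero_lfunE !linear0.
move=> iN Ei; rewrite /= big_cons mulrC pactM mulE pactXsub !endE.
(* On the kernel of [E], the operator [H - i] turns [E^i w] into [E^(i+1)] of a multiple of [F w]:
   one linear factor is used up and the depth in the image of [E] rises by one. *)
have e : H ((E ^+ i) w) - i%:R *: (E ^+ i) w = (E ^+ i.+1) (i.+1%:R^-1 *: F w).
  rewrite [RHS]linearZ; change (H ((E ^+ i) w) - i%:R *: (E ^+ i) w = i.+1%:R^-1 *: ((E ^+ i.+1) (F w))).
  rewrite sl2_EnF -ES Ei linear0 add0r scalerA mulVf ?natf_neq0 // scale1r sl2_HEn.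
  by rewrite -mul2n natrM; vring.
rewrite e; apply: IH; first by rewrite addSn -addnS.
by rewrite -e linearB linearZ /= Ei scaler0 subr0; apply/eqP; have := HEv ((E ^+ i) w);
  rewrite Ei linear0 scaler0 addr0 => <-.
Qed.

(** The annihilating product of [sl2_ker_poly] has distinct roots, all natural numbers at least [i],
    and splits [v] inside [A] and the kernel of [E]. Only [[H, E] = 2E] and [[E, F] = H] enter, so
    the lemma applies to triples whose [F] is still to be corrected. *)
Lemma sl2_ker_hge A i v w : stab H A -> v \in A -> v = (E ^+ i) w -> E v = 0 ->
  exists s : seq (nat * V), v = \sum_(t <- s) t.2 /\
   forall t, t \in s -> [/\ H t.2 = t.1%:R *: t.2, (i <= t.1)%N, t.2 \in A & E t.2 = 0].
Proof.
move=> sA vA vE Ev; have [N HN] := sl2_ker_poly.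
have [iN|lt] := leqP i N; last first.
  exists [::]; rewrite big_nil; split=> //; have [M EM] := En.
  have := HN N ((E ^+ (i - N)) w) (leqnn _).
  rewrite -mulE -exprD subnKC ?(ltnW lt) // -vE subnn big_nil pact1 oneE; exact.
have := HN i w iN; rewrite -vE => /(_ Ev) /= Hv.
pose rs : seq k := [seq j%:R | j <- iota i (N - i)].
have urs : uniq rs by rewrite map_inj_uniq ?iota_uniq // => a b; apply: natf_inj.
have vB : v \in (A :&: lker E)%VS by rewrite memv_cap vA memv_ker Ev eqxx.
have sB : stab H (A :&: lker E)%VS.
  move=> u; rewrite !memv_cap !memv_ker => /andP [uA /eqP Eu]; rewrite sA //=.
  by have := HEv u; rewrite Eu linear0 scaler0 addr0 => <-.
have [|y [yE Hy]] := prod_eigsum urs sB vB; first by rewrite /rs big_map.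
exists [seq (j, y j%:R) | j <- iota i (N - i)]; split; first by rewrite big_map yE big_map.
move=> _ /mapP [j jI ->]; move: jI; rewrite mem_iota => /andP [ij _]; have [e] := Hy j%:R.
by rewrite memv_cap memv_ker => /andP [yA /eqP Ey].
Qed.

Lemma sl2_ker_weight c v : E v = 0 -> H v = c *: v -> v != 0 -> exists n, c = n%:R.
Proof.
move=> Ev Hv v0; have [N HN] := sl2_ker_poly.
have := HN 0 v (leq0n _); rewrite expr0 oneE => /(_ Ev).
rewrite (pact_eigen _ Hv) => /eqP; rewrite scaler_eq0 (negPf v0) orbF horner_prod.
rewrite prodf_seq_eq0 => /hasP [j _] /=; rewrite !hornerE subr_eq0 => /eqP ->; by exists j.
Qed.

Lemma sl2_ker_neg n v : E v = 0 -> H v = - n.+1%:R *: v -> v = 0.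
Proof.
move=> Ev Hv; apply/eqP/negPn/negP => v0; have [m] := sl2_ker_weight Ev Hv v0.
move/eqP; rewrite eq_sym -subr_eq0 opprK -natrD addnS (negPf (natf_neq0 char0 _)) //.
Qed.

(* Lefschetz decomposition for an sl2-action up to an error in [A']. *)
Lemma lefschetz_mod (G : 'End(V)) A A' (n : nat) v :
  stab E A -> stab G A -> stab E A' -> stab G A' -> (A' <= A)%VS ->
  H * G - G * H = - 2%:R *: G ->
  (forall u, u \in A -> E (G u) - G (E u) - H u \in A') ->
  v \in A -> H v = n%:R *: v ->
  exists w t, [/\ w \in A, H (E w) = n%:R *: E w, t \in A, v = E w + t & if n is 0 then E t \in A' else t \in A'].
Proof.
move=> sE sG sE' sG' AA HG EG vA Hv.
have GE m u : u \in A -> (E ^+ m.+1) (G u) - G ((E ^+ m.+1) u) -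
     m.+1%:R *: ((E ^+ m) (H u) + m%:R *: (E ^+ m) u) \in A'.
  move=> uA; elim: m => [|m IH].
    by rewrite !expr1 expr0 !oneE scale0r addr0 scale1r EG.
  have EmA : (E ^+ m.+1) u \in A by apply: stabX.
  have := rpredD (sE' _ IH) (EG _ EmA).
  rewrite !homE sl2_HEn !ES.
  congr (_ \in A'); rewrite -(addn1 m.+1) -(addn1 m) -mul2n natrM !natrD.
  by vring.
have [N EN] := En.
have : (E ^+ N) v \in A' by rewrite EN zero_lfunE mem0v.
move: N v vA Hv {EN}.
(* Modulo [A'], the operator [E^m E G] acts on such a [v] as the scalar [(m+1)(n+m)] times [E^m].
   Subtracting the scalar lowers the power of [E] that sends [v] into [A']; the scalar is invertible
   unless [n] and [m] are both zero, so [v] can be recovered. *)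
have step m v : v \in A -> H v = n%:R *: v -> (E ^+ m.+1) v \in A' ->
    let v' := E (G v) - (m.+1%:R * (n + m)%:R) *: v in
    [/\ v' \in A, H v' = n%:R *: v', (E ^+ m) v' \in A', G v \in A & H (E (G v)) = n%:R *: E (G v)].
  move=> vA Hv Ev; have GvA := sG _ vA.
  have HEG : H (E (G v)) = n%:R *: E (G v).
    have HGv : H (G v) = G (H v) - 2%:R *: G v.
      by rewrite -scaleNr -scaleE -HG !endE addrC subrK.
    by rewrite HEv HGv Hv linearB !linearZ /=; vring.
  split=> //.
  - by rewrite rpredB ?rpredZ ?sE.
  - by rewrite linearB linearZ /= HEG Hv; vring.
  have := rpredD (GE m v vA) (sG' _ Ev); congr (_ \in A').
  rewrite !homE ESr Hv homZ natrD.
  by vring.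
have fin m v : v \in A -> (m.+1%:R * (n + m)%:R : k) != 0 ->
    let v' := E (G v) - (m.+1%:R * (n + m)%:R) *: v in
    H (E (G v)) = n%:R *: E (G v) -> G v \in A ->
    (exists w t, [/\ w \in A, H (E w) = n%:R *: E w, t \in A, v' = E w + t & if n is 0 then E t \in A' else t \in A']) ->
    exists w t, [/\ w \in A, H (E w) = n%:R *: E w, t \in A, v = E w + t & if n is 0 then E t \in A' else t \in A'].
  move=> vA c0 v' HEG GvA [w [t [wA Hw tA e tA']]].
  set c := _ * _ in c0 v' e.
  exists (c^-1 *: (G v - w)), (- c^-1 *: t); split.
  - by rewrite rpredZ // rpredB.
  - by rewrite !homE HEG Hw; vring.
  - by rewrite rpredZ.
  - have vE : c^-1 *: (E (G v) - v') = v by rewrite /v' opprB addrC subrK scalerA mulVf // scale1r.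
    by rewrite -{1}vE e !homE; vring.
  - by case: (n) tA' => [|?] tA'; rewrite ?linearZ /= rpredZ.
case: n step fin => [|n] step fin; last first.
  elim=> [|m IH] v vA Hv Ev.
    exists 0, v; split; rewrite ?mem0v ?hom0 ?scaler0 ?add0r //.
    by rewrite expr0 oneE in Ev.
  have [a b c d e] := step m v vA Hv Ev; apply: (fin m) => //; last exact: IH.
  by rewrite mulf_neq0 ?addSn ?natf_neq0.
case=> [|m].
  move=> v vA Hv; rewrite expr0 oneE => Ev.
  by exists 0, v; split; rewrite ?mem0v ?hom0 ?scaler0 ?add0r //; apply: sE'.
elim: m => [|m IH] v vA Hv Ev.
  exists 0, v; split; rewrite ?mem0v ?hom0 ?scaler0 ?add0r //.
have [a b c d e] := step m.+1 v vA Hv Ev; apply: (fin m.+1) => //; last exact: IH.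
by rewrite mulf_neq0 ?natf_neq0.
Qed.

End Sl2.

(** * sl2-modules: semisimplicity, the Casimir operator, highest weights *)

Section Sl2Modules.
Variables (k : closedFieldType) (V : vectType k).
Hypothesis char0 : [pchar k] =i pred0.
Implicit Types (A : {vspace V}) (u v w : V) (E H F : 'End(V)).

Definition sl2 E H F := [/\ H * E - E * H = 2%:R *: E, E * F - F * E = H &
  H * F - F * H = - 2%:R *: F].

Let two0 : (2%:R : k) != 0 := natf_neq0 char0 1.

Lemma sl2_nilp E H F : sl2 E H F -> nilp E.
Proof. by case=> HE _ _; apply: (shift_nilp char0 HE). Qed.

Lemma sl2_opp E H F : sl2 E H F -> sl2 F (- H) E.
Proof.
move=> [HE EF HF]; split.
- by rewrite mulNr mulrN opprK addrC -[LHS]opprB HF scaleNr opprK.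
- by rewrite -EF opprB.
- by rewrite mulNr mulrN opprK addrC -[LHS]opprB HE scaleNr.
Qed.

Lemma sl2_HEv E H F v : sl2 E H F -> H (E v) = E (H v) + 2%:R *: E v.
Proof. by move=> [HE _ _]; rewrite -scaleE -HE !endE addrC subrK. Qed.

Lemma sl2_EFv E H F v : sl2 E H F -> E (F v) = F (E v) + H v.
Proof. by move=> [_ EF _]; rewrite -EF !endE addrC subrK. Qed.

Lemma sl2_HFv E H F v : sl2 E H F -> H (F v) = F (H v) - 2%:R *: F v.
Proof. by move=> [_ _ HF]; rewrite -scaleNr -scaleE -HF !endE addrC subrK. Qed.

(** The nilpotent part [N] of [H] commutes with the whole triple. Induction on the power of [E]
    killing [v]: the vector [v'] is killed by a smaller power, and [N v' = 0] says that [N v],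
    killed by [E], has a negative weight, hence vanishes. *)
Lemma sl2_diag E H F : sl2 E H F -> diagz H.
Proof.
move=> S; have [HE EF HF] := S; have En := sl2_nilp S.
have [p [_ Hp]] := @replica _ _ H id (erefl _).
have [rs [P [urs vE Pg _]]] := geigen_decomp H.
pose T := pact H p.
have TH : T * H = H * T by apply: pact_comm_with.
have shift (X : 'End(V)) c : (forall v, H (X v) = X (H v) + c *: X v) ->
    forall v, T (X v) = X (T v) + c *: X v.
  move=> HX; have gX r v : geigen H r v -> geigen H (r + c) (X v).
    move=> [M HM]; exists M; elim: M v HM => [|M IH] v; first by rewrite /shift_pow !expr0 pact1 !oneE => ->; rewrite hom0.
    rewrite !shift_powS => /IH; congr (_ = _); congr (shift_pow _ _ _ _).
    by rewrite HX !homE; vring.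
  move=> v; rewrite [v]vE !linear_sum -big_split !big_seq /=; apply: eq_bigr => r rr.
  have g := Pg r v rr; rewrite /T (Hp _ _ (gX _ _ g)) (Hp _ _ g) !homE.
  by vring.
have TE := shift E 2%:R (fun v => sl2_HEv v S).
have TF v : T (F v) = F (T v) - 2%:R *: F v.
  by rewrite -scaleNr; apply: shift => w; rewrite (sl2_HFv w S) scaleNr.
pose N := H - T.
have NE v : N (E v) = E (N v) by rewrite /N !endE TE (sl2_HEv v S) !homE; vring.
have NF v : N (F v) = F (N v) by rewrite /N !endE TF (sl2_HFv v S) !homE; vring.
have NHv v : N (H v) = H (N v) by rewrite /N !endE homD homN -[T (H v)]mulE TH mulE.
have N0 n v : (E ^+ n) v = 0 -> N v = 0.
  elim: n v => [|[|n] IH] v; first by rewrite expr0 oneE => ->; rewrite hom0.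
    rewrite expr1 => Ev; have vA : v \in fullv by rewrite memvf.
    have [|s [-> Hs]] := sl2_ker_hge char0 HE EF En (fun u _ => memvf (H u)) vA (i := 0) (w := v) _ Ev.
      by rewrite expr0 oneE.
    rewrite linear_sum big_seq; apply: big1 => t /Hs [e _ _ _] /=.
    have g : geigen H t.1%:R t.2 by exists 1%N; rewrite shift_powS e subrr hom0.
    by rewrite /N !endE e /T (Hp _ _ g) subrr.
  move=> Ev; pose v' := E (F v) - n.+2%:R *: (H v + n.+1%:R *: v).
  have Ev' : (E ^+ n.+1) v' = 0.
    have := sl2_EnF HE EF n.+1 v; rewrite Ev hom0 add0r => e.
    have e2 : (E ^+ n.+1) (E (F v)) = (E ^+ n.+2) (F v) by rewrite [in RHS]exprSr mulE.
    by rewrite /v' !homE e2 e; vring.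
  have ENv : E (N v) = 0 by rewrite -NE; apply: IH; rewrite -mulE -exprSr.
  have e : H (N v) - n.+2%:R *: (H (N v) + n.+1%:R *: N v) = 0.
    by rewrite -[RHS](IH _ Ev') /v' !homE NE NF NHv (sl2_EFv _ S) ENv hom0 add0r.
  apply: (@sl2_ker_neg _ _ char0 E H F HE EF En n.+1) => //.
  apply: (scalerI (natf_neq0 char0 n)).
  apply/eqP; rewrite -subr_eq0; apply/eqP; rewrite -[RHS]oppr0 -[in RHS]e.
  by rewrite -(addn1 n.+1) -(addn1 n) !natrD; vring.
have [n En0] := En; suff HT : H = T by rewrite HT; move=> v; rewrite [v]vE big_seq;
  apply: eigsum_sum => r rr; apply: (@eigsum_eig _ _ _ _ r); rewrite ?memvf // (Hp _ _ (Pg r v rr)).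
apply/lfunP => v; apply/eqP; rewrite -subr_eq0 -oppE -addE; apply/eqP.
by apply: (N0 n); rewrite En0 zero_lfunE.
Qed.

(** Twice the element [EF + FE + H^2/2]. On a vector of weight [n] killed by [E] it is the scalar
    [n(n+2)], which is zero for a natural [n] only if [n = 0]. *)
Definition casimir E H F : 'End(V) := 4%:R *: (F * E) + H * H + 2%:R *: H.

Lemma casimirE E H F v : casimir E H F v = 4%:R *: F (E v) + H (H v) + 2%:R *: H v.
Proof. by rewrite /casimir !endE. Qed.

Lemma casimir_commE E H F v : sl2 E H F -> casimir E H F (E v) = E (casimir E H F v).
Proof.
move=> S; rewrite !casimirE !homE (sl2_EFv _ S) !(sl2_HEv _ S) !homE !(sl2_HEv _ S).
by vring.
Qed.

Lemma casimir_commF E H F v : sl2 E H F -> casimir E H F (F v) = F (casimir E H F v).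
Proof.
move=> S; rewrite !casimirE !homE (sl2_EFv _ S) !(sl2_HFv _ S) !homE !(sl2_HFv _ S).
by vring.
Qed.

Lemma casimir_commH E H F v : sl2 E H F -> casimir E H F (H v) = H (casimir E H F v).
Proof.
move=> S; rewrite !casimirE !homE (sl2_HFv _ S) !(sl2_HEv _ S) !homE.
by vring.
Qed.

Lemma casimir_comm (f E H F : 'End(V)) : (forall v, f (E v) = E (f v)) -> (forall v, f (H v) = H (f v)) ->
  (forall v, f (F v) = F (f v)) -> forall v, f (casimir E H F v) = casimir E H F (f v).
Proof. by move=> fE fH fF v; rewrite !casimirE !homE fF fE !fH. Qed.

Lemma casimir_stab E H F A : stab E A -> stab H A -> stab F A -> stab (casimir E H F) A.
Proof.
by move=> sE sH sF v vA; rewrite casimirE !rpredD ?rpredZ //; [apply/sF/sE|apply/sH/sH|apply: sH].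
Qed.

(** Raising a weight vector of the kernel to the top reaches weight zero, so its weight is at most
    zero; the opposite triple has the same Casimir operator and gives the other inequality. Thus [H]
    kills the kernel, and [E v] and [F v], lying in it with weights 2 and -2, vanish. *)
Lemma casimir_ker E H F v : sl2 E H F -> casimir E H F v = 0 -> [/\ E v = 0, H v = 0 & F v = 0].
Proof.
move=> S; have [HE EF HF] := S.
pose M := lker (casimir E H F).
have key E' H' F' : sl2 E' H' F' -> (forall v, casimir E' H' F' v = casimir E H F v) ->
    forall r u, u != 0 -> casimir E H F u = 0 -> H' u = r *: u -> exists n, r = - n%:R.
  move=> S' cE; have [HE' EF' HF'] := S'; have [N EN] := sl2_nilp S'.
  have top m r u : (E' ^+ m) u = 0 -> u != 0 -> casimir E H F u = 0 -> H' u = r *: u -> exists n, r = - n%:R.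
    elim: m r u => [|m IH] r u; first by rewrite expr0 oneE => -> /eqP.
    rewrite exprSr mulE => Emu u0 cu Hu; have [Eu|Eu] := eqVneq (E' u) 0; last first.
      have [||n e] := IH (r + 2%:R) (E' u) Emu Eu; first by rewrite -cE (casimir_commE _ S') cE cu hom0.
        by rewrite (sl2_HEv _ S') Hu homZ; vring.
      by exists n.+2; rewrite -[r](addrK 2%:R) e -opprD -natrD addn2.
    have [n e] := sl2_ker_weight char0 HE' EF' (sl2_nilp S') Eu Hu u0.
    move: cu; rewrite -cE casimirE Eu hom0 scaler0 add0r Hu homZ Hu scalerA scalerA -scalerDl => /eqP.
    rewrite scaler_eq0 (negPf u0) orbF -mulrDl mulf_eq0 e -natrD addn2 (negPf (natf_neq0 char0 _)) /=.
    by move/eqP => ->; exists 0; rewrite oppr0.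
  by move=> r u u0 cu Hu; apply: (top N r u) => //; rewrite EN zero_lfunE.
have H0 u : casimir E H F u = 0 -> H u = 0.
  move=> cu; have uM : u \in M by rewrite memv_ker cu.
  have sM : stab H M by move=> w; rewrite !memv_ker (casimir_commH _ S) => /eqP ->; rewrite hom0.
  have [rs [w [_ -> Hw]]] := diag_eigsum (sl2_diag S) sM uM.
  rewrite linear_sum; apply: big1 => r _ /=; have [e] := Hw r; rewrite memv_ker => /eqP cw.
  have [->|w0] := eqVneq (w r) 0; first by rewrite hom0.
  have [n rn] := key _ _ _ S (fun v => erefl) r (w r) w0 cw e.
  have cas z : casimir F (- H) E z = casimir E H F z.
    by rewrite !casimirE !oppE homN opprK (sl2_EFv _ S); vring.
  have eg : (- H) (w r) = (- r) *: w r by rewrite oppE e scaleNr.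
  have [m] := key _ _ _ (sl2_opp S) cas (- r) (w r) w0 cw eg.
  move=> rm; have /(natf_inj char0) : (n + m)%:R = 0%:R :> k.
    by rewrite natrD -[n%:R]opprK -[m%:R]opprK -rn -rm subrr.
  by case: (n) rn => [|//] rn _; rewrite e rn oppr0 scale0r.
move=> cv; have Hv := H0 v cv.
have cE : casimir E H F (E v) = 0 by rewrite (casimir_commE _ S) cv hom0.
have cF : casimir E H F (F v) = 0 by rewrite (casimir_commF _ S) cv hom0.
split=> //.
  have := sl2_HEv v S; rewrite (H0 _ cE) Hv hom0 add0r => /esym/eqP.
  by rewrite scaler_eq0 (negPf two0) => /eqP.
have := sl2_HFv v S; rewrite (H0 _ cF) Hv hom0 add0r => /esym/eqP.
by rewrite oppr_eq0 scaler_eq0 (negPf two0) => /eqP.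
Qed.

Lemma casimir_ker2 E H F v : sl2 E H F ->
  casimir E H F (casimir E H F v) = 0 -> casimir E H F v = 0.
Proof.
move=> S /(casimir_ker S) [cE cH _].
have [|_ HEv FEv] := casimir_ker S (v := E v); first by rewrite (casimir_commE _ S).
have [|_ HHv _] := casimir_ker S (v := H v); first by rewrite (casimir_commH _ S).
by rewrite casimirE FEv HHv (diag_ker2 (sl2_diag S) HHv) !scaler0 !addr0.
Qed.

Lemma pact_shift H (X : 'End(V)) d q v : (forall v, H (X v) = X (H v) + d *: X v) ->
  X (pact H q v) = pact (H - d *: (1 : 'End(V))) q (X v).
Proof.
move=> HX; elim/poly_ind: q v => [|q c IH] v; first by rewrite !pact0 !zero_lfunE hom0.
by rewrite !pactD !pactMX !pactC !endE (homD X) (homZ X) IH HX addrK.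
Qed.

(** A Lagrange polynomial in [H] projects [w] to the weight [c - d]; since [X] shifts weights by
    [d], the image [X w] does not change. *)
Lemma eig_preimage A H c (X : 'End(V)) d w : diagz H -> stab H A ->
  (forall v, H (X v) = X (H v) + d *: X v) -> w \in A -> H (X w) = c *: X w ->
  exists w', [/\ w' \in A, X w' = X w & H w' = (c - d) *: w'].
Proof.
move=> dH sA HX wA Hw; have [rs [y [urs wE y3]]] := diag_eigsum dH sA wA.
pose q : {poly k} := \prod_(r <- rs | r != c - d) ('X - r%:P).
have q0 : q.[c - d] != 0.
  rewrite /q horner_prod prodf_seq_neq0; apply/allP => r _ /=; apply/implyP.
  by rewrite !hornerE subr_eq0 eq_sym.
exists (q.[c - d]^-1 *: pact H q w); split.
- by rewrite rpredZ // pact_stab.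
- have e : (H - d *: (1 : 'End(V))) (X w) = (c - d) *: X w by rewrite !endE Hw scalerBl.
  by rewrite homZ (pact_shift _ _ HX) (pact_eigen q e) scalerA mulVf // scale1r.
rewrite homZ scalerA mulrC -scalerA; congr (_ *: _); rewrite wE !linear_sum /=.
rewrite big_seq [RHS]big_seq; apply: eq_bigr => r rr; have [e _] := y3 r.
rewrite (pact_eigen q e) homZ e; have [->|ne] := eqVneq r (c - d); first by rewrite scalerA mulrC -scalerA.
suff -> : q.[r] = 0 by rewrite !scale0r scaler0.
by rewrite /q (big_rem r) //= ne hornerM !hornerE subrr mul0r.
Qed.

Lemma lefschetz E H F A (n : nat) v : sl2 E H F -> stab E A -> stab H A -> stab F A -> v \in A ->
  H v = n%:R *: v ->
  exists w t, [/\ w \in A, H w = (n%:R - 2%:R) *: w, t \in A, v = E w + t & if n is 0 then E t = 0 else t = 0].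
Proof.
move=> S sE sH sF vA Hv; have [HE EF HF] := S.
have [||u _|w [t [wA Hw tA e te]]] := lefschetz_mod char0 HE (sl2_nilp S) sE sF _ _ (sub0v A) HF _ vA Hv.
- by move=> u; rewrite memv0 => /eqP ->; rewrite hom0 mem0v.
- by move=> u; rewrite memv0 => /eqP ->; rewrite hom0 mem0v.
- by rewrite (sl2_EFv _ S) memv0; apply/eqP; vring.
have [w' [wA' e' Hw']] := eig_preimage (sl2_diag S) sH (fun u => sl2_HEv u S) wA Hw.
exists w', t; split; rewrite ?e' //.
by case: (n) te => [|?]; rewrite memv0 => /eqP.
Qed.

Lemma lefschetz_surj E H F A (n : nat) v : sl2 E H F -> stab E A -> stab H A -> stab F A -> v \in A ->
  H v = n.+1%:R *: v -> exists w, [/\ w \in A, H w = (n.+1%:R - 2%:R) *: w & v = E w].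
Proof.
move=> S sE sH sF vA Hv; have [w [t [wA Hw _ -> ->]]] := lefschetz S sE sH sF vA Hv.
by exists w; rewrite addr0.
Qed.

(** Descending with [F] and climbing back with [E] multiplies [v] by the product of the factors
    [(j+1)(n-j)] for [j < i], which is nonzero as long as [i] does not exceed [n]. *)
Lemma lefschetz_pow E H F A (n i : nat) v : sl2 E H F -> stab F A -> v \in A ->
  E v = 0 -> H v = n%:R *: v -> (i <= n)%N -> exists2 w, w \in A & v = (E ^+ i) w.
Proof.
move=> S sF vA Ev Hv ni; have [HF' FE' _] := sl2_opp S.
have step j : E ((F ^+ j.+1) v) = (j.+1%:R * (n%:R - j%:R)) *: (F ^+ j) v.
  have := sl2_EnF HF' FE' j v; rewrite Ev hom0 oppE Hv !homE => /esym/eqP.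
  by rewrite addr_eq0 => /eqP ->; vring.
have [c c0 cE] : exists2 c, c != 0 & (E ^+ i) ((F ^+ i) v) = c *: v.
  elim: i ni => [|i IH] ni; first by exists 1; rewrite ?oner_neq0 // !expr0 !oneE scale1r.
  have [c c0 cE] := IH (ltnW ni).
  exists (i.+1%:R * (n%:R - i%:R) * c); last by rewrite exprSr mulE step homZ cE scalerA.
  by rewrite !mulf_neq0 ?natf_neq0 // -natrB ?(ltnW ni) // -(subnSK ni) natf_neq0.
exists (c^-1 *: (F ^+ i) v); first by rewrite rpredZ // stabX.
by rewrite homZ cE scalerA mulVf // scale1r.
Qed.

(** The relation [[E, F] = H] holds up to an operator that lowers the flag. At each level
    [lefschetz_mod] leaves an error one level lower, where the induction hypothesis applies. *)
Lemma lefschetz_flag E H F (K : nat -> {vspace V}) N (n : nat) v :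
  H * E - E * H = 2%:R *: E -> H * F - F * H = - 2%:R *: F -> diagz H ->
  (forall i, [/\ stab E (K i), stab H (K i), stab F (K i) & (K i <= K i.+1)%VS]) -> K 0%N = 0%VS ->
  (forall i u, u \in K i.+1 -> E (F u) - F (E u) - H u \in K i) ->
  v \in K N -> H v = n%:R *: v ->
  exists w t, [/\ w \in K N, H w = (n%:R - 2%:R) *: w, t \in K N, v = E w + t & if n is 0 then E t = 0 else t = 0].
Proof.
move=> HE HF dH sK K0 EF; have En := shift_nilp char0 HE (natf_neq0 char0 1).
have HEv u : H (E u) = E (H u) + 2%:R *: E u by rewrite -scaleE -HE !endE addrC subrK.
suff Hw : forall N n v, v \in K N -> H v = n%:R *: v -> exists w t, [/\ w \in K N, t \in K N, v = E w + t,
    H (E w) = n%:R *: E w & if n is 0 then E t = 0 else t = 0].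
  move=> vN Hv; have [w [t [wK tK e Hw' te]]] := Hw N n v vN Hv.
  have [_ sH _ _] := sK N; have [w' [wA' e' Hw2]] := eig_preimage dH sH HEv wK Hw'.
  by exists w', t; rewrite e'.
move=> {}N; elim: N => [|N IH] {}n {}v vK Hv.
  exists 0, v; move: vK; rewrite K0 memv0 => /eqP ->.
  by rewrite !hom0 addr0 scaler0 !mem0v; split=> //; case: (n).
have [sE1 sH1 sF1 _] := sK N.+1; have [sE0 sH0 sF0 le] := sK N.
have [w [t [wA Hw tA e te]]] := lefschetz_mod char0 HE En sE1 sF1 sE0 sF0 le HF (EF N) vK Hv.
have Ht : H t = n%:R *: t.
  have -> : t = v - E w by rewrite e addrAC subrr add0r.
  by rewrite !homE Hv Hw; vring.
have sub := subvP le.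
case: n Hv Hw te Ht => [|n] Hv Hw te Ht; last first.
  have [w' [t' [w'A t'A e' Hw' te']]] := IH _ _ te Ht.
  exists (w + w'), t'; split=> //; [by rewrite rpredD // sub|exact: sub| |].
    by rewrite e e' homD addrA.
  by rewrite !homE Hw Hw'; vring.
(* In weight zero the error [E t] has weight two and lies in the image of [E] one level down. A
   preimage [w3] of weight zero is decomposed in turn and exchanged for [t]. *)
have HEt : H (E t) = 2%:R *: E t by rewrite HEv Ht scale0r hom0 add0r.
have [w2 [t2 [w2A _ e2 Hw2 t20]]] := IH _ _ te HEt.
have [_ sH _ _] := sK N.
have [w3 [w3A e3 Hw3]] := eig_preimage dH sH HEv w2A Hw2.
rewrite subrr in Hw3; have [w4 [t4 [w4A t4A e4 Hw4 t40]]] := IH 0 w3 w3A Hw3.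
exists (w + w4), (t - w3 + t4); split.
- by rewrite rpredD // sub.
- by rewrite rpredD ?rpredB // sub.
- by rewrite {1}e {1}(_ : t = t - w3 + (E w4 + t4)) -?e4 ?subrK // e4 homD; vring.
- by rewrite !homE Hw Hw4; vring.
by rewrite !homE t40 addr0 e3 e2 t20 addr0 subrr.
Qed.

End Sl2Modules.

(** * The superalgebra osp(1|2) and its Scasimir operator *)

Section Osp12.
Variables (k : closedFieldType) (V : vectType k).
Hypothesis char0 : [pchar k] =i pred0.
Variables (Z Y C : 'End(V)).
Hypothesis ZY : Z * Y + Y * Z = C.
Hypothesis CZ : C * Z - Z * C = Z.
Hypothesis CY : C * Y - Y * C = - Y.

Let CZv v : C (Z v) = Z (C v) + Z v.
Proof. by have /lfunP/(_ v) := CZ; rewrite addE oppE !mulE => e; rewrite -[LHS](subrK (Z (C v))) e addrC. Qed.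

Let CYv v : C (Y v) = Y (C v) - Y v.
Proof. by have /lfunP/(_ v) := CY; rewrite addE !oppE !mulE => e; rewrite -[LHS](subrK (Y (C v))) e addrC. Qed.

Let CE v : C v = Z (Y v) + Y (Z v). Proof. by rewrite -ZY !endE. Qed.

Lemma osp_sl2 : sl2 (Z * Z) C (- (Y * Y)).
Proof.
split; apply/lfunP => v; rewrite !endE.
- by rewrite CZv CZv !homE; vring.
- rewrite !homE; have e w : Z (Z (Y w)) = Y (Z (Z w)) - Z w.
    have := CZv w; rewrite !CE homD => e; apply/eqP; rewrite -subr_eq0; apply/eqP.
    transitivity (Z (Z (Y w)) + Z (Y (Z w)) + Z w - (Z (Y (Z w)) + Y (Z (Z w)))); first by vring.
    by rewrite -e subrr.
  by rewrite !(e, homE) !CE; vring.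
by rewrite !(homE, CYv); vring.
Qed.

(** The Scasimir operator, which anticommutes with [Z] and [Y], is this one plus one half. Without
    the half the invariants are exactly the kernel. *)
Definition ghost : 'End(V) := Z * Y - Y * Z.

Lemma ghostZ v : Z (ghost v) = - Z v - ghost (Z v).
Proof.
have := CZv v; rewrite !CE homD /ghost !endE homD homN => e; apply/eqP; rewrite -subr_eq0; apply/eqP.
transitivity (Z (Z (Y v)) + Z (Y (Z v)) + Z v - (Z (Y (Z v)) + Y (Z (Z v)))); first by vring.
by rewrite -e subrr.
Qed.

Lemma ghostY v : Y (ghost v) = - Y v - ghost (Y v).
Proof.
have := CYv v; rewrite !CE homD /ghost !endE homD homN => e; apply/eqP; rewrite -subr_eq0; apply/eqP.
transitivity (Z (Y (Y v)) + Y (Z (Y v)) - (Y (Z (Y v)) + Y (Y (Z v)) - Y v)); first by vring.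
by rewrite e subrr.
Qed.

Lemma ghost_comm_even (X : 'End(V)) : (forall v, X (Z v) = Z (X v)) -> (forall v, X (Y v) = Y (X v)) ->
  forall v, X (ghost v) = ghost (X v).
Proof. by move=> XZ XY v; rewrite /ghost !endE homD homN XZ XY XY XZ. Qed.

Lemma ghost_comm_odd (X : 'End(V)) : (forall v, X (Z v) = - Z (X v)) -> (forall v, X (Y v) = - Y (X v)) ->
  forall v, X (ghost v) = ghost (X v).
Proof. by move=> XZ XY v; rewrite /ghost !endE homD homN XZ XY XY XZ !homN !opprK. Qed.

(** On an irreducible module of highest weight [n] the eigenvalues are [n] and [-(n+1)], the second
    one absent for [n = 0]; so -1 does not occur. Directly: a solution can be moved into the kernel
    of [Z * Z], where it would have [C]-weight -1. *)
Lemma ghost_p1_inj v : ghost v + v = 0 -> v = 0.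
Proof.
have S := osp_sl2; have [HE EF _] := S; have En := sl2_nilp char0 S.
have base u : (Z * Z) u = 0 -> ghost u + u = 0 -> u = 0.
  move=> Eu a; have ZZu : Z (Z u) = 0 by rewrite -mulE.
  have ZYZ : Z (Y (Z u)) = 0.
    have := CZv u; rewrite !CE !homE ZZu hom0 addr0 => e2.
    have a' := congr1 Z a; rewrite /ghost !endE !homE in a'.
    transitivity (Z (Z (Y u)) + Z (Y (Z u)) + Z u - (Z (Z (Y u)) - Z (Y (Z u)) + Z u) - Z (Y (Z u))).
      by vring.
    by rewrite -e2 a' subr0 subrr.
  have CZu : C (Z u) = 0 by rewrite CE ZZu hom0 addr0.
  have YZ : Y (Z u) = 0.
    apply: (@sl2_ker_neg _ _ char0 _ C _ HE EF En 0); first by rewrite mulE ZYZ hom0.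
    by rewrite CYv CZu hom0 sub0r scaleN1r.
  apply: (@sl2_ker_neg _ _ char0 _ C _ HE EF En 0) => //.
  move/eqP: a; rewrite /ghost !endE YZ subr0 addr_eq0 => /eqP a.
  by rewrite CE YZ a addr0 scaleN1r.
have [n En0] := En.
have H m u : ((Z * Z) ^+ m) u = 0 -> ghost u + u = 0 -> u = 0.
  elim: m u => [|m IH] u; first by rewrite expr0 oneE.
  rewrite exprSr mulE => Em a; apply: (base u) => //; apply: (IH _ Em).
  rewrite mulE; have a' := congr1 (fun v => Z (Z v)) a; rewrite /= !homE ghostZ !homE ghostZ in a'.
  rewrite -[RHS]a'; vring.
by apply: (H n); rewrite En0 zero_lfunE.
Qed.

(** By [ghostZ] and [ghostY], the operator [ghost + 1] kills [Z v] and [Y v]. *)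
Lemma ghost_ker v : ghost v = 0 -> Z v = 0 /\ Y v = 0.
Proof.
move=> gv; split; apply: ghost_p1_inj; [have := ghostZ v|have := ghostY v]; rewrite gv hom0 => /eqP;
  by rewrite eq_sym -opprD oppr_eq0 addrC => /eqP.
Qed.

Lemma ghost_ker2 v : ghost (ghost v) = 0 -> ghost v = 0.
Proof.
move=> /ghost_ker [gZ gY].
have Zv : Z v = 0.
  by apply: ghost_p1_inj; apply/eqP; rewrite -oppr_eq0 opprD addrC -ghostZ gZ.
have Yv : Y v = 0.
  by apply: ghost_p1_inj; apply/eqP; rewrite -oppr_eq0 opprD addrC -ghostY gY.
by rewrite /ghost !endE Zv Yv !hom0 subrr.
Qed.

(** [ghost + 1] is invertible and [Z (ghost + 1) = - ghost Z]. *)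
Lemma ghost_im v : exists w, Z v = ghost w.
Proof.
have inj : lker (ghost + 1) == 0%VS.
  rewrite -subv0; apply/subvP => u; rewrite memv_ker memv0 addE oneE => /eqP e.
  by rewrite (ghost_p1_inj e).
have vE := lker0_lfunVK inj v; rewrite addE oneE in vE.
exists (- Z (((ghost + 1)^-1)%VF v)).
by rewrite -[in LHS]vE !homE ghostZ; vring.
Qed.

End Osp12.

(** * Jordan chains and the criterion for odd blocks *)

Section JordanChains.
Variables (k : closedFieldType) (V : vectType k).
Implicit Types (T : 'End(V)) (U : {vspace V}).

Lemma functional_at v : v != 0 -> exists phi : 'Hom(V, k^o), phi v != 0.
Proof.
move=> v0; apply: NNPP => H; move/eqP: v0; apply.
rewrite (coord_vbasis (memvf v)); apply: big1 => i _.
suff -> : vector.coord (vbasis fullv) i v = 0 by rewrite scale0r.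
apply/eqP/negPn/negP => c; apply: H.
have [|f fE] := @mkhom k V k^o (fun v => vector.coord (vbasis fullv) i v).
  by move=> a u w; rewrite linearP.
by exists f; rewrite fE.
Qed.

(** A longest chain is split off. Its size is good: for a bad size the hypothesis would make its
    last vector the image of a longer chain. The hypothesis descends to a stable complement, and the
    dimension decreases. *)
Lemma jordan_chains T U (good : pred nat) : stab T U -> (exists N, forall u, u \in U -> iter N T u = 0) ->
  (forall m u w, u \in U -> w \in U -> u = iter m T w -> T u = 0 -> ~~ good m.+1 ->
     exists2 w', w' \in U & u = iter m.+1 T w') ->
  exists2 sz, jordan_blocks T U sz & all good sz.
Proof.
have [d] := ubnP (\dim U); elim: d U => // d IH U; rewrite ltnS => dU sU [N HN] Hgood.
have iE n v : iter n T v = (T ^+ n) v by rewrite exprE.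
have [n [kn Tnw]] : exists n, (forall u, u \in U -> iter n T u = 0) /\
    (if n is n'.+1 then exists2 w, w \in U & iter n' T w != 0 else exists2 w, w \in U & true).
  elim: N HN => [|N IHN] HN; first by exists 0; split=> //; exists 0; rewrite ?mem0v.
  have [H|H] := classic (exists2 w, w \in U & iter N T w != 0); first by exists N.+1.
  apply: IHN => u uU; apply/eqP/negPn/negP => nu; by apply: H; exists u.
case: n kn Tnw => [|n] kn.
  move=> _; exists [::] => //; exists [::]; split=> //.
  rewrite /basis_of /= span_nil nil_free andbT eqEsubv sub0v /=.
  by apply/subvP => u /kn /= ->; rewrite mem0v.
move=> {}Tnw; case: Tnw => {}w {}wU Tnw.
have TUn j u : u \in U -> iter j T u \in U by move=> uU; rewrite iE; apply: stabX.
have Tn1 j u : u \in U -> (n < j)%N -> iter j T u = 0.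
  by move=> uU /subnK <-; rewrite iterD kn // iE hom0.
have goodn : good n.+1.
  apply/negPn/negP => bad; have TTw : T (iter n T w) = 0 by rewrite -iterS kn.
  have [w' w'U e] := Hgood n _ w (TUn n w wU) wU (erefl _) TTw bad.
  by move: Tnw; rewrite e kn // eqxx.
have [phi phiw] := functional_at Tnw.
pose ch m r := [seq iter j T w | j <- iota m r].
have chU m r : (<<ch m r>> <= U)%VS.
  by apply/span_subvP => _ /mapP [j _ ->]; apply: TUn.
have ch_top m r j s : (m + r)%N = n.+1 -> (j + m = n.+1)%N -> s \in <<ch m r>>%VS -> iter j T s = 0.
  move=> mr jm /(coord_span (X := in_tuple (ch m r))) ->.
  rewrite iE linear_sum; apply: big1 => i _ /=; rewrite linearZ /=.
  have /mapP [l] : (in_tuple (ch m r))`_i \in ch m r by rewrite mem_nth.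
  rewrite mem_iota => /andP [ml _] ->.
  by rewrite -iE -iterD Tn1 ?scaler0 // -jm leq_add2l.
have ch_cons m r : ch m r.+1 = iter m T w :: ch m.+1 r by [].
have ch_phi m r s : (m + r)%N = n.+1 -> s \in <<ch m r>>%VS -> (forall i, phi (iter i T s) = 0) -> s = 0.
  elim: r m s => [|r IHr] m s mr; first by rewrite /ch /= span_nil memv0 => /eqP.
  rewrite ch_cons span_cons => /memv_addP [_ /vlineP [c ->] [s' s'c ->]] Hphi.
  have mr' : (m.+1 + r)%N = n.+1 by rewrite addSnnS.
  have mn : (m <= n)%N by rewrite -ltnS -mr' leq_addr.
  have c0 : c = 0.
    have := Hphi (n - m)%N; rewrite iE homD homZ -!iE -iterD subnK // (ch_top _ _ _ _ mr' _ s'c) ?addr0; last first.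
      by rewrite addnS subnK.
    by rewrite homZ => /eqP; rewrite scaler_eq0 (negPf phiw) orbF => /eqP.
  rewrite c0 scale0r add0r in Hphi *; exact: IHr mr' s'c Hphi.
have ch_free m r : (m + r)%N = n.+1 -> free (ch m r).
  elim: r m => [|r IHr] m mr; first by rewrite nil_free.
  have mr' : (m.+1 + r)%N = n.+1 by rewrite addSnnS.
  have mn : (m <= n)%N by rewrite -ltnS -mr' leq_addr.
  rewrite ch_cons free_cons IHr // andbT; apply/negP => /(ch_top _ _ (n - m)%N _ mr').
  rewrite addnS subnK // => /(_ erefl); rewrite -iterD subnK // => e.
  by rewrite e eqxx in Tnw.
(* The complement is cut out by all functionals [phi T^i], where [phi] does not vanish on the last
   vector of the chain; this makes it [T]-stable. *)
have [U' HU'] : exists U' : {vspace V}, forall u, u \in U' <-> u \in U /\ forall i, phi (iter i T u) = 0.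
  apply: vspace_of_pred => [|c u v [uU Hu] [vU Hv]].
    by split=> [|i]; rewrite ?mem0v // iE !hom0.
  split=> [|i]; first by rewrite rpredD ?rpredZ.
  by rewrite iE linearP /= -!iE homD homZ Hu Hv scaler0 addr0.
have U'U : (U' <= U)%VS by apply/subvP => u /HU' [].
have split_ch u : u \in U -> exists s : V, [/\ s \in <<ch 0%N n.+1>>%VS & u - s \in U'].
  move=> uU; have Hj j : (j <= n.+1)%N -> exists s : V, s \in <<ch 0%N n.+1>>%VS /\
      forall i, (n < i + j)%N -> phi (iter i T (u - s)) = 0.
    elim: j => [|j IHj] jn.
      exists 0; rewrite mem0v; split=> // i; rewrite addn0 subr0 => lt.
      by rewrite (Tn1 _ _ uU lt) hom0.
    have [s [sc Hs]] := IHj (ltnW jn); rewrite ltnS in jn.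
    pose c := phi (iter (n - j) T (u - s)) / phi (iter n T w).
    exists (s + c *: iter j T w); split.
      apply: rpredD => //; apply: rpredZ; apply: memv_span; apply/mapP; exists j => //.
      by rewrite mem_iota /= add0n ltnS.
    move=> i; rewrite addnS ltnS leq_eqVlt => /orP [/eqP e|lt].
      have {e} -> : i = (n - j)%N by rewrite e addnK.
      rewrite opprD addrA iE homD homN !homZ -!iE -iterD subnK // homD homN homZ /c.
      rewrite [_ *: phi _](_ : _ = phi (iter (n - j) T (u - s))) ?subrr //.
      by rewrite -[LHS]/(_ * _) mulfVK.
    by rewrite opprD addrA iE homD homN !homZ -!iE -iterD (Tn1 _ _ wU lt) scaler0 subr0 Hs.
  have [s [sc Hs]] := Hj n.+1 (leqnn _).
  exists s; split=> //; apply/HU'; split=> [|i]; last by rewrite Hs // addnS ltnS leq_addl.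
  by rewrite rpredB // (subvP (chU 0 n.+1)).
have UE : (<<ch 0%N n.+1>> + U')%VS = U.
  apply/eqP; rewrite eqEsubv subv_add chU U'U /=; apply/subvP => u uU.
  have [s [sc us]] := split_ch u uU; apply/memv_addP; exists s => //; exists (u - s) => //.
  by rewrite addrC subrK.
have dir : (<<ch 0%N n.+1>> :&: U' = 0)%VS.
  apply/eqP; rewrite -subv0; apply/subvP => s; rewrite memv_cap memv0 => /andP [sc /HU' [_ Hs]].
  by rewrite (ch_phi 0 n.+1 s).
have dlt : (\dim U' < d)%N.
  apply: leq_trans dU; rewrite ltnNge; apply/negP => le.
  have /HU' [_ /(_ n) e] : w \in U' by rewrite (_ : U' = U) //; apply/eqP; rewrite eqEdim U'U.
  by rewrite e eqxx in phiw.
have sU' : stab T U'.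
  move=> u /HU' [uU Hu]; apply/HU'; split=> [|i]; first exact: sU.
  by rewrite -iterSr.
have [|m u v uU' vU' uE Tu bad|sz [c [szE Hc bc]] gsz] := IH U' dlt sU'.
- by exists n.+1 => u /(subvP U'U) /kn.
- have [v' v'U uE'] := Hgood m u v (subvP U'U _ uU') (subvP U'U _ vU') uE Tu bad.
  have [s [sc v's]] := split_ch v' v'U; exists (v' - s) => //.
  apply/eqP; rewrite -subr_eq0; apply/eqP; apply: (ch_phi 0 n.+1) => // [|i].
    have -> : u - iter m.+1 T (v' - s) = iter m.+1 T s by rewrite uE' !iE homD homN opprB addrC subrK.
    have stc : stab T <<ch 0%N n.+1>>.
      have [B HB] : exists B : {vspace V}, forall v, v \in B <-> T v \in <<ch 0%N n.+1>>%VS.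
        apply: vspace_of_pred => [|b u1 u2 H1 H2]; first by rewrite hom0 mem0v.
        by rewrite homD homZ rpredD ?rpredZ.
      have /subvP sub : (<<ch 0%N n.+1>> <= B)%VS.
        apply/span_subvP => _ /mapP [j jI ->]; apply/HB; rewrite -iterS.
        have [e|ne] := eqVneq j n; first by rewrite e Tn1 ?mem0v.
        apply: memv_span; apply/mapP; exists j.+1 => //; move: jI; rewrite !mem_iota /= !add0n !ltnS => le.
        by rewrite ltn_neqAle ne.
      by move=> v1 /sub /HB.
    by rewrite iE; apply: stabX.
  have /HU' [_ ->] // : u - iter m.+1 T (v' - s) \in U'.
  by rewrite rpredB // iE; apply: stabX.
exists (n.+1 :: sz); last by rewrite /= goodn.
exists ((w, n.+1) :: c); split=> [|p|].
- by rewrite /= szE.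
- rewrite inE => /orP [/eqP ->|/Hc //]; split=> //; exact: kn.
rewrite /= -UE; apply: (@cat_basis _ _ _ _ (ch 0%N n.+1)) bc.
  exact/directv_addP.
by rewrite /basis_of eqxx ch_free.
Qed.

(** From [[T^2, Y] = T] follows [[T^(2n+2), Y] = (n+1) T^(2n+1)]. Hence a vector of the kernel of
    the form [T^(2n+1) w] also lies in the image of [T^(2n+2)], which excludes blocks of size
    [2n+2]. *)
Lemma neat_crit (T Y : 'End(V)) : (forall v, T (T (Y v)) - Y (T (T v)) = T v) -> nilp T ->
  [pchar k] =i pred0 -> neat_on T fullv.
Proof.
move=> TY [N TN] char0; apply: jordan_chains => [v _||m u w _ _ uE Tu].
- exact: memvf.
- by exists N => u _; rewrite -exprE TN zero_lfunE.
rewrite /= negbK => om; have mE : m = m./2.*2.+1 by rewrite -[LHS]odd_double_half om.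
move: (m./2) mE => n mE; rewrite {m om}mE in uE *.
have key j v : iter j.*2.+2 T (Y v) = Y (iter j.*2.+2 T v) + j.+1%:R *: iter j.*2.+1 T v.
  elim: j => [|j IHj]; first by rewrite /= scale1r -[X in _ + X]TY addrC subrK.
  have TTY x : T (T (Y x)) = Y (T (T x)) + T x by rewrite -[X in _ + X]TY addrC subrK.
  rewrite doubleS 2!iterS IHj !(homE, TTY) -!iterS -[in RHS](addn1 j.+1) natrD.
  by vring.
exists (n.+1%:R^-1 *: Y w); first exact: memvf.
rewrite -iterS; have -> : iter n.*2.+2 T (n.+1%:R^-1 *: Y w) = n.+1%:R^-1 *: iter n.*2.+2 T (Y w).
  by rewrite -!exprE homZ.
rewrite key (iterS n.*2.+1) -uE Tu hom0 add0r scalerA mulVf ?scale1r //.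
exact: natf_neq0.
Qed.

End JordanChains.

(** * The criterion for balanced operators *)

Section Balanced.
Variables (k : closedFieldType) (V : vectType k).
Hypothesis char0 : [pchar k] =i pred0.
Variables (U : {vspace V}) (T E H F b : 'End(V)) (bs : nat -> 'End(V)) (N : nat).
Hypothesis S : sl2 E H F.
Hypothesis stE : stab E U.
Hypothesis stH : stab H U.
Hypothesis stF : stab F U.
Hypothesis stb : stab b U.
Hypothesis stbs : forall j, stab (bs j) U.
Hypothesis TE : forall v, v \in U -> T v = \sum_(j < N.+1) bs j v.
Hypothesis TT : forall v, v \in U -> T (T v) = E v.
Hypothesis Hbs : forall j v, H (bs j v) = bs j (H v) + j%:R *: bs j v.
Hypothesis aE : forall v, bs 0%N (E v) = E (bs 0%N v).
Hypothesis aF : forall v, bs 0%N (F v) = F (bs 0%N v).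
Hypothesis ab : forall v, E v = bs 0%N (b v) + b (bs 0%N v).
Hypothesis Hb : forall v, H (b v) = b (H v) + 2%:R *: b v.

Lemma hge_splitA i (A : {vspace V}) v : hge H i v -> stab H A -> v \in A ->
  exists u w, [/\ [/\ u \in A & w \in A], H u = i%:R *: u, hge H i.+1 w & v = u + w].
Proof.
move=> Hv sA vA; have [u [w [Hu Hw e]]] := hge_split Hv.
suff uA : u \in A.
  exists u, w; split=> //; split=> //.
  by rewrite -[w](addKr u) -e rpredD // rpredN.
have [s [wE Hs]] := Hw; pose q : {poly k} := \prod_(t <- s) ('X - (t.1%:R)%:P).
have q0 : q.[i%:R] != 0.
  rewrite /q horner_prod prodf_seq_neq0; apply/allP => t /Hs [_ le] /=.
  rewrite !hornerE subr_eq0; apply/negP => /eqP /(natf_inj char0) e'.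
  by rewrite -e' ltnn in le.
have qw : pact H q w = 0.
  rewrite wE linear_sum big_seq; apply: big1 => t ts /=; have [e' _] := Hs t ts.
  rewrite (pact_eigen _ e') (_ : q.[_] = 0) ?scale0r // /q.
  by rewrite (big_rem t) //= hornerM !hornerE subrr mul0r.
have : pact H q v \in A by apply: pact_stab.
by rewrite e homD qw addr0 (pact_eigen _ Hu) rpredZeq (negPf q0).
Qed.

(** Let [a] be the weight-zero part of [T]. The leading component [u1] of [u] satisfies [a u1 = 0],
    and [E = a b + b a] makes [b F / m] a homotopy: [a w = u1]. Lefschetz on the kernel of [a]
    changes [w] into a vector [t] killed by [E], still of weight [m], hence in the image of [E^l].
    Now [u - T t] starts in a higher weight. *)
Lemma balanced_step m : (0 < m)%N -> forall u, u \in U -> T u = 0 -> E u = 0 -> hge H m u ->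
  forall l, (l <= m)%N -> exists2 t, t \in U & u = T ((E ^+ l) t).
Proof.
have [M HM] := hge_top char0 H.
have stT : stab T U by move=> v vU; rewrite TE // rpred_sum // => j _; apply: stbs.
have hbs i j v : hge H i v -> hge H (i + j) (bs j v).
  apply: hge_map => n u Hu; by rewrite Hbs Hu homZ natrD scalerDl.
have ETT v : v \in U -> E (T v) = T (E v) by move=> vU; rewrite -!TT // stT.
have [d] : exists d, (M <= m + d)%N by exists M; rewrite leq_addl.
elim: d m => [|d IH] m Mm m0 u uU Tu Eu Hu l lm.
  exists 0; rewrite ?mem0v // !hom0; apply: HM Hu; by rewrite addn0 in Mm.
have sG : stab H (U :&: lker E)%VS.
  move=> v; rewrite !memv_cap !memv_ker => /andP [vU /eqP Ev]; rewrite stH //=.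
  by have := sl2_HEv v S; rewrite Ev !hom0 scaler0 addr0 => <-.
have uG : u \in (U :&: lker E)%VS by rewrite memv_cap uU memv_ker Eu eqxx.
have [u1 [u2 [[u1G u2G] Hu1 Hu2 uE]]] := hge_splitA Hu sG uG.
move: u1G u2G; rewrite !memv_cap !memv_ker => /andP [u1U /eqP Eu1] /andP [u2U /eqP Eu2].
have hi : hge H m u1 by apply: hge_eig Hu1 _.
have au1 : bs 0%N u1 = 0.
  have e : bs 0%N u1 = - (\sum_(j < N) bs j.+1 u1 + T u2).
    apply/eqP; rewrite -subr_eq0 opprK addrA; apply/eqP; rewrite -[RHS]Tu uE homD; congr (_ + _).
    by rewrite TE // big_ord_recl.
  have eig : H (bs 0%N u1) = m%:R *: bs 0%N u1 by rewrite Hbs Hu1 homZ scale0r addr0.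
  apply: (hge_eig0 char0 _ eig (ltnSn m)).
  rewrite e; apply: hgeN; apply: hgeD.
    apply: hge_sum => j _; apply: hge_le (hbs m j.+1 u1 hi); by rewrite addnS ltnS leq_addr.
  rewrite TE //; apply: hge_sum => j _; apply: hge_le (hbs m.+1 j u2 Hu2); by rewrite leq_addr.
have m0' : (m%:R : k) != 0 by case: (m) m0 => // m' _; apply: natf_neq0.
pose w := m%:R^-1 *: b (F u1).
have aw : bs 0%N w = u1.
  have := sl2_EFv u1 S; rewrite Eu1 hom0 add0r ab aF au1 !hom0 addr0 Hu1 => e.
  by rewrite homZ e scalerA mulVf // scale1r.
have wU : w \in U by rewrite rpredZ // stb // stF.
have Hw : H w = m%:R *: w.
  by rewrite /w homZ Hb (sl2_HFv _ S) Hu1 !homE; vring.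
pose A := (U :&: lker (bs 0%N))%VS.
have sA (X : 'End(V)) : stab X U -> (forall v, bs 0%N (X v) = X (bs 0%N v)) -> stab X A.
  move=> sX aX v; rewrite !memv_cap !memv_ker => /andP [vU /eqP av]; by rewrite sX //= aX av hom0.
have aH v : bs 0%N (H v) = H (bs 0%N v) by rewrite Hbs scale0r addr0.
have EwA : E w \in A by rewrite memv_cap stE //= memv_ker aE aw Eu1.
have HEw : H (E w) = m.+2%:R *: E w.
  by rewrite (sl2_HEv _ S) Hw homZ -scalerDl -natrD addn2.
have [w' [w'A Hw' Ew']] := lefschetz_surj char0 S (sA E stE aE) (sA H stH aH) (sA F stF aF) EwA HEw.
move: w'A; rewrite memv_cap memv_ker => /andP [w'U /eqP aw'].
pose t := w - w'.
have tU : t \in U by rewrite rpredB.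
have Et : E t = 0 by rewrite homD homN -Ew' subrr.
have Ht : H t = m%:R *: t.
  rewrite homD homN Hw Hw' -(addn2 m) natrD; vring.
have at_ : bs 0%N t = u1 by rewrite homD homN aw aw' subr0.
have [t' t'U tE] := lefschetz_pow char0 S stF tU Et Ht lm.
have TtU : T t \in U by apply: stT.
have hT : hge H m.+1 (u - T t).
  rewrite uE TE // big_ord_recl /= at_ opprD addrACA subrr add0r.
  apply: hgeB => //; apply: hge_sum => j _.
  apply: hge_le (hbs m j.+1 t (hge_eig Ht (leqnn m))); by rewrite addnS ltnS leq_addr.
have Mm' : (M <= m.+1 + d)%N by rewrite addSnnS.
have vU : u - T t \in U by rewrite rpredB.
have Tv : T (u - T t) = 0 by rewrite homD homN Tu TT // Et subrr.
have Ev : E (u - T t) = 0 by rewrite homD homN Eu ETT // Et hom0 subrr.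
have [t2 t2U e] := IH m.+1 Mm' isT (u - T t) vU Tv Ev hT l (leqW lm).
exists (t' + t2); first by rewrite rpredD.
by rewrite !homD -tE -e addrC subrK.
Qed.

(** The forbidden sizes are [2l+1] with [l > 0]. A vector [u = T^(2l) w = E^l w] killed by [T] is
    killed by [E] and has weights at least [l], so [balanced_step] writes it as [T^(2l+1) t]. *)
Lemma balanced_crit : balanced_on T U.
Proof.
have stT : stab T U by move=> v vU; rewrite TE // rpred_sum // => j _; apply: stbs.
have pw l v : v \in U -> iter l.*2 T v = (E ^+ l) v.
  move=> vU; elim: l => [|l IH]; first by rewrite expr0 oneE.
  have xU : (E ^+ l) v \in U by apply: stabX.
  by rewrite doubleS 2!iterS IH TT // exprS mulE.
have [M EM] := sl2_nilp char0 S; apply: jordan_chains => [//||m u w uU wU uE Tu].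
  by exists M.*2 => u uU; rewrite pw // EM zero_lfunE.
rewrite negb_or negbK => /andP [m0]; rewrite /= => om.
have mE : m = m./2.*2 by rewrite -[LHS]odd_double_half (negPf om).
have l0 : (0 < m./2)%N by move: m0; rewrite mE; case: (m./2).
move: (m./2) mE l0 => l mE l0; rewrite {m m0 om}mE in uE *.
have Eu : E u = 0 by rewrite -TT // Tu hom0.
have [HE EF _] := S.
rewrite pw // in uE.
have [s [us Hs]] := sl2_ker_hge char0 HE EF (sl2_nilp char0 S) stH uU uE Eu.
have hu : hge H l u by exists s; split=> // t /Hs [].
have [t tU ->] := balanced_step l0 uU Tu Eu hu (leqnn l).
by exists t => //; rewrite -(pw _ _ tU).
Qed.

End Balanced.

(** * Brackets, parities and inner automorphisms *)

Section Brackets.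
Variables (k : fieldType) (L : lieSuperalgebra k).
Local Notation even u := (u \in homog L false).
Local Notation odd u := (u \in homog L true).
Implicit Types (u v w a : L).

Lemma parity_split v : exists v0 v1, [/\ even v0, odd v1 & v = v0 + v1].
Proof.
have : v \in (homog L false + homog L true)%VS by rewrite homog_full memvf.
by move=> /memv_addP [v0 e0 [v1 e1 e]]; exists v0, v1.
Qed.

Lemma adD u v w : ad L (u + v) w = ad L u w + ad L v w.
Proof. by rewrite linearD addE. Qed.
Lemma adZ c u w : ad L (c *: u) w = c *: ad L u w.
Proof. by rewrite linearZ scaleE. Qed.
Lemma adN u w : ad L (- u) w = - ad L u w.
Proof. by rewrite linearN oppE. Qed.
Lemma ad0 w : ad L 0 w = 0.
Proof. by rewrite linear0 zero_lfunE. Qed.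
Definition adE := (adD, adZ, adN, ad0, homE).

Lemma jac_even a v w : even a -> ad L a (ad L v w) = ad L (ad L a v) w + ad L v (ad L a w).
Proof.
move=> ea; have [v0 [v1 [e0 e1 ->]]] := parity_split v.
rewrite !adE (ad_jacobi w ea e0) (ad_jacobi w ea e1) /= expr0 !scale1r.
by vring.
Qed.

Lemma jac_odd a (b : L) w : odd a -> odd b -> ad L (ad L a b) w = ad L a (ad L b w) + ad L b (ad L a w).
Proof.
by move=> oa ob; rewrite (ad_jacobi w oa ob) /= expr1 scaleN1r subrK.
Qed.

Lemma ad_comm a v : even a -> ad L a * ad L v - ad L v * ad L a = ad L (ad L a v).
Proof.
by move=> ea; apply/lfunP => w; rewrite !endE jac_even // addrK.
Qed.

Lemma anti_even a v : even a -> ad L a v = - ad L v a.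
Proof.
move=> ea; have [v0 [v1 [e0 e1 ->]]] := parity_split v.
by rewrite !adE (ad_antisym ea e0) (ad_antisym ea e1) /= expr0 !scale1r opprD.
Qed.

Lemma anti_even' a v : even a -> ad L v a = - ad L a v.
Proof. by move=> ea; rewrite (anti_even v ea) opprK. Qed.

Lemma sym_odd a (b : L) : odd a -> odd b -> ad L a b = ad L b a.
Proof. by move=> oa ob; rewrite (ad_antisym oa ob) /= expr1 scaleN1r opprK. Qed.

Lemma even_even u v : even u -> even v -> even (ad L u v).
Proof. exact: ad_homog. Qed.
Lemma even_odd u v : even u -> odd v -> odd (ad L u v).
Proof. exact: ad_homog. Qed.
Lemma odd_even u v : odd u -> even v -> odd (ad L u v).
Proof. exact: ad_homog. Qed.
Lemma odd_odd u v : odd u -> odd v -> even (ad L u v).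
Proof. exact: ad_homog. Qed.

Lemma parity0 v : even v -> odd v -> v = 0.
Proof.
by move=> ev ov; apply/eqP; rewrite -memv0 -(homog_direct L) memv_cap ev ov.
Qed.

Definition lie_hom (L' : lieSuperalgebra k) (phi : 'Hom(L, L')) :=
  (forall p v, v \in homog L p -> phi v \in homog L' p) /\
  forall u v, phi (ad L u v) = ad L' (phi u) (phi v).

(* [phi] and [psi] are mutually inverse automorphisms, unipotent with respect to
   every filtration compatible with the elements satisfying [P]. *)
Definition inner (P : L -> Prop) (phi psi : 'End(L)) :=
  [/\ lie_hom phi, lie_hom psi, phi * psi = 1, psi * phi = 1 &
   forall A B : {vspace L}, (forall n, P n -> stab (ad L n) A) ->
     (forall n v, P n -> v \in B -> ad L n v \in A) ->
     forall v, v \in B -> phi v - v \in A /\ psi v - v \in A].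

Lemma inner_id P : inner P 1 1.
Proof.
split; rewrite ?mulr1 //; try by split=> [b v|u v]; rewrite !oneE.
by move=> A B _ _ v _; rewrite oneE subrr mem0v.
Qed.

Lemma lie_hom_comp (f g : 'End(L)) : lie_hom f -> lie_hom g -> lie_hom (f * g).
Proof.
move=> [fp fh] [gp gh]; split=> [b v vb|u v]; first by rewrite mulE; apply/fp/gp.
by rewrite !mulE gh fh.
Qed.

Lemma inner_mul P f f' g g' : inner P f f' -> inner P g g' -> inner P (f * g) (g' * f').
Proof.
move=> [hf hf' ff' f'f Hf] [hg hg' gg' g'g Hg]; split; try exact: lie_hom_comp.
- by rewrite mulrA -(mulrA f) gg' mulr1.
- by rewrite mulrA -(mulrA g') f'f mulr1.
move=> A B PA PB v vB; rewrite !mulE.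
have [g1 g2] := Hg A B PA PB v vB; have [f1 f2] := Hf A B PA PB v vB.
have PA2 n w Pn := PA n Pn w; have [f3 _] := Hf A A PA PA2 _ g1; have [_ g3] := Hg A A PA PA2 _ f2.
split.
  have -> : f (g v) - v = (f (g v - v) - (g v - v)) + (f v - v) + (g v - v) by rewrite !homE; vring.
  exact: (rpredD (rpredD f3 f1) g1).
have -> : g' (f' v) - v = (g' (f' v - v) - (f' v - v)) + (g' v - v) + (f' v - v) by rewrite !homE; vring.
exact: (rpredD (rpredD g3 g2) f2).
Qed.

Lemma inner_fix P phi psi v : inner P phi psi -> (forall n, P n -> ad L n v = 0) ->
  phi v = v /\ psi v = v.
Proof.
move=> [_ _ _ _ H] Pv; have [||f1 f2] := H 0%VS <[v]>%VS _ _ v (memv_line v).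
- by move=> n _ w; rewrite !memv0 => /eqP ->; rewrite hom0.
- by move=> n _ Pn /vlineP [c ->]; rewrite homZ Pv // scaler0 mem0v.
by move: f1 f2; rewrite !memv0 !subr_eq0 => /eqP -> /eqP ->.
Qed.

End Brackets.

(** * Truncated exponentials of nilpotent endomorphisms *)

Section Exponential.
Variables (k : closedFieldType) (V : vectType k).
Hypothesis char0 : [pchar k] =i pred0.
Implicit Types (f : 'End(V)).

Definition divpow f i : 'End(V) := i`!%:R^-1 *: f ^+ i.
Definition expN N f : 'End(V) := \sum_(i < N) divpow f i.

Let factr0 i : (i`!%:R : k) != 0.
Proof. by have := fact_gt0 i; case: (i`!) => // n _; apply: natf_neq0. Qed.

Lemma divpow0 f : divpow f 0 = 1.
Proof. by rewrite /divpow fact0 invr1 scale1r expr0. Qed.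

Lemma divpowS f i v : f (divpow f i v) = i.+1%:R *: divpow f i.+1 v.
Proof.
rewrite /divpow !scaleE homZ -mulE -exprS scalerA factS natrM invfM mulrA mulfV ?mul1r //.
exact: natf_neq0.
Qed.

Lemma divpow_top f N i : f ^+ N = 0 -> (N <= i)%N -> divpow f i = 0.
Proof. by move=> fN /subnK <-; rewrite /divpow exprD fN mulr0 scaler0. Qed.

Lemma sum_trunc (W : zmodType) N M (F : nat -> W) : (forall j, (N <= j)%N -> F j = 0) -> (N <= M)%N ->
  \sum_(j < M) F j = \sum_(j < N) F j.
Proof.
move=> F0 NM; rewrite (big_ord_widen _ F NM) [LHS](bigID (fun i : 'I_M => (i < N)%N)) /=.
by rewrite [X in _ + X]big1 ?addr0 // => i; rewrite -leqNgt => /F0.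
Qed.

(** Antidiagonals up to twice the truncation order meet every pair, so a product of two truncated
    series can be summed by total degree. *)
Lemma triangle_sum N (W : zmodType) (G : nat -> nat -> W) :
  (forall i j, (N <= i)%N || (N <= j)%N -> G i j = 0) ->
  \sum_(n < N + N) \sum_(i < n.+1) G i (n - i)%N = \sum_(i < N) \sum_(j < N) G i j.
Proof.
move=> G0; have tri M : \sum_(n < M) \sum_(i < n.+1) G i (n - i)%N = \sum_(i < M) \sum_(j < M - i) G i j.
  elim: M => [|M IH]; first by rewrite !big_ord0.
  rewrite big_ord_recr /= IH [RHS]big_ord_recr /= subSnn big_ord1 [in LHS]big_ord_recr /= subnn addrA.
  congr (_ + _); rewrite -big_split; apply: eq_bigr => i _ /=.
  by rewrite subSn ?big_ord_recr // ltnW.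
rewrite tri (sum_trunc (N := N) (F := fun i => \sum_(j < N + N - i) G i j)) ?leq_addr // => [|i Ni]; last by apply: big1 => j _; rewrite G0 ?Ni.
apply: eq_bigr => i _; apply: (sum_trunc (F := G i)) => [j Nj|]; first by rewrite G0 // Nj orbT.
by rewrite -addnBA ?leq_addr // ltnW.
Qed.

Lemma expN_trunc f N M v : f ^+ N = 0 -> (N <= M)%N -> \sum_(i < M) divpow f i v = expN N f v.
Proof.
move=> fN NM; rewrite /expN sum_lfunE; apply: (sum_trunc (F := fun i => divpow f i v)) NM => j Nj.
by rewrite (divpow_top fN Nj) zero_lfunE.
Qed.

Lemma divpowD f n : \sum_(i < n.+1) divpow (- f) i * divpow f (n - i)%N = (n == 0%N)%:R.
Proof.
have c : GRing.comm f (- f) by rewrite /GRing.comm mulrN mulNr.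
transitivity (n`!%:R^-1 *: ((f + - f) ^+ n)).
  rewrite exprDn_comm // scaler_sumr; apply: eq_bigr => i _; rewrite /divpow mulEZl mulEZr scalerA.
  have c' : f ^+ (n - i) * (- f) ^+ i = (- f) ^+ i * f ^+ (n - i) by apply: commrX; apply/commr_sym/commrX/commr_sym.
  rewrite c' -scaler_nat scalerA; congr (_ *: _).
  have le : (i <= n)%N by rewrite -ltnS.
  rewrite -(bin_fact le) !natrM !invfM.
  have b0 : ('C(n, i)%:R : k) != 0.
    by have := bin_gt0 n i; rewrite le; case: ('C(n, i)) => // m _; apply: natf_neq0.
  by field; rewrite b0 !factr0.
rewrite subrr; case: n => [|n]; first by rewrite expr0 invr1 scale1r.
by rewrite exprS mul0r scaler0.
Qed.

Lemma expN_inv f N : f ^+ N = 0 -> expN N (- f) * expN N f = 1.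
Proof.
move=> fN; have fN' : (- f) ^+ N = 0 by rewrite exprNn fN mulr0.
have [N0|N0] := posnP N.
  by move: fN; rewrite N0 expr0 => e; rewrite -[LHS]mul1r e mul0r.
rewrite /expN mulr_suml; under eq_bigr do rewrite mulr_sumr.
rewrite -(triangle_sum (G := fun i j => divpow (- f) i * divpow f j)); last first.
  by move=> i j /orP [Ni|Nj]; [rewrite (divpow_top fN') ?mul0r|rewrite (divpow_top fN) ?mulr0].
under eq_bigr do rewrite divpowD.
case: N N0 {fN fN'} => // N _; rewrite addSn big_ord_recl /= big1 ?addr0 // => i _.
Qed.

Lemma expN_near f N (A : {vspace V}) v : (0 < N)%N -> f v \in A -> stab f A -> expN N f v - v \in A.
Proof.
case: N => // N _ fv sA; rewrite /expN sum_lfunE big_ord_recl /= divpow0 oneE addrC addKr.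
apply: rpred_sum => i _; rewrite /divpow scaleE rpredZ // exprSr mulE.
by apply: stabX.
Qed.

Lemma expN_near2 f N (A : {vspace V}) v : (1 < N)%N -> f (f v) \in A -> stab f A ->
  expN N f v - (v + f v) \in A.
Proof.
case: N => [|[|N]] // _ fv sA; rewrite /expN sum_lfunE 2!big_ord_recl /= divpow0 oneE.
set S := \sum_(i < N) _; have d1 : divpow f (bump 0 0) v = f v by rewrite /divpow invr1 scale1r expr1.
rewrite d1 (_ : _ - _ = S); last by vring.
apply: rpred_sum => i _; rewrite /divpow scaleE rpredZ // /bump /= 2!exprSr mulE mulE.
by apply: stabX.
Qed.

End Exponential.

(** * Exponentials of even inner derivations *)

Section LieExponential.
Variables (k : closedFieldType) (L : lieSuperalgebra k).
Hypothesis char0 : [pchar k] =i pred0.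
Local Notation even u := (u \in homog L false).
Local Notation odd u := (u \in homog L true).
Implicit Types (u v w a n : L).

(** Divided powers absorb the binomial coefficients. In the induction the factor [m + 1] splits as
    [i + (m + 1 - i)], one share for each argument of the bracket. *)
Lemma divpow_leibniz n m u v : even n -> divpow (ad L n) m (ad L u v) =
  \sum_(i < m.+1) ad L (divpow (ad L n) i u) (divpow (ad L n) (m - i) v).
Proof.
move=> en; elim: m => [|m IH]; first by rewrite big_ord1 divpow0 !oneE.
have m0 := natf_neq0 char0 m.
apply: (scalerI m0); rewrite -(divpowS char0) IH linear_sum /=.
under eq_bigr => i _ do rewrite jac_even // !(divpowS char0) adZ homZ.
rewrite big_split /= scaler_sumr.
transitivity (\sum_(i < m.+2) (i%:R + (m.+1 - i)%:R) *: ad L (divpow (ad L n) i u) (divpow (ad L n) (m.+1 - i) v)); last first.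
  apply: eq_bigr => i _; by rewrite -natrD subnKC // -ltnS.
under [RHS]eq_bigr => i _ do rewrite scalerDl.
rewrite [RHS]big_split /=; congr (_ + _).
  rewrite [RHS]big_ord_recl /= scale0r add0r; apply: eq_bigr => i _.
  by rewrite /bump /= subSS.
rewrite [RHS]big_ord_recr /= subnn scale0r addr0; apply: eq_bigr => i _.
by rewrite subSn // -ltnS.
Qed.

Lemma expN_hom n N : even n -> ad L n ^+ N = 0 -> lie_hom (expN N (ad L n)).
Proof.
move=> en nN; split=> [p v vp|u v].
  rewrite /expN sum_lfunE; apply: rpred_sum => i _; rewrite /divpow scaleE rpredZ // exprE.
  by elim: (val i) => [//|j IH]; rewrite iterS; apply: (ad_homog en IH).
rewrite -(expN_trunc _ nN (leq_addr N N)).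
under eq_bigr => m _ do rewrite divpow_leibniz //.
rewrite (triangle_sum (G := fun i j => ad L (divpow (ad L n) i u) (divpow (ad L n) j v))); last first.
  move=> i j /orP [Ni|Nj]; first by rewrite (divpow_top nN) // zero_lfunE ad0.
  by rewrite (divpow_top nN Nj) zero_lfunE hom0.
rewrite /expN !sum_lfunE [ad L (\sum_(_ < _) _)]linear_sum sum_lfunE; apply: eq_bigr => i _.
by rewrite linear_sum.
Qed.

Lemma inner_exp (P : L -> Prop) n N : even n -> ad L n ^+ N = 0 -> P n -> (0 < N)%N ->
  inner P (expN N (ad L n)) (expN N (- ad L n)).
Proof.
move=> en nN Pn N0; have nN' : (- ad L n) ^+ N = 0 by rewrite exprNn nN mulr0.
split.
- exact: expN_hom.
- by rewrite -linearN /=; apply: expN_hom; rewrite ?rpredN //= linearN.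
- by rewrite -{1}[ad L n]opprK expN_inv.
- exact: expN_inv.
move=> A B PA PB v vB; split; apply: expN_near => //.
- exact: PB.
- exact: PA.
- by rewrite oppE rpredN PB.
by apply/stabN/PA.
Qed.

End LieExponential.

(** * sl2-triples in a Lie superalgebra *)

Section Triples.
Variables (k : closedFieldType) (L : lieSuperalgebra k).
Hypothesis char0 : [pchar k] =i pred0.
Local Notation even u := (u \in homog L false).
Local Notation odd u := (u \in homog L true).
Implicit Types (u v w a n e h f : L).

Definition triple e h f := [/\ even e, even h, even f &
  [/\ ad L h e = 2%:R *: e, ad L e f = h & ad L h f = - 2%:R *: f]].

Lemma triple_sl2 e h f : triple e h f -> sl2 (ad L e) (ad L h) (ad L f).
Proof.
move=> [ee eh ef [he e_f hf]]; split; rewrite ad_comm //.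
- by rewrite he linearZ.
- by rewrite e_f.
- by rewrite hf linearZ.
Qed.

Lemma flag_stab (V : vectType k) (S : 'End(V) -> Prop) K (T : 'End(V)) i : lower_central S K ->
  (forall t, S t -> S (t * T - T * t)) -> stab T (K i).
Proof.
move=> [K0 KS] ST; elim: i => [|i IH] v; first by move/K0 => ->; rewrite hom0 mem0v.
move=> /KS vK; apply/KS => t St; have := vK _ (ST t St); rewrite !endE => H.
by rewrite -[t (T v)](subrK (T (t v))) rpredD // IH // vK.
Qed.

(** Successive approximation along the Engel flag of [NN]: since [ad E] maps weight zero onto weight
    two at each level, [nu] is the first-order effect on [E] of the exponential of an element of
    weight zero. *)
Lemma conj_triple E H F (NN : {vspace L}) nu : triple E H F ->
  (forall n, n \in NN -> even n /\ nilp (ad L n)) ->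
  (forall m n, m \in NN -> n \in NN -> ad L m n \in NN) ->
  stab (ad L E) NN -> stab (ad L H) NN -> stab (ad L F) NN ->
  nu \in NN -> ad L H nu = 2%:R *: nu ->
  exists phi psi, inner (fun n => n \in NN /\ ad L H n = 0) phi psi /\ phi E = E + nu.
Proof.
move=> tr Nn Nb sE sH sF nuN Hnu; have S := triple_sl2 tr; have [eE eH eF [HE EF HF]] := tr.
pose SS (t : 'End(L)) := exists2 n, n \in NN & t = ad L n.
have [t [n nN ->]|t1 t2 [n1 n1N ->] [n2 n2N ->]|K [N [FK KN]]] := @engel_flag _ _ SS.
- by case: (Nn n nN).
- by exists (ad L n1 n2); [exact: Nb|rewrite ad_comm //; case: (Nn _ n1N)].
have norm X : even X -> stab (ad L X) NN -> forall i, stab (ad L X) (K i :&: NN).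
  move=> eX sX i v; rewrite !memv_cap => /andP [vK vN]; rewrite (sX _ vN) andbT.
  apply: (flag_stab FK) vK => t [n nN ->]; exists (ad L n X); last by rewrite ad_comm //; case: (Nn _ nN).
  by have [en _] := Nn n nN; rewrite (anti_even X en) rpredN; apply: sX.
have [K0 KS] := FK.
have normN n i : n \in NN -> stab (ad L n) (K i :&: NN).
  move=> nN v; rewrite !memv_cap => /andP [vK vN]; rewrite Nb // andbT.
  case: i vK => [/K0 ->|i /KS vK]; first by rewrite hom0 mem0v.
  by apply: (subvP (flag_mono i FK)); apply: vK; exists n.
have claim i nu' : nu' \in (K i :&: NN)%VS -> ad L H nu' = 2%:R *: nu' ->
    exists phi psi, inner (fun n => n \in NN /\ ad L H n = 0) phi psi /\ phi E = E + nu'.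
  elim: i nu' => [|i IH] nu' nuK Hnu'.
    exists 1, 1; split; first exact: inner_id.
    by move: nuK; rewrite memv_cap => /andP [/K0 ->]; rewrite addr0 oneE.
  have [w [wA Hw nuE]] := lefschetz_surj char0 S (norm E eE sE i.+1) (norm H eH sH i.+1) (norm F eF sF i.+1) nuK Hnu'.
  rewrite subrr scale0r in Hw; pose n := - w.
  have nA : n \in (K i.+1 :&: NN)%VS by rewrite rpredN.
  have nN : n \in NN by move: nA; rewrite memv_cap => /andP [].
  have [en [M nM]] := Nn n nN.
  have nE : ad L n E = nu' by rewrite (anti_even E en) /n homN opprK.
  have Hn : ad L H n = 0 by rewrite homN Hw oppr0.
  have nM2 : ad L n ^+ M.+2 = 0 by rewrite -addn2 exprD nM mul0r.
  have in1 := inner_exp (P := fun n => n \in NN /\ ad L H n = 0) char0 en nM2 (conj nN Hn) (ltn0Sn _).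
  set phi := expN _ _ in in1; set psi := expN _ _ in in1.
  (* The second-order error lies one step deeper in the flag; its preimage under [phi] is removed by
     the induction hypothesis. *)
  pose nu2 := phi E - (E + nu').
  have nu2K : nu2 \in (K i :&: NN)%VS.
    rewrite /nu2 -nE; apply: expN_near2 => //; last exact: normN.
    rewrite nE memv_cap; move: nuK; rewrite memv_cap => /andP [/KS nuK nu'N]; rewrite Nb // andbT.
    by apply: nuK; exists n.
  have [[_ h1] [_ h2] e1 e2 near] := in1.
  have [fH gH] : phi H = H /\ psi H = H.
    by apply: (inner_fix in1) => m [mN Hm]; have [em _] := Nn m mN; rewrite (anti_even _ em) Hm oppr0.
  have Hnu2 : ad L H nu2 = 2%:R *: nu2.
    by rewrite /nu2 homD homN homD -{1}fH -h1 HE Hnu' !homE; vring.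
  have psiK : psi nu2 \in (K i :&: NN)%VS.
    have [||_ d] := near (K i :&: NN)%VS (K i :&: NN)%VS _ _ nu2 nu2K.
    - by move=> m [mN _]; apply: normN.
    - by move=> m v [mN _] vK; apply: normN.
    by rewrite -[psi nu2](subrK nu2) rpredD.
  have [||phi2 [psi2 [in2 phi2E]]] := IH (- psi nu2).
  - by rewrite rpredN.
  - by rewrite homN -{1}gH -h2 Hnu2 !homE; vring.
  exists (phi * phi2), (psi2 * psi); split; first exact: inner_mul.
  rewrite mulE phi2E homD homN -[phi (psi _)]mulE e1 oneE /nu2 opprB addrC.
  by rewrite subrK.
by apply: (claim N) => //; rewrite KN memv_cap memvf.
Qed.

(** Everything to be read off in an arbitrary representation, stated by brackets only so that
    homomorphisms transport it: [z, y, ez, c] will feed [neat_crit], and [E, H, F, be, b] will feed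
    [balanced_crit]. *)
Definition splits (s x : L) : Prop :=
  exists (z y ez c E H F be : L) (b : nat -> L) (N : nat),
  [/\ [/\ odd z, odd y, odd be & forall j, odd (b j)],
      [/\ even ez, even c & triple E H F],
      [/\ ad L z z = 2%:R *: ez, ad L ez y = z, ad L c ez = 2%:R *: ez &
          ad L z (\sum_(j < N.+1) b j) = 0],
      x = z + \sum_(j < N.+1) b j &
      [/\ forall j, ad L H (b j) = j%:R *: b j,
          [/\ ad L (b 0%N) E = 0, ad L (b 0%N) F = 0, ad L (b 0%N) be = E & ad L H be = 2%:R *: be],
          ad L (b 0%N) (b 0%N) = 2%:R *: s &
          ad L (\sum_(j < N.+1) b j) (\sum_(j < N.+1) b j) = 2%:R *: (s + E)]].

End Triples.

Lemma splits_hom (k : closedFieldType) (L L' : lieSuperalgebra k) (phi : 'Hom(L, L')) s x :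
  lie_hom phi -> splits s x -> splits (phi s) (phi x).
Proof.
move=> [hp hb] [z [y [ez [c [E [H [F [be [b [N]]]]]]]]]].
move=> [[oz oy obe ob] [eez ec [eE eH eF [HE EF HF]]] [zz ezy cez zb] xE [Hb [bE bF bbe Hbe] bb BB]].
have sE : \sum_(j < N.+1) phi (b j) = phi (\sum_(j < N.+1) b j) by rewrite linear_sum.
exists (phi z), (phi y), (phi ez), (phi c), (phi E), (phi H), (phi F), (phi be), (fun j => phi (b j)), N.
split.
- by split=> [|||j]; apply: hp.
- split; try exact: hp.
  by split; try exact: hp; rewrite -!hb HE EF HF !homE.
- by rewrite sE -!hb zz ezy cez zb !homE.
- by rewrite sE xE !homE.
split=> [j|||].
- by rewrite -hb Hb homE.
- by rewrite -!hb bE bF bbe Hbe !homE.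
- by rewrite -hb bb homE.
by rewrite sE -hb BB !homE.
Qed.

(** * Polynomials without constant term, and projection onto a kernel *)

Section PactZero.
Variables (k : closedFieldType) (V : vectType k).
Implicit Types (f : 'End(V)) (p : {poly k}).

Lemma pact_no_const f p : p`_0 = 0 -> exists q, forall v, pact f p v = pact f q (f v).
Proof.
move=> p0; have /factor_theorem [q ->] : root p 0 by rewrite /root horner_coef0 p0.
by exists q => v; rewrite subr0 pactMX mulE.
Qed.

Lemma pact_into f p (A : {vspace V}) v : p`_0 = 0 -> stab f A -> f v \in A -> pact f p v \in A.
Proof.
by move=> p0 sA fv; have [q ->] := pact_no_const f p0; apply: pact_stab.
Qed.

Lemma pact_kill f p v : p`_0 = 0 -> f v = 0 -> pact f p v = 0.
Proof. by move=> p0 fv; have [q ->] := pact_no_const f p0; rewrite fv hom0. Qed.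

(** One minus the replica of [f] for the indicator function of the nonzero scalars. *)
Lemma ker_projector f : diagz f -> exists P : 'End(V),
  [/\ forall v, f (P v) = 0, forall v, f v = 0 -> P v = v,
      forall g : 'End(V), f * g = g * f -> P * g = g * P &
      forall (A : {vspace V}) v, stab f A -> f v \in A -> v - P v \in A].
Proof.
move=> df; have [|p [p0 Hp]] := @replica _ _ f (fun r => (r != 0)%:R); first by rewrite eqxx.
have eig r v : f v = r *: v -> pact f p v = (r != 0)%:R *: v.
  by move=> fv; apply: Hp; exists 1%N; rewrite shift_powS fv subrr hom0.
exists (1 - pact f p); split=> [v|v fv|g fg|A v sA fv].
- have [rs [w [_ -> Hw]]] := df v; rewrite [_ (\sum_(_ <- _) _)]linear_sum [f _]linear_sum.
  apply: big1 => r _ /=.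
  have [e _] := Hw r; rewrite addE oneE oppE (eig _ _ e) homD homN homZ e.
  by have [->|_] := eqVneq r 0; rewrite ?scale0r ?scaler0 ?oppr0 ?addr0 // scale1r subrr.
- by rewrite !endE (pact_kill p0 fv) subr0.
- by rewrite mulrDl mulrDr mul1r mulr1 mulNr mulrN (pact_comm_with p fg).
by rewrite !endE opprB addrC subrK; apply: pact_into.
Qed.

End PactZero.

(** * Jordan decomposition in the even part, and the trace form *)

(** Since [p] has no constant term, [ad L b] kills what [ad L a] kills and maps into every stable
    subspace that receives [ad L a]; the semisimple part therefore inherits centralizers, cycles and
    ideals. *)
Definition jordan_closed (k : closedFieldType) (L : lieSuperalgebra k) :=
  forall a, a \in homog L false -> exists (p : {poly k}) (b : L),
   [/\ p`_0 = 0, b \in homog L false, ad L b = pact (ad L a) p, diagz (ad L b) & nilp (ad L a - ad L b)].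

Section Kappa.
Variables (k : closedFieldType) (L : lieSuperalgebra k).
Hypothesis char0 : [pchar k] =i pred0.
Local Notation even u := (u \in homog L false).
Implicit Types (u v w a b : L).

(** An ordinary trace over the whole superspace, not a supertrace; its invariance is used for
    brackets of even elements. *)
Definition kappa a b := tr (ad L a * ad L b).

Lemma kappaDr a b b' : kappa a (b + b') = kappa a b + kappa a b'.
Proof. by rewrite /kappa linearD mulrDr trD. Qed.
Lemma kappaZr a c b : kappa a (c *: b) = c * kappa a b.
Proof. by rewrite /kappa linearZ mulEZr trZ. Qed.
Lemma kappaC a b : kappa a b = kappa b a.
Proof. exact: trM. Qed.
Lemma kappa0r a : kappa a 0 = 0.
Proof. by rewrite /kappa linear0 mulr0 tr0. Qed.

Lemma kappa_inv a b c : even a -> even b -> kappa (ad L a b) c = kappa a (ad L b c).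
Proof.
move=> ea eb; rewrite /kappa -!ad_comm // mulrBl mulrBr !trD !trN; congr (_ - _).
  by rewrite mulrA.
by rewrite -mulrA trM -mulrA.
Qed.

Lemma geigen_bracket a (r c : k) u v : even a ->
  geigen (ad L a) r u -> geigen (ad L a) c v -> geigen (ad L a) (r + c) (ad L u v).
Proof.
move=> ea [M HM] [N HN]; exists (M + N)%N; have [n nE] : exists n, n = (M + N)%N by eexists.
rewrite -nE; elim: n M N nE u v HM HN => [|n IH] M N nE u v HM HN.
  move: nE HM => /esym/eqP; rewrite addn_eq0 => /andP [/eqP -> _].
  by rewrite /shift_pow expr0 pact1 !oneE => ->; rewrite ad0.
rewrite shift_powS jac_even //.
have -> : ad L (ad L a u) v + ad L u (ad L a v) - (r + c) *: ad L u v =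
    ad L (ad L a u - r *: u) v + ad L u (ad L a v - c *: v) by rewrite !adE; vring.
have z f x m : shift_pow f x m (0 : L) = 0 by rewrite hom0.
rewrite homD; case: M nE HM => [|M] nE HM.
  move: HM; rewrite /shift_pow expr0 pact1 oneE => ->; by rewrite !(hom0, scaler0, subr0, ad0, addr0).
rewrite (IH M N) -?shift_powS //; last by move: nE; rewrite addSn => [[]].
case: N nE HN => [|N] nE HN.
  move: HN; rewrite /shift_pow expr0 pact1 oneE => ->; by rewrite !(hom0, scaler0, subr0, ad0, addr0).
by rewrite (IH M.+1 N) -?shift_powS ?addr0 //; move: nE; rewrite addnS => [[]].
Qed.

(** The bracket adds generalized eigenvalues, so a function [t] that is additive on them gives a
    derivation. Additivity is asked only where all three eigenvalues occur, as in [cartan_nilp]. *)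
Lemma replica_derivation a (t : k -> k) p : even a ->
  (forall r v, geigen (ad L a) r v -> pact (ad L a) p v = t r *: v) ->
  (forall r s u v w, u != 0 -> v != 0 -> w != 0 ->
     geigen (ad L a) r u -> geigen (ad L a) s v -> geigen (ad L a) (r + s) w -> t (r + s) = t r + t s) ->
  forall u v, pact (ad L a) p (ad L u v) = ad L (pact (ad L a) p u) v + ad L u (pact (ad L a) p v).
Proof.
move=> ea Hp Ht u v; have [rs [P [_ vE Pg _]]] := geigen_decomp (ad L a).
have key r s u' v' : geigen (ad L a) r u' -> geigen (ad L a) s v' ->
   pact (ad L a) p (ad L u' v') = ad L (pact (ad L a) p u') v' + ad L u' (pact (ad L a) p v').
  move=> gu gv; have g := geigen_bracket ea gu gv.
  rewrite (Hp _ _ gu) (Hp _ _ gv) (Hp _ _ g) !adE -scalerDl.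
  have [->|w0] := eqVneq (ad L u' v') 0; first by rewrite !scaler0.
  have [e|u0] := eqVneq u' 0; first by rewrite e ad0 eqxx in w0.
  have [e|v0] := eqVneq v' 0; first by rewrite e hom0 eqxx in w0.
  by rewrite (Ht _ _ _ _ _ u0 v0 w0 gu gv g).
set S := pact (ad L a) p in key *.
have key2 r u' : geigen (ad L a) r u' -> S (ad L u' v) = ad L (S u') v + ad L u' (S v).
  move=> gu; rewrite (vE v) big_seq; elim/big_ind: _ => [|x y Qx Qy|s sr]; first by rewrite !adE addr0.
    by rewrite !homD Qx Qy addrACA.
  exact: key gu (Pg s v sr).
rewrite (vE u) big_seq; elim/big_ind: _ => [|x y Qx Qy|s sr]; first by rewrite !adE addr0.
  by rewrite adD !homD !adD Qx Qy addrACA.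
exact: key2 (Pg s u sr).
Qed.

End Kappa.

Lemma even_self (k : closedFieldType) (L : lieSuperalgebra k) (a : L) : [pchar k] =i pred0 ->
  a \in homog L false -> ad L a a = 0.
Proof.
move=> char0 ea; have /eqP := anti_even a ea; rewrite -addr_eq0 -mulr2n -scaler_nat.
by rewrite scaler_eq0 (negPf (natf_neq0 char0 1)) => /eqP.
Qed.

(** * Cycles, boundaries and the ideal acting by zero on homology *)

Section Homology.
Variables (k : closedFieldType) (L : lieSuperalgebra k).
Local Notation even u := (u \in homog L false).
Local Notation odd u := (u \in homog L true).
Implicit Types (u v w a b c : L).
Variables (x0 : L).
Hypothesis ox0 : odd x0.
Hypothesis DD : forall v, ad L x0 (ad L x0 v) = 0.
Local Notation D := (ad L x0).

Definition cyc := lker D.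
Definition bnd := limg D.

Lemma cycP v : (v \in cyc) = (D v == 0).
Proof. exact: memv_ker. Qed.

Lemma bndP v : v \in bnd <-> exists w, v = D w.
Proof.
by split=> [/memv_imgP [w _ ->]|[w ->]]; [exists w|apply: memv_img; rewrite memvf].
Qed.

Lemma bnd_cyc v : v \in bnd -> v \in cyc.
Proof. by move=> /bndP [w ->]; rewrite cycP DD. Qed.

Lemma D_even a v : even a -> a \in cyc -> ad L a (D v) = D (ad L a v).
Proof.
move=> ea; rewrite cycP => /eqP Da.
by rewrite jac_even // (anti_even x0 ea) Da oppr0 ad0 add0r.
Qed.

Lemma D_odd a v : odd a -> a \in cyc -> ad L a (D v) = - D (ad L a v).
Proof.
move=> oa; rewrite cycP => /eqP Da; apply/eqP; rewrite -addr_eq0 -jac_odd //.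
by rewrite (sym_odd oa ox0) Da ad0.
Qed.

Lemma cyc_split a : a \in cyc -> exists a0 a1, [/\ even a0, odd a1, a0 \in cyc, a1 \in cyc & a = a0 + a1].
Proof.
rewrite cycP => /eqP Da; have [a0 [a1 [e0 o1 aE]]] := parity_split a.
have e : D a0 = - D a1 by apply/eqP; rewrite -addr_eq0 -homD -aE Da.
have D1 : D a1 = 0.
  apply: parity0; first exact: odd_odd.
  by rewrite -[D a1]opprK -e rpredN; apply: odd_even.
by exists a0, a1; split; rewrite ?cycP ?e ?D1 ?oppr0.
Qed.

Lemma cyc_bnd a v : a \in cyc -> v \in bnd -> ad L a v \in bnd.
Proof.
move=> /cyc_split [a0 [a1 [e0 o1 c0 c1 ->]]] /bndP [w ->].
rewrite adD D_even // D_odd // -homN -homD; apply/bndP; by eexists.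
Qed.

Lemma cyc_cyc a v : a \in cyc -> v \in cyc -> ad L a v \in cyc.
Proof.
move=> /cyc_split [a0 [a1 [e0 o1 c0 c1 ->]]]; rewrite !cycP => /eqP Dv.
rewrite adD homD -D_even // -[D (ad L a1 v)]opprK -D_odd // Dv !hom0.
by rewrite oppr0 addr0.
Qed.

Lemma cyc_stab a : a \in cyc -> stab (ad L a) cyc.
Proof. by move=> ac v; apply: cyc_cyc. Qed.
Lemma bnd_stab a : a \in cyc -> stab (ad L a) bnd.
Proof. by move=> ac v; apply: cyc_bnd. Qed.

(* The even cycles acting by zero on the homology of [ad x0]. *)
Lemma null_exists : exists U : {vspace L}, forall a, a \in U <->
  [/\ even a, a \in cyc & forall c, c \in cyc -> ad L a c \in bnd].
Proof.
apply: vspace_of_pred => [|r a b [ea ca Ha] [eb cb Hb]].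
  by split; rewrite ?mem0v // => c _; rewrite ad0 mem0v.
split; try by rewrite rpredD ?rpredZ.
by move=> c cc; rewrite adD adZ rpredD ?rpredZ ?Ha ?Hb.
Qed.

Definition null := sval (constructive_indefinite_description _ null_exists).

Lemma nullP a : a \in null <-> [/\ even a, a \in cyc & forall c, c \in cyc -> ad L a c \in bnd].
Proof. exact: (svalP (constructive_indefinite_description _ null_exists)). Qed.

Lemma null_even a : a \in null -> even a. Proof. by case/nullP. Qed.
Lemma null_cyc a : a \in null -> a \in cyc. Proof. by case/nullP. Qed.

Lemma null_ideal c a : even c -> c \in cyc -> a \in null -> ad L c a \in null.
Proof.
move=> ec cc /nullP [ea ca Ha]; apply/nullP; split; [exact: even_even|exact: cyc_cyc|move=> v vc].
rewrite -[ad L _ v](addrK (ad L a (ad L c v))) -jac_even // rpredB //; last by apply/Ha/cyc_cyc.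
by apply: cyc_bnd => //; apply: Ha.
Qed.

Lemma null_ideal' c a : even c -> c \in cyc -> a \in null -> ad L a c \in null.
Proof. by move=> ec cc an; rewrite (anti_even' a ec) rpredN; apply: null_ideal. Qed.

Lemma bnd_null v : v \in bnd -> even v -> v \in null.
Proof.
move=> vb ev; apply/nullP; split=> //; first exact: bnd_cyc.
by move=> c cc; rewrite (anti_even c ev) rpredN; apply: cyc_bnd.
Qed.

Hypothesis char0 : [pchar k] =i pred0.
Hypothesis JD : jordan_closed L.
Variables (e h f : L).
Hypothesis ehf : triple e h f.
Hypothesis ec : e \in cyc.
Hypothesis hc : h \in cyc.
Hypothesis fc : f \in cyc.

Let eh : even h. Proof. by case: ehf. Qed.
Let dh : diagz (ad L h). Proof. exact: (sl2_diag char0 (triple_sl2 ehf)). Qed.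

Let self a : even a -> ad L a a = 0.
Proof. exact: even_self. Qed.

Let toral u := [/\ u \in null, diagz (ad L u) & ad L h u = 0].

(** A toral element whose adjoint has the smallest kernel. By [joint_ker] some [u + n t] has as
    kernel the intersection of the two kernels, and minimality forces the kernel of [u] into that of
    [t]. *)
Lemma max_toral : exists u, toral u /\ forall t, toral t -> ad L u t = 0 ->
  forall v, ad L u v = 0 -> ad L t v = 0.
Proof.
have [u [Tu min]] : exists u, toral u /\ forall t, toral t -> (\dim (lker (ad L u)) <= \dim (lker (ad L t)))%N.
  have T0 : toral 0.
    split; rewrite ?mem0v ?hom0 //; rewrite linear0 => v; apply: (@eigsum_eig _ _ _ _ 0); rewrite ?memvf //.
    by rewrite zero_lfunE scale0r.
  have H : forall n u, toral u -> (\dim (lker (ad L u)) <= n)%N ->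
      exists u, toral u /\ forall t, toral t -> (\dim (lker (ad L u)) <= \dim (lker (ad L t)))%N.
    elim=> [|n IH] u Tu un; first by exists u; split=> // t _; apply: leq_trans un _.
    have [[t [Tt lt]]|ne] := classic (exists t, toral t /\ (\dim (lker (ad L t)) < \dim (lker (ad L u)))%N).
      by apply: (IH t Tt); rewrite -ltnS; apply: leq_trans un.
    exists u; split=> // t Tt; rewrite leqNgt; apply/negP => lt; by apply: ne; exists t.
  exact: (H _ 0 T0 (leqnn _)).
exists u; split=> // t Tt ut v uv.
have [[un du hu] [tn dt ht]] := (Tu, Tt).
have cut : ad L u * ad L t = ad L t * ad L u.
  by apply/eqP; rewrite -subr_eq0 ad_comm ?(null_even un) // ut linear0.
have [m Hm] := joint_ker char0 du dt cut.
have adE2 : ad L (u + m.+1%:R *: t) = ad L u + m.+1%:R *: ad L t by rewrite linearD linearZ.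
have T' : toral (u + m.+1%:R *: t).
  split; first by rewrite rpredD ?rpredZ.
    by rewrite adE2; apply: diag_comb.
  by rewrite !homE hu ht scaler0 addr0.
pose u2 := u + m.+1%:R *: t.
have sub : (lker (ad L (u2)) <= lker (ad L u))%VS.
  by apply/subvP => w; rewrite !memv_ker /u2 adE2 => /eqP /Hm [-> _].
have eq : lker (ad L (u2)) = lker (ad L u).
  by apply/eqP; rewrite eqEdim sub min.
have : v \in lker (ad L (u2)) by rewrite eq memv_ker uv.
by rewrite memv_ker /u2 adE2 => /eqP /Hm [].
Qed.

(** * A Levi triple centralizing a maximal toral element *)

Section Centralizer.
Variable u : L.
Hypothesis Tu : toral u.
Hypothesis umax : forall t, toral t -> ad L u t = 0 -> forall v, ad L u v = 0 -> ad L t v = 0.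

Let un : u \in null. Proof. by case: Tu. Qed.
Let eu : even u := null_even un.
Let uc : u \in cyc := null_cyc un.
Let du : diagz (ad L u). Proof. by case: Tu. Qed.
Let uh : ad L u h = 0.
Proof. by case: Tu => _ _ hu; rewrite (anti_even' _ eh) hu oppr0. Qed.

Let cent := (null :&: lker (ad L u))%VS.

Lemma centP a : (a \in cent) = (a \in null) && (ad L u a == 0).
Proof. by rewrite memv_cap memv_ker. Qed.

Lemma cent_ideal c a : even c -> c \in cyc -> ad L u c = 0 -> a \in cent -> ad L c a \in cent.
Proof.
move=> ec' cc ucc; rewrite !centP => /andP [an /eqP ua]; rewrite null_ideal //=.
by rewrite jac_even // ucc ad0 ua hom0 addr0.
Qed.

(** The semisimple part of [a] is again toral and commutes with [u], so by maximality it kills the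
    kernel of [ad u], where [a] thus acts nilpotently. *)
Lemma toral_part a : a \in cent -> ad L h a = 0 -> exists b (p : {poly k}),
  [/\ p`_0 = 0, ad L b = pact (ad L a) p, forall v, ad L u v = 0 -> ad L b v = 0 & nilp (ad L a - ad L b)].
Proof.
rewrite centP => /andP [an /eqP ua] ha; have ea := null_even an; have ca := null_cyc an.
have [p [b [p0 eb bE db nb]]] := JD ea; exists b, p; split=> // v uv.
have kill c : even c -> ad L c a = 0 -> ad L c b = 0.
  move=> ec' ca'; rewrite (anti_even b ec') bE (pact_kill p0) ?oppr0 //.
  by rewrite (anti_even' a ec') ca' oppr0.
apply: umax uv; last exact: kill.
split=> //; last exact: kill.
apply/nullP; split=> //.
  rewrite cycP (anti_even' x0 eb) bE (pact_kill p0) ?oppr0 //.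
  by rewrite (anti_even x0 ea); move: ca; rewrite cycP => /eqP ->; rewrite oppr0.
move=> c cc; rewrite bE; apply: pact_into => //; first exact: bnd_stab.
by case/nullP: an => _ _; apply.
Qed.

(** Projecting [e] and [f] to the kernel of [ad u] changes them by elements of [null], and on that
    kernel the centralizer of [u] in [null] acts nilpotently. There [lefschetz_flag] corrects [f1]
    until [[e1, f2] = h + t] with [[e1, t] = 0]; this keeps [[c, e1] = 2 e1], and the relation for
    [f] is repaired as in Jacobson-Morozov. *)
Lemma levi_triple : exists eK c fK, [/\ triple eK c fK,
  [/\ eK - e \in null, c - h \in null & fK - f \in null],
  [/\ ad L h eK = 2%:R *: eK, ad L h c = 0 & ad L h fK = - 2%:R *: fK] &
  [/\ ad L u eK = 0, ad L u c = 0 & ad L u fK = 0]].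
Proof.
have [ee _ ef [he e_f hf]] := ehf.
have [P [uP Pid Pc Pnear]] := ker_projector du.
have PP v : P (P v) = P v by apply/Pid/uP.
have Pcomm c : even c -> ad L u c = 0 -> P * ad L c = ad L c * P.
  by move=> ec' ucc; apply: Pc; apply/eqP; rewrite -subr_eq0 ad_comm // ucc linear0.
have ca a : a \in cent -> [/\ a \in null, ad L u a = 0, even a & a \in cyc].
  by rewrite centP => /andP [an /eqP ua]; rewrite (null_even an) (null_cyc an).
(* Operators on the kernel of [ad u], through the projection [P], from [h]-homogeneous elements:
   these are nilpotent by [shift_nilp] in nonzero weight and by [toral_part] in weight zero, and
   they are closed under commutators, as [engel_flag] requires. *)
pose SS (t : 'End(L)) := exists a (r : k), [/\ a \in cent, ad L h a = r *: a & t = ad L a * P].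
have [t [a [r [aC ha ->]]]|t1 t2 [a [r [aC ha ->]]] [b [r' [bC hb ->]]]|K [N [FK KN]]] := @engel_flag _ _ SS.
- have [an ua ea cya] := ca a aC.
  have cP : ad L a * P = P * ad L a by rewrite Pcomm.
  have [r0|r0] := eqVneq r 0; last first.
    apply: nilpM => //; apply: (shift_nilp char0 (h := ad L h) (c := r)) => //.
    by rewrite ad_comm // ha linearZ.
  have [|b [p [p0 bE bk nb]]] := toral_part aC; first by rewrite ha r0 scale0r.
  have -> : ad L a * P = (ad L a - ad L b) * P.
    rewrite mulrBl (_ : ad L b * P = 0) ?subr0 //; apply/lfunP => v.
    by rewrite mulE zero_lfunE; apply/bk/uP.
  apply: nilpM => //; rewrite mulrBl mulrBr cP; congr (_ - _).
  by rewrite bE; apply: pact_comm_with; rewrite cP.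
- have [an ua ea cya] := ca a aC; have [bn ub eb cyb] := ca b bC.
  exists (ad L a b), (r + r'); split.
  + exact: cent_ideal.
  + by rewrite jac_even // ha hb adZ homZ scalerDl.
  have PP' : P * P = P by apply/lfunP => v; rewrite mulE PP.
  rewrite -ad_comm // mulrBl; congr (_ - _).
    by rewrite -mulrA (mulrA P) Pcomm // -!mulrA PP'.
  by rewrite -mulrA (mulrA P) Pcomm // -!mulrA PP'.
pose A i := (K i :&: cent)%VS.
have AP i v : (v \in A i) = (v \in K i) && (v \in cent) by exact: memv_cap.
have Astab X d : even X -> X \in cyc -> ad L u X = 0 -> ad L h X = d *: X -> forall i, stab (ad L X) (A i).
  move=> eX cX uX hX i v; rewrite !AP => /andP [vK vC]; apply/andP; split; last exact: cent_ideal.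
  apply: (flag_stab FK) vK => _ [a [r [aC ha ->]]]; have [an ua ea cya] := ca a aC.
  exists (ad L a X), (r + d); split.
  - by rewrite (anti_even' a eX) rpredN; apply: cent_ideal.
  - by rewrite jac_even // ha hX adZ homZ scalerDl.
  by rewrite -ad_comm // mulrBl -!mulrA; congr (_ - _); rewrite Pcomm.
pose e1 := P e; pose f1 := P f.
have near X : even X -> X \in cyc -> [/\ even (P X), P X - X \in null & P X \in cyc].
  move=> eX cX; have pe : X - P X \in homog L false.
    by apply: Pnear; [move=> v; apply: even_even|apply: even_even].
  have pb : X - P X \in bnd by apply: Pnear; [exact: bnd_stab|case/nullP: un => _ _; apply].
  have e' : P X = X - (X - P X) by rewrite opprB addrC subrK.
  split; first by rewrite e' rpredB.
    by rewrite -opprB rpredN; apply: bnd_null.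
  by rewrite e' rpredB //; apply: bnd_cyc.
have [ee1 en1 ec1] := near e ee ec; have [ef1 fn1 fc1] := near f ef fc.
have hP : P * ad L h = ad L h * P by apply: Pcomm.
have he1 : ad L h e1 = 2%:R *: e1 by rewrite /e1 -mulE -hP mulE he homZ.
have hf1 : ad L h f1 = - 2%:R *: f1 by rewrite /f1 -mulE -hP mulE hf homZ.
have ue1 : ad L u e1 = 0 by apply: uP.
have uf1 : ad L u f1 = 0 by apply: uP.
pose i0 := ad L e1 f1 - h.
have i0C : i0 \in cent.
  rewrite centP; apply/andP; split.
    have -> : i0 = ad L (e1 - e) f1 + ad L e (f1 - f) by rewrite /i0 -e_f !adE; vring.
    by rewrite rpredD //; [apply: null_ideal'|apply: null_ideal].
  by rewrite homD homN jac_even // ue1 ad0 uf1 hom0 uh oppr0 !addr0.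
have hi0 : ad L h i0 = 0.
  by rewrite homD homN jac_even // he1 hf1 !adE self //; vring.
have uE (X : 'End(L)) v : v \in cent -> P v = v by rewrite centP => /andP [_ /eqP /Pid].
have HE1 : ad L h * ad L e1 - ad L e1 * ad L h = 2%:R *: ad L e1 by rewrite ad_comm // he1 linearZ.
have HF1 : ad L h * ad L f1 - ad L f1 * ad L h = - 2%:R *: ad L f1 by rewrite ad_comm // hf1 linearZ.
have stA i : [/\ stab (ad L e1) (A i), stab (ad L h) (A i), stab (ad L f1) (A i) & (A i <= A i.+1)%VS].
  split; [exact: (Astab _ 2%:R)|apply: (Astab _ 0) => //|exact: (Astab _ (- 2%:R))|].
    by rewrite self // scale0r.
  by apply/subvP => v; rewrite !AP => /andP [vK ->]; rewrite (subvP (flag_mono i FK) _ vK).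
have A0 : A 0%N = 0%VS.
  by apply/eqP; rewrite -subv0; apply/subvP => v; rewrite AP => /andP [/(FK.1 v).1 -> _]; rewrite mem0v.
have EFA i v : v \in A i.+1 -> ad L e1 (ad L f1 v) - ad L f1 (ad L e1 v) - ad L h v \in A i.
  rewrite !AP => /andP [/FK.2 vK vC].
  have -> : ad L e1 (ad L f1 v) - ad L f1 (ad L e1 v) - ad L h v = ad L i0 v.
    by rewrite /i0 adD adN -ad_comm // !endE.
  apply/andP; split.
    have := vK (ad L i0 * P); rewrite mulE uE // => -> //.
    by exists i0, 0; rewrite hi0 scale0r.
  have [n0 u0 ev0 cv0] := ca i0 i0C; exact: cent_ideal.
have i0A : i0 \in A N by rewrite AP KN memvf i0C.
have hi0' : ad L h i0 = 0%:R *: i0 by rewrite hi0 scale0r.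
have [w [t [wA hw tA i0E e1t]]] := lefschetz_flag char0 HE1 HF1 dh stA A0 EFA i0A hi0'.
have [wN uw ew cw] : [/\ w \in null, ad L u w = 0, even w & w \in cyc].
  by apply: ca; move: wA; rewrite AP => /andP [].
have tC : t \in cent by move: tA; rewrite AP => /andP [].
have [tN ut et ct] := ca t tC.
rewrite sub0r in hw.
pose f2 := f1 - w; pose c := ad L e1 f2.
have cE : c = h + t.
  by rewrite /c /f2 homD homN -[ad L e1 f1](subrK h) -/i0 i0E; vring.
have ht : ad L h t = 0.
  have -> : t = i0 - ad L e1 w by rewrite i0E addrAC subrr add0r.
  by rewrite homD homN hi0 jac_even // he1 hw !adE; vring.
have ef2 : even f2 by rewrite rpredB.
have cf2 : f2 \in cyc by rewrite rpredB.
have uf2 : ad L u f2 = 0 by rewrite homD homN uf1 uw subr0.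
have hf2 : ad L h f2 = - 2%:R *: f2 by rewrite homD homN hf1 hw; vring.
have ecc : even c by rewrite cE rpredD.
have te1 : ad L t e1 = 0 by rewrite (anti_even' t ee1) ?e1t ?oppr0 // (anti_even e1 et) e1t oppr0.
have ce1 : ad L c e1 = 2%:R *: e1 by rewrite cE adD he1 te1 addr0.
pose m := ad L c f2 + 2%:R *: f2.
have mE : m = ad L t f2 by rewrite /m cE adD hf2; vring.
have mC : m \in cent.
  by rewrite mE (anti_even' t ef2) rpredN; apply: cent_ideal.
have e1m : ad L e1 m = 0.
  rewrite /m homD homZ jac_even // -/c (anti_even c ee1) ce1 self // addr0 adN adZ -/c.
  by vring.
have hm : ad L h m = - 2%:R *: m.
  by rewrite mE jac_even // ht ad0 add0r hf2 homZ.
have hc0 : ad L h c = 0 by rewrite cE homD ht self // addr0.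
pose B := (cent :&: eigenv (ad L h) (- 2%:R))%VS.
have Bh v : v \in B -> v \in cent /\ ad L h v = - 2%:R *: v.
  by rewrite memv_cap eigenvP => /andP [-> /eqP ->].
have sB : stab (ad L c) B.
  move=> v /Bh [vC hv]; rewrite memv_cap eigenvP cent_ideal //=.
  - by rewrite jac_even // hc0 ad0 add0r hv homZ.
  - by rewrite cE rpredD.
  by rewrite cE homD uh ut addr0.
have mB : m \in B by rewrite memv_cap eigenvP hm eqxx mC.
have HEc : ad L c * ad L e1 - ad L e1 * ad L c = 2%:R *: ad L e1 by rewrite ad_comm // ce1 linearZ.
have EFc : ad L e1 * ad L f2 - ad L f2 * ad L e1 = ad L c by rewrite ad_comm.
have [|s' [mS Hs]] := sl2_ker_hge char0 HEc EFc (shift_nilp char0 HEc (natf_neq0 char0 1)) sB mB (i := 0) (w := m) _ e1m.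
  by rewrite expr0 oneE.
(* [ad c + 2] is inverted weight by weight: on the kernel of [ad e1] the weights of [c] are natural
   numbers. *)
pose w' := \sum_(y <- s') (y.1 + 2)%:R^-1 *: y.2.
have n2 y : ((y + 2)%:R : k) != 0 by rewrite addn2; apply: natf_neq0.
have cw' : ad L c w' + 2%:R *: w' = m.
  rewrite mS linear_sum scaler_sumr -big_split big_seq [RHS]big_seq /=; apply: eq_bigr => y /Hs [e' _ _ _] /=.
  rewrite homZ e' scalerA scalerA -scalerDl (_ : _ + _ = 1) ?scale1r //.
  by rewrite [_ * y.1%:R]mulrC -mulrDl -natrD mulfV.
have w'B : w' \in B by rewrite /w' big_seq; apply: rpred_sum => y /Hs [_ _ yB _]; apply: rpredZ.
have e1w' : ad L e1 w' = 0.
  by rewrite linear_sum big_seq; apply: big1 => y /Hs [_ _ _ e'] /=; rewrite homZ e' scaler0.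
have [w'C hw'] := Bh _ w'B; have [w'N uw' ew' cw2] := ca w' w'C.
pose fK := f2 - w'.
exists e1, c, fK; split.
- split=> //; first by rewrite rpredB.
  split=> //; first by rewrite homD homN e1w' subr0.
  rewrite homD homN (_ : ad L c f2 = m - 2%:R *: f2); last by rewrite /m addrK.
  by rewrite -cw'; vring.
- split=> //; first by rewrite cE addrAC subrr add0r.
  have -> : fK - f = (f1 - f) - w - w' by rewrite /fK /f2; vring.
  exact: (rpredB (rpredB fn1 wN) w'N).
- by split=> //; rewrite homD homN hf2 hw'; vring.
split=> //; first by rewrite cE homD uh ut addr0.
by rewrite homD homN uf2 uw' subr0.
Qed.

(** By invariance, images of [ad u], [ad h] and [ad c] are orthogonal to [c], which leaves an
    element [a3] commuting with all three. Its nilpotent part has trace zero against [c]; its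
    semisimple part kills [fK] by maximality of [u], hence is orthogonal to [c = [eK, fK]]. *)
Lemma levi_perp_cartan eK c fK : triple eK c fK -> eK \in cyc -> c \in cyc -> fK \in cyc -> ad L h c = 0 ->
  ad L u eK = 0 -> ad L u c = 0 -> ad L u fK = 0 -> forall a, a \in null -> kappa c a = 0.
Proof.
move=> trK eKc cc fKc hc0 ueK uc0 ufK a an; have [eeK ecc efK [_ efc _]] := trK.
have dc := sl2_diag char0 (triple_sl2 trK).
have cut X w : even X -> ad L X c = 0 -> kappa c (ad L X w) = 0.
  by move=> eX Xc; rewrite -kappa_inv // (anti_even' c eX) Xc oppr0 kappaC kappa0r.
have stn X : even X -> X \in cyc -> stab (ad L X) null by move=> eX cX v; apply: null_ideal.
have [a1 [w1 [a1n w1n ua1 ->]]] := diag_ker_im du (stn u eu uc) an.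
rewrite kappaDr cut // addr0.
have a1C : a1 \in cent by rewrite centP a1n ua1 eqxx.
have sth : stab (ad L h) cent by move=> v; apply: cent_ideal.
have [a2 [w2 [a2C w2C ha2 ->]]] := diag_ker_im dh sth a1C.
rewrite kappaDr cut // addr0.
have stc : stab (ad L c) (cent :&: lker (ad L h))%VS.
  move=> v; rewrite !(memv_cap _ cent) !memv_ker => /andP [vC /eqP hv].
  by rewrite cent_ideal //= jac_even // hc0 ad0 hv hom0 addr0.
have a2B : a2 \in (cent :&: lker (ad L h))%VS by rewrite memv_cap a2C memv_ker ha2 eqxx.
have [a3 [w3 [a3B _ ca3 ->]]] := diag_ker_im dc stc a2B.
rewrite kappaDr cut ?self // addr0.
move: a3B; rewrite (memv_cap _ cent) memv_ker => /andP [a3C /eqP ha3].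
have [b [p [p0 bE bk nb]]] := toral_part a3C ha3.
have ea3 : even a3 by move: a3C; rewrite centP => /andP [/null_even].
have com : ad L a3 * ad L c = ad L c * ad L a3.
  by apply/eqP; rewrite -subr_eq0 ad_comm // (anti_even c ea3) ca3 oppr0 linear0.
have -> : kappa c a3 = kappa c b + tr (ad L c * (ad L a3 - ad L b)).
  by rewrite /kappa mulrBr trD trN addrC subrK.
rewrite [X in _ + X]nilp_tr ?addr0.
  by rewrite -efc kappa_inv // (anti_even b efK) bk // oppr0 kappa0r.
have cb : ad L c * (ad L a3 - ad L b) = (ad L a3 - ad L b) * ad L c.
  by rewrite mulrBl mulrBr com; congr (_ - _); rewrite bE (pact_comm_with p com).
by rewrite cb; apply: nilpM.
Qed.

End Centralizer.

(** Orthogonality for [eK] and [fK] follows from that for [c]: both are nonzero multiples of their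
    brackets with [c], and [null] is an ideal. *)
Lemma levi_exists : exists eK c fK, [/\ triple eK c fK,
  [/\ eK - e \in null, c - h \in null & fK - f \in null],
  [/\ ad L h eK = 2%:R *: eK, ad L h c = 0 & ad L h fK = - 2%:R *: fK] &
  forall a, a \in null -> [/\ kappa eK a = 0, kappa c a = 0 & kappa fK a = 0]].
Proof.
have [u [Tu umax]] := max_toral.
have [eK [c [fK [trK [en cn fn] [heK hc0 hfK] [ueK uc ufK]]]]] := levi_triple Tu umax.
have eKc : eK \in cyc by rewrite -[eK](subrK e) rpredD // null_cyc.
have cc : c \in cyc by rewrite -[c](subrK h) rpredD // null_cyc.
have fKc : fK \in cyc by rewrite -[fK](subrK f) rpredD // null_cyc.
exists eK, c, fK; split=> // a an.
have perp := levi_perp_cartan Tu umax trK eKc cc fKc hc0 ueK uc ufK.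
have [eeK ecc efK [ce _ cf]] := trK.
have root X d : even X -> X \in cyc -> d != 0 -> ad L c X = d *: X -> kappa X a = 0.
  move=> eX cX d0 cXE; apply/eqP; have : d * kappa X a == 0.
    by rewrite kappaC -kappaZr -cXE kappaC kappa_inv // perp //; apply: null_ideal.
  by rewrite mulf_eq0 (negPf d0).
have d0 := natf_neq0 char0 1.
split; [exact: (root eK 2%:R)|exact: perp|apply: (root fK (- 2%:R)) => //].
by rewrite oppr_eq0.
Qed.

End Homology.

(** * The radical of the trace form and a nilpotent ideal *)

Section Radical.
Variables (k : closedFieldType) (L : lieSuperalgebra k).
Hypothesis char0 : [pchar k] =i pred0.
Local Notation even u := (u \in homog L false).
Local Notation odd u := (u \in homog L true).
Variables (x0 : L).
Hypothesis ox0 : odd x0.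
Hypothesis DD : forall v, ad L x0 (ad L x0 v) = 0.
Implicit Types (p r a : L).
Local Notation cyc := (cyc x0).
Local Notation bnd := (bnd x0).
Local Notation null := (null x0).

Definition null_rad_pred r := r \in null /\ forall b, b \in null -> kappa r b = 0.

Lemma null_rad_exists : exists U : {vspace L}, forall r, r \in U <-> null_rad_pred r.
Proof.
apply: vspace_of_pred => [|d a b [an Ha] [bn Hb]].
  by split=> [|b _]; rewrite ?mem0v // kappaC kappa0r.
split=> [|c cn]; first by rewrite rpredD ?rpredZ.
by rewrite kappaC kappaDr kappaZr !(kappaC c) Ha // Hb // mulr0 addr0.
Qed.

(** Besides [null] itself this contains, by the orthogonality in [levi_exists], the Levi triple;
    hence both normalize the ideal spanned by brackets with the radical. *)
Definition norm_pred p := [/\ even p, p \in cyc & forall r, null_rad_pred r -> kappa p r = 0].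

(** The analogue of the ideal [[g, rad g]], which acts nilpotently. *)
Definition nilrad_pred v := exists s : seq (L * L),
  (forall t, t \in s -> norm_pred t.1 /\ null_rad_pred t.2) /\ v = \sum_(t <- s) ad L t.1 t.2.

Lemma rad_ideal c r : even c -> c \in cyc -> null_rad_pred r -> null_rad_pred (ad L c r).
Proof.
move=> ec cc [rn Hr]; split; first exact: null_ideal.
have er := null_even rn; move=> b bn.
rewrite (anti_even' c er) kappaC -scaleN1r kappaZr kappaC kappa_inv // Hr ?mulr0 //.
exact: null_ideal.
Qed.

Lemma norm_bracket p q : norm_pred p -> norm_pred q -> norm_pred (ad L p q).
Proof.
move=> [ep cp Hp] [eq cq Hq]; split; [exact: even_even|exact: cyc_cyc|move=> r Rr].
by rewrite kappa_inv // Hp //; apply: rad_ideal.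
Qed.

Lemma nilrad_exists : exists U : {vspace L}, forall v, v \in U <-> nilrad_pred v.
Proof.
apply: vspace_of_pred => [|d a b [s [Hs ->]] [t [Ht ->]]].
  by exists [::]; rewrite big_nil.
exists ([seq (d *: y.1, y.2) | y <- s] ++ t); split=> [y|].
  rewrite mem_cat => /orP [/mapP [z /Hs [[e1 c1 H1] H2] ->]|/Ht //]; split=> //=.
  split; rewrite ?rpredZ // => r Rr.
  by rewrite kappaC kappaZr kappaC H1 // mulr0.
rewrite big_cat big_map /=; congr (_ + _); rewrite scaler_sumr; apply: eq_bigr => y _.
by rewrite adZ.
Qed.

Lemma nilrad_rad v : nilrad_pred v -> null_rad_pred v.
Proof.
have [R RP] := null_rad_exists.
move=> [s [Hs ->]]; apply/RP; rewrite big_seq; apply: rpred_sum => t /Hs [[e1 c1 _] H2].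
by apply/RP/rad_ideal.
Qed.

Lemma nilrad_ideal p v : norm_pred p -> nilrad_pred v -> nilrad_pred (ad L p v).
Proof.
have [U UP] := nilrad_exists.
move=> Np [s [Hs ->]]; rewrite linear_sum; apply/UP; rewrite big_seq; apply: rpred_sum => t /Hs [N1 R2] /=.
have [ep cp _] := Np; rewrite jac_even //; apply: rpredD; apply/UP.
  exists [:: (ad L p t.1, t.2)]; split; last by rewrite big_seq1.
  by move=> y; rewrite inE => /eqP -> /=; split=> //; apply: norm_bracket.
exists [:: (t.1, ad L p t.2)]; split; last by rewrite big_seq1.
by move=> y; rewrite inE => /eqP -> /=; split=> //; apply: rad_ideal.
Qed.

(** Cartan's criterion. For a replica [S] of [ad a], itself a derivation, the trace of [ad [p, r]]
    times [S] equals [- kappa p (S r)], which is zero because [S r] stays in the radical. *)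
Lemma nilrad_nilp a : nilrad_pred a -> nilp (ad L a).
Proof.
move=> Na; have [an Ha] := nilrad_rad Na; have ea := null_even an; have ca := null_cyc an.
have [R RP] := null_rad_exists.
apply: (cartan_nilp char0) => t p p0 Hp Ht.
have der := replica_derivation ea Hp Ht; set S := pact (ad L a) p in der *.
have [s [Hs aE]] := Na; rewrite {1}aE linear_sum mulr_suml tr_sum big_seq; apply: big1 => y ys.
have [[e1 c1 H1] R2] := Hs y ys; have [n2 _] := R2; have e2 := null_even n2 => /=.
have stR : stab (ad L a) R by move=> v /RP Rv; apply/RP/rad_ideal.
have SR : null_rad_pred (S y.2) by apply/RP/pact_stab => //; apply/RP.
have com : S * ad L y.2 - ad L y.2 * S = ad L (S y.2).
  by apply/lfunP => v; rewrite !endE der addrK.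
rewrite -ad_comm // mulrBl trD trN -!mulrA (trM (ad L y.2)) -mulrA -trN -trD -mulrN -mulrDr.
have -> : ad L y.2 * S - S * ad L y.2 = - ad L (S y.2) by rewrite -com opprB.
by rewrite mulrN trN -/(kappa _ _) H1 ?oppr0.
Qed.

(* A nilpotent ideal that absorbs the part of [null] moved twice by [K]. *)
Lemma nilrad_data eK c fK : triple eK c fK -> eK \in cyc -> c \in cyc -> fK \in cyc ->
  (forall a, a \in null -> [/\ kappa eK a = 0, kappa c a = 0 & kappa fK a = 0]) ->
  exists nn : {vspace L}, [/\ (nn <= null)%VS,
   forall n, n \in nn -> even n /\ nilp (ad L n),
   forall p n, p \in null -> n \in nn -> ad L p n \in nn,
   forall p n, p \in [:: eK; c; fK] -> n \in nn -> ad L p n \in nn &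
   forall p q a, p \in [:: eK; c; fK] -> q \in [:: eK; c; fK] -> a \in null -> ad L p (ad L q a) \in nn].
Proof.
move=> [eeK ec' efK _] cK cc cf Hperp; have [nn nnP] := nilrad_exists; exists nn.
have Kp p : p \in [:: eK; c; fK] -> [/\ even p, p \in cyc & forall a, a \in null -> kappa p a = 0].
  by rewrite !inE => /or3P [] /eqP ->; split=> // a /Hperp [].
have NK p : p \in [:: eK; c; fK] -> norm_pred p.
  by move=> /Kp [ep cp Hp]; split=> // r [rn _]; apply: Hp.
have Nn p : p \in null -> norm_pred p.
  move=> pn; split; [exact: null_even pn|exact: null_cyc pn|move=> r [rn Hr]].
  by rewrite kappaC Hr.
split.
- by apply/subvP => v /nnP /nilrad_rad [].
- by move=> n /nnP Nn'; split; [have [/null_even] := nilrad_rad Nn'|exact: nilrad_nilp].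
- by move=> p n pn /nnP Hn; apply/nnP/nilrad_ideal => //; apply: Nn.
- by move=> p n pn /nnP Hn; apply/nnP/nilrad_ideal => //; apply: NK.
move=> p q a pK qK an; apply/nnP; exists [:: (p, ad L q a)]; split; last by rewrite big_seq1.
move=> t; rewrite inE => /eqP -> /=; split; first exact: NK.
have [eq cq Hq] := Kp q qK; have ea := null_even an.
split; first exact: null_ideal.
move=> b bn; rewrite kappa_inv // Hq //; apply: null_ideal => //; exact: null_cyc.
Qed.

End Radical.

(** * Gauge fixing relative to osp(1|2) *)

Lemma odd_cube (k : closedFieldType) (L : lieSuperalgebra k) (x : L) : [pchar k] =i pred0 ->
  x \in homog L true -> ad L (ad L x x) x = 0.
Proof.
move=> char0 ox; have := anti_even x (odd_odd ox ox); have := jac_odd x ox ox.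
move: (ad L (ad L x x) x) (ad L x (ad L x x)) => a b -> /eqP; rewrite -addr_eq0 => /eqP e.
have three0 : (3%:R : k) != 0 := natf_neq0 char0 2.
have b0 : b = 0 by apply: (scalerI three0); rewrite scaler0 scaler_nat mulrS mulr2n addrA e.
by rewrite b0 addr0.
Qed.

Section Gauge.
Variables (k : closedFieldType) (L : lieSuperalgebra k).
Hypothesis char0 : [pchar k] =i pred0.
Local Notation even u := (u \in homog L false).
Local Notation odd u := (u \in homog L true).
Variables (s x0 eK c fK e' kk fJ z : L).
Hypothesis s0 : forall v, ad L s v = 0.
Hypothesis es : even s.
Hypothesis ox0 : odd x0.
Hypothesis x00 : ad L x0 x0 = 2%:R *: s.
Implicit Types (u v w a b r x : L).
Local Notation cyc := (cyc x0).
Local Notation bnd := (bnd x0).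
Local Notation null := (null x0).
Local Notation D := (ad L x0).

Let two0 : (2%:R : k) != 0 := natf_neq0 char0 1.

Lemma DD v : D (D v) = 0.
Proof.
have := jac_odd v ox0 ox0; rewrite x00 adZ s0 scaler0 -mulr2n -scaler_nat => /esym/eqP.
by rewrite scaler_eq0 (negPf two0) => /eqP.
Qed.

Hypothesis trK : triple eK c fK.
Hypothesis trJ : triple e' kk fJ.
Hypothesis Kc : [/\ eK \in cyc, c \in cyc & fK \in cyc].
Hypothesis Jn : [/\ e' \in null, kk \in null & fJ \in null].
Hypothesis JK : forall p q, p \in [:: e'; kk; fJ] -> q \in [:: eK; c; fK] -> ad L p q = 0.
Hypothesis oz : odd z.
Hypothesis zc : z \in cyc.
Hypothesis zz : ad L z z = 2%:R *: eK.
Hypothesis cz : ad L c z = z.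
Hypothesis Jz : forall p, p \in [:: e'; kk; fJ] -> ad L p z = 0.

Let e'm : e' \in [:: e'; kk; fJ]. Proof. by rewrite !inE eqxx. Qed.
Let kkm : kk \in [:: e'; kk; fJ]. Proof. by rewrite !inE eqxx !orbT. Qed.
Let fKm : fK \in [:: eK; c; fK]. Proof. by rewrite !inE eqxx !orbT. Qed.

Let e := eK + e'.
Let h := c + kk.
Let f := fK + fJ.

Let JKx p q : p \in [:: e'; kk; fJ] -> q \in [:: eK; c; fK] -> ad L q p = 0.
Proof.
move=> pJ qK; have [[_ ecc _ _] [ee ek ef _]] := (trK, trJ).
have ep : even p by move: pJ; rewrite !inE => /or3P [] /eqP ->.
by rewrite (anti_even' q ep) JK // oppr0.
Qed.

Lemma sum_triple : triple e h f.
Proof.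
have [[eeK ec efK [H1 H2 H3]] [ee ek ef [H4 H5 H6]]] := (trK, trJ).
have [a1 a2 a3] : [/\ e' \in [:: e'; kk; fJ], kk \in [:: e'; kk; fJ] & fJ \in [:: e'; kk; fJ]].
  by rewrite !inE !eqxx !orbT.
have [b1 b2 b3] : [/\ eK \in [:: eK; c; fK], c \in [:: eK; c; fK] & fK \in [:: eK; c; fK]].
  by rewrite !inE !eqxx !orbT.
have J1 := (JK a1 b1, JK a1 b2, JK a1 b3, JK a2 b1, JK a2 b2, JK a2 b3, JK a3 b1, JK a3 b2, JK a3 b3).
have J2 := (JKx a1 b1, JKx a1 b2, JKx a1 b3, JKx a2 b1, JKx a2 b2, JKx a2 b3, JKx a3 b1, JKx a3 b2, JKx a3 b3).
split; try by rewrite rpredD.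
by split; rewrite /e /h /f !adE !(J1, J2, H1, H2, H3, H4, H5, H6); vring.
Qed.

Let eh : even h. Proof. by case: sum_triple. Qed.
Let ee : even e. Proof. by case: sum_triple. Qed.
Let ec : e \in cyc. Proof. by case: Kc => a _ _; case: Jn => b _ _; rewrite rpredD // null_cyc. Qed.
Let hc : h \in cyc. Proof. by case: Kc => _ a _; case: Jn => _ b _; rewrite rpredD // null_cyc. Qed.
Let fc : f \in cyc. Proof. by case: Kc => _ _ a; case: Jn => _ _ b; rewrite rpredD // null_cyc. Qed.
Let S := triple_sl2 sum_triple.
Let dh : diagz (ad L h) := sl2_diag char0 S.

Let y := ad L fK z.
Let oy : odd y. Proof. by apply: even_odd => //; case: trK. Qed.

Let eKz : ad L eK z = 0.
Proof.
have := odd_cube char0 oz; rewrite zz adZ => /eqP.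
by rewrite scaler_eq0 (negPf two0) => /eqP.
Qed.

Let eKy : ad L eK y = z.
Proof. by have [eeK _ _ [_ H _]] := trK; rewrite /y jac_even // H cz eKz hom0 addr0. Qed.

Let cy : ad L c y = - y.
Proof. by have [_ ecc _ [_ _ H]] := trK; rewrite /y jac_even // H cz adZ; vring. Qed.

Let zy : ad L z y = - c.
Proof.
have [eeK _ efK [_ H _]] := trK; have := jac_even z z efK.
rewrite zz homZ (anti_even eK efK) H -/y (sym_odd oy oz) => e1.
apply: (scalerI two0); rewrite (_ : _ *: ad L z y = ad L z y + ad L z y); last by vring.
by rewrite -e1.
Qed.

Let Jy p : p \in [:: e'; kk; fJ] -> ad L p y = 0.
Proof.
move=> pJ; have [ee' ek ef _] := trJ.
have ep : even p by move: pJ; rewrite !inE => /or3P [] /eqP ->.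
by rewrite /y jac_even // (JK pJ fKm) (Jz pJ) ad0 hom0 addr0.
Qed.

Let yc : y \in cyc. Proof. by case: Kc => _ _ a; exact: (cyc_cyc ox0 a zc). Qed.

Let hz : ad L h z = z.
Proof. by rewrite /h adD cz (Jz kkm) addr0. Qed.
Let hy : ad L h y = - y.
Proof. by rewrite /h adD cy (Jy kkm) addr0. Qed.
Let ez : ad L e z = 0.
Proof. by rewrite /e adD eKz (Jz e'm) addr0. Qed.
Let ey : ad L e y = z.
Proof. by rewrite /e adD eKy (Jy e'm) addr0. Qed.
Let kill_x0 a : even a -> a \in cyc -> ad L a x0 = 0.
Proof. by move=> ea; rewrite cycP (anti_even x0 ea) => /eqP ->; rewrite oppr0. Qed.
Let hx0 : ad L h x0 = 0 := kill_x0 eh hc.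
Let ex0 : ad L e x0 = 0 := kill_x0 ee ec.

Let Z := ad L z.
Let Y := - ad L y.
Let G := ghost Z Y.

Let ZY : Z * Y + Y * Z = ad L c.
Proof.
apply/lfunP => v; rewrite !endE homN -opprD -jac_odd //.
by rewrite zy adN opprK.
Qed.
Let ecc : even c. Proof. by case: trK. Qed.
Let CZ : ad L c * Z - Z * ad L c = Z. Proof. by rewrite /Z ad_comm // cz. Qed.
Let CY : ad L c * Y - Y * ad L c = - Y.
Proof. by rewrite /Y mulrN mulNr !opprK addrC -opprB ad_comm // cy linearN opprK. Qed.

Let Gker v : G v = 0 -> ad L z v = 0 /\ ad L y v = 0.
Proof.
move=> /(ghost_ker char0 ZY CZ CY) [-> /eqP]; by rewrite oppE oppr_eq0 => /eqP ->.
Qed.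

Let Ginv v : ad L z v = 0 -> ad L y v = 0 -> G v = 0.
Proof. by move=> zv yv; rewrite /G /ghost /Y /Z !endE zv yv !(oppr0, hom0, addr0). Qed.

Let HZ v : ad L h (Z v) = Z (ad L h v) + Z v.
Proof. by rewrite /Z jac_even // hz addrC. Qed.
Let HY v : ad L h (Y v) = Y (ad L h v) - Y v.
Proof. by rewrite !oppE homN jac_even // hy adN; vring. Qed.
Let HG v : ad L h (G v) = G (ad L h v).
Proof.
rewrite /G /ghost addE oppE !mulE homD homN HZ HY HY HZ [in RHS]addE oppE !mulE !homE.
by vring.
Qed.
Let EG v : ad L e (G v) = G (ad L e v).
Proof.
have eKG w : ad L eK (G w) = G (ad L eK w).
  apply: (scalerI two0); rewrite -adZ -homZ -[in RHS]adZ -zz !jac_odd // -/Z.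
  have gz v' : Z (G v') = - Z v' - G (Z v') := ghostZ ZY CZ v'.
  by rewrite !(gz, homD, homN); vring.
rewrite /e !adD homD eKG; congr (_ + _); have [ee' _ _ _] := trJ.
apply: ghost_comm_even => w; first by rewrite /Z jac_even // (Jz e'm) ad0 add0r.
by rewrite !oppE homN jac_even // (Jy e'm) ad0 add0r.
Qed.
Let DG v : D (G v) = G (D v).
Proof.
apply: ghost_comm_odd => w; first by rewrite /Z (D_odd ox0) // opprK.
by rewrite !oppE homN (D_odd ox0) // opprK.
Qed.
Let Gp p v : v \in homog L p -> G v \in homog L p.
Proof.
move=> vp; rewrite /G /ghost addE oppE !mulE !oppE homN rpredB // ?rpredN.
  by have := ad_homog oz (ad_homog oy vp); rewrite !addTb negbK.
by have := ad_homog oy (ad_homog oz vp); rewrite !addTb negbK.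
Qed.

Lemma hge_ad i j u v : hge (ad L h) i u -> hge (ad L h) j v -> hge (ad L h) (i + j) (ad L u v).
Proof.
move=> [t [-> Ht]] hv; rewrite linear_sum sum_lfunE; apply: hge_sum => p /Ht [e1 le] /=.
have [w [-> Hw]] := hv; rewrite linear_sum; apply: hge_sum => q /Hw [e2 le2] /=.
apply: (@hge_eig _ _ _ _ (p.1 + q.1)); last exact: leq_add.
by rewrite jac_even // e1 e2 adZ homZ natrD scalerDl.
Qed.

Lemma hge_comm (g : 'End(L)) i v : (forall w, ad L h (g w) = g (ad L h w)) ->
  hge (ad L h) i v -> hge (ad L h) i (g v).
Proof.
move=> Hg [t [-> Ht]]; rewrite linear_sum; apply: hge_sum => p /Ht [e1 le] /=.
by apply: (hge_eig _ le); rewrite Hg e1 homZ.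
Qed.

(** The invariant of the recursion on [i]: [b] is the osp(1|2)-invariant part found so far, and [r]
    the error, of weight at least [i]. *)
Definition gauged i x b r := [/\ odd x /\ ad L x x = 2%:R *: (s + e),
  [/\ odd b, hge (ad L h) 2 b, ad L z b = 0, ad L y b = 0 & ad L e b = 0],
  x = x0 + z + b + r & hge (ad L h) i r].

(** An exponential of positive weight commuting with [e] fixes [s + e], so it preserves the equation
    for the square of [x]. *)
Lemma gauge_apply j Yv x : even Yv -> ad L h Yv = j.+1%:R *: Yv -> ad L e Yv = 0 ->
  odd x -> ad L x x = 2%:R *: (s + e) ->
  exists x2, [/\ odd x2 /\ ad L x2 x2 = 2%:R *: (s + e), splits s x2 -> splits s x &
    forall m, hge (ad L h) m (ad L Yv (ad L Yv x)) -> hge (ad L h) m (x2 - (x + ad L Yv x))].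
Proof.
move=> eY hY eYv ox xx.
have [M nM] : nilp (ad L Yv).
  by apply: (shift_nilp char0 (h := ad L h) (c := j.+1%:R)); rewrite ?natf_neq0 // ad_comm // hY linearZ.
have nM2 : ad L Yv ^+ M.+2 = 0 by rewrite -addn2 exprD nM mul0r.
have in1 := inner_exp (P := fun n => n = Yv) char0 eY nM2 (erefl _) (ltn0Sn _).
set phi := expN _ _ in in1; set psi := expN _ _ in in1.
have [[p1 h1] hpsi _ e2 _] := in1.
have [fs gs] : phi s = s /\ psi s = s.
  by apply: (inner_fix in1) => _ ->; rewrite (anti_even' _ es) s0 oppr0.
have [fe _] : phi e = e /\ psi e = e.
  by apply: (inner_fix in1) => _ ->; rewrite (anti_even' _ ee) eYv oppr0.
exists (phi x); split.
- by split; [exact: p1|rewrite -h1 xx homZ homD fs fe].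
- by move=> /(splits_hom hpsi); rewrite gs -mulE e2 oneE.
move=> m hm; have [A AP] : exists A : {vspace L}, forall v, v \in A <-> hge (ad L h) m v.
  apply: vspace_of_pred => [|d u v hu hv]; first exact: hge0.
  by apply: hgeD => //; apply: hgeZ.
apply/AP; apply: expN_near2 => //; first exact/AP.
move=> v /AP hv; apply/AP; apply: (@hge_le _ _ _ _ (0 + m)) => //.
apply: hge_ad hv; exact: hge_eig hY _.
Qed.

(** The boundary [t] is [D v] with [v] even of weight [i]. As [[e, v]] is a cycle, Lefschetz on the
    even cycles changes [v] by a cycle into an element commuting with [e], whose exponential cancels
    [t] to first order. The invariant part [r'] joins [b]; it must vanish for [i = 1] because [b]
    starts in weight two. *)
Lemma gauge_exact i x b r r' t r2 : (0 < i)%N -> gauged i x b r -> r = r' + t + r2 ->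
  [/\ odd r', ad L h r' = i%:R *: r', ad L z r' = 0, ad L y r' = 0 & ad L e r' = 0] -> (i = 1%N -> r' = 0) ->
  [/\ odd t, ad L h t = i%:R *: t, t \in bnd & ad L e t = 0] -> hge (ad L h) i.+1 r2 ->
  exists x2 b2 r3, gauged i.+1 x2 b2 r3 /\ (splits s x2 -> splits s x).
Proof.
move=> i0 [[ox xx] [ob hb zb yb eb] xE hr] rE [or' hr' zr yr er] r10 [ot ht /bndP [v0 tE] et] hr2.
have [v1 [v2 [e1 o2 v0E]]] := parity_split v0.
have D2 : D v2 = 0.
  apply: parity0; first exact: odd_odd.
  have -> : D v2 = t - D v1 by rewrite tE v0E homD addrAC subrr add0r.
  by rewrite rpredB //; apply: odd_even.
have D1 : D v1 = t by rewrite tE v0E homD D2 addr0.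
have HD w : ad L h (D w) = D (ad L h w) + 0 *: D w by rewrite jac_even // hx0 ad0 add0r scale0r addr0.
have shE : stab (ad L h) (homog L false) by move=> w; apply: even_even.
have [|v [ev Dv hv]] := eig_preimage (c := i%:R) dh shE HD e1; first by rewrite D1.
rewrite subr0 in hv; rewrite D1 in Dv.
pose A := (homog L false :&: cyc)%VS.
have AP w : (w \in A) = (even w) && (w \in cyc) by exact: memv_cap.
have sA X : even X -> X \in cyc -> stab (ad L X) A.
  move=> eX cX w; rewrite !AP => /andP [ew cw]; rewrite even_even //=; exact: (cyc_cyc ox0).
have evA : ad L e v \in A.
  by rewrite AP even_even //= cycP -D_even // Dv et.
have hev : ad L h (ad L e v) = i.+2%:R *: ad L e v.
  by rewrite (sl2_HEv _ S) hv homZ -scalerDl -natrD addn2.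
have ef : even f by case: sum_triple.
have [w [wA hw ew]] := lefschetz_surj char0 S (sA e ee ec) (sA h eh hc) (sA f ef fc) evA hev.
move: wA; rewrite AP cycP => /andP [evw /eqP Dw].
pose Yv := v - w.
have eY : even Yv by rewrite rpredB.
have hY : ad L h Yv = i%:R *: Yv.
  by rewrite homD homN hv hw -(addn2 i) natrD; vring.
have eYv : ad L e Yv = 0 by rewrite homD homN ew subrr.
have DY : D Yv = t by rewrite homD homN Dv Dw subr0.
case: i i0 hr hr' r10 ht hr2 hv hev hw hY => // j _ hr hr' r10 ht hr2 hv hev hw hY.
have [x2 [ox2 sp near]] := gauge_apply eY hY eYv ox xx.
have gY := hge_eig hY (leqnn _).
have hgz : hge (ad L h) 1 z by apply: (@hge_eig _ _ _ _ 1); rewrite ?hz ?scale1r.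
have hrest : hge (ad L h) 1 (z + b + r).
  by apply: hgeD; [apply: hgeD => //; apply: hge_le hb|apply: hge_le hr].
have YxE : ad L Yv x = - t + ad L Yv (z + b + r).
  by rewrite xE -!addrA homD (anti_even x0 eY) DY.
have hYrest : hge (ad L h) j.+2 (ad L Yv (z + b + r)).
  by have := hge_ad gY hrest; rewrite addn1.
have hYx : hge (ad L h) j.+1 (ad L Yv x).
  rewrite YxE; apply: hgeD; last exact: hge_le hYrest.
  by apply: hgeN; apply: hge_eig ht _.
have hYY : hge (ad L h) j.+2 (ad L Yv (ad L Yv x)).
  by apply: hge_le (hge_ad gY hYx); rewrite addnS ltnS leq_addr.
exists x2, (b + r'), (r2 + ad L Yv (z + b + r) + (x2 - (x + ad L Yv x))); split=> //; split=> //.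
- split; rewrite ?rpredD // ?homD ?zb ?yb ?eb ?zr ?yr ?er ?addr0 //.
  apply: hgeD => //; case: (j) hr' r10 => [|j'] hr' r10; first by rewrite r10 //; apply: hge0.
  exact: hge_eig hr' _.
- by rewrite YxE {1}xE rE; vring.
by apply: hgeD; [exact: hgeD|exact: near].
Qed.

Let hgz : hge (ad L h) 1 z.
Proof. by apply: (@hge_eig _ _ _ _ 1); rewrite ?hz ?scale1r. Qed.

Let gauged_kill i x b r : gauged i x b r -> odd r /\ ad L e r = 0.
Proof.
move=> [[ox xx] [ob hb zb yb eb] xE hr].
have rE : r = x - x0 - z - b by rewrite xE; vring.
split; first by rewrite rE !rpredB.
have ex : ad L e x = 0.
  have := odd_cube char0 ox; rewrite xx adZ adD s0 add0r => /eqP.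
  by rewrite scaler_eq0 (negPf two0) => /eqP.
by rewrite rE !homD !homN ex ex0 ez eb !oppr0 !addr0.
Qed.

Lemma gauged_square i x b r : gauged i x b r ->
  2%:R *: (D r + ad L z r) + (2%:R *: ad L b r + ad L r r) = 2%:R *: (e' - D b) - ad L b b.
Proof.
move=> gx; have [or er] := gauged_kill gx; have [[ox xx] [ob hb zb yb eb] xE hr] := gx.
have Dz : D z = 0 by apply/eqP; rewrite -cycP.
move: xx; rewrite {1 2}xE !adE x00 zz Dz (sym_odd oz ox0) Dz (sym_odd ob ox0) (sym_odd ob oz) zb.
rewrite (sym_odd or ox0) (sym_odd or oz) (sym_odd or ob) /e => xx.
apply/eqP; rewrite -subr_eq0; apply/eqP.
transitivity (2%:R *: s + 0 + D b + D r + (0 + 2%:R *: eK + 0 + ad L z r) + (D b + 0 + ad L b b + ad L b r) +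
   (D r + ad L z r + ad L b r + ad L r r) - 2%:R *: (s + (eK + e'))); first by vring.
by rewrite -xx; vring.
Qed.

(** The leading component is [r' + rho] with [r'] invariant and [rho] in the image of the Scasimir
    operator. The equation for the square makes [rho] a cycle with [[z, rho]] a boundary; then [rho]
    is, up to a boundary, the bracket of [z] with an even cycle of weight [i - 1], and an
    exponential removes it. *)
Lemma gauge_step i x b r : (1 < i)%N -> gauged i x b r ->
  exists x2 b2 r2, gauged i.+1 x2 b2 r2 /\ (splits s x2 -> splits s x).
Proof.
move=> i1 gx; have [or er] := gauged_kill gx; have sq := gauged_square gx.
have [[ox xx] [ob hb zb yb eb] xE hr] := gx.
pose A0 := (homog L true :&: lker (ad L e))%VS.
have A0P w : (w \in A0) = odd w && (ad L e w == 0) by rewrite memv_cap memv_ker.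
have shA : stab (ad L h) A0.
  move=> w; rewrite !A0P => /andP [ow /eqP ew]; rewrite even_odd //=.
  by have := sl2_HEv w S; rewrite ew !hom0 scaler0 addr0 => <-.
have rA : r \in A0 by rewrite A0P or er eqxx.
have [ri [rp [[riA rpA] hri hrp rE]]] := hge_splitA char0 hr shA rA.
have [rj [rq [[rjA rqA] hrj hrq rpE]]] := hge_splitA char0 hrp shA rpA.
pose A := (A0 :&: eigenv (ad L h) i%:R)%VS.
have AP w : (w \in A) = (w \in A0) && (ad L h w == i%:R *: w) by rewrite memv_cap eigenvP.
have sG : stab G A.
  move=> w; rewrite !AP !A0P => /andP [/andP [ow /eqP ew] /eqP hw].
  by rewrite Gp //= EG ew hom0 eqxx HG hw homZ eqxx.
have riA' : ri \in A by rewrite AP riA hri eqxx.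
have [r' [w [r'A wA Gr' riE]]] := ker_im_split (ghost_ker2 char0 ZY CZ CY) sG riA'.
have [zr yr] := Gker Gr'; pose rho := G w.
have rhoA : rho \in A by apply: sG.
move: r'A rhoA; rewrite !AP !A0P => /andP [/andP [or' /eqP er'] /eqP hr'] /andP [/andP [orho /eqP erho] /eqP hrho].
have HD v : ad L h (D v) = D (ad L h v) by rewrite jac_even // hx0 ad0 add0r.
(* Applying [G] to the equation kills the invariants and separates the weights. *)
have Geq : 2%:R *: D (G ri) + (2%:R *: G (D rj + Z ri) +
    G (2%:R *: (D rq + Z (rj + rq)) + (2%:R *: ad L b r + ad L r r))) = 0.
  have e1 : G (2%:R *: (D r + ad L z r) + (2%:R *: ad L b r + ad L r r)) = 0.
    have Ge' : G e' = 0.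
      have ee' : even e' by case: trJ.
      by apply: Ginv; rewrite (anti_even' _ ee') ?(Jz e'm) ?(Jy e'm) oppr0.
    have Gb : G b = 0 by apply: Ginv.
    have Gbb : G (ad L b b) = 0.
      apply: Ginv.
        by have /eqP := jac_odd b oz ob; rewrite zb ad0 hom0 addr0 eq_sym => /eqP.
      by have /eqP := jac_odd b oy ob; rewrite yb ad0 hom0 addr0 eq_sym => /eqP.
    by rewrite sq !(homD, homN, homZ) Ge' -DG Gb Gbb !(hom0, oppr0, addr0, scaler0).
  rewrite -[RHS]e1 rE rpE DG -/Z !(homD, homZ); move: (ad L b _) => ?.
  by vring.
have ghr : hge (ad L h) i.+2 (G (2%:R *: (D rq + Z (rj + rq)) + (2%:R *: ad L b r + ad L r r))).
  apply: hge_comm => //; apply: hgeD; last apply: hgeD.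
  - apply: hgeZ; apply: hgeD; first exact: hge_comm.
    rewrite -[i.+2]/(1 + i.+1)%N; apply: hge_ad => //; apply: hgeD; first exact: hge_eig hrj _.
    exact: hge_le hrq.
  - apply: hgeZ; exact: (hge_ad hb hr).
  by apply: hge_le (hge_ad hr hr); rewrite -addn2 leq_add2l.
have hGD : ad L h (2%:R *: D (G ri)) = i%:R *: (2%:R *: D (G ri)).
  by rewrite homZ HD HG hri !homZ; vring.
have hGZ : ad L h (2%:R *: G (D rj + Z ri)) = i.+1%:R *: (2%:R *: G (D rj + Z ri)).
  rewrite homZ HG homD HD HZ hrj hri !(homZ, homD) -(addn1 i) natrD; vring.
have DGri : D (G ri) = 0.
  apply: (scalerI two0); rewrite scaler0; apply: (hge_eig0 char0 (j := i.+1) _ hGD) => //.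
  move/eqP: Geq; rewrite addr_eq0 => /eqP ->; apply: hgeN; apply: hgeD; first exact: hge_eig hGZ _.
  exact: hge_le ghr.
have GDZ : G (D rj + Z ri) = 0.
  apply: (scalerI two0); rewrite scaler0; apply: (hge_eig0 char0 (j := i.+2) _ hGZ) => //.
  move/eqP: Geq; rewrite DGri scaler0 add0r addr_eq0 => /eqP ->; exact: hgeN.
have Drho : D rho = 0.
  have e1 : G ri = G (G w) by rewrite riE homD Gr' add0r.
  by rewrite DG; apply: (ghost_ker2 char0 ZY CZ CY); rewrite -/G -!DG -e1.
have rhoc : rho \in cyc by rewrite cycP Drho.
(* [Z rho] is [G v'], and [rj] contributes through its part [G t]. Then [G (G (D t + v')) = 0], and
   the absence of a generalized kernel gives [Z rho = - D (G t)]. *)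
have zrho : ad L z rho \in bnd.
  have zri : Z ri = Z rho by rewrite riE homD /Z zr add0r.
  have [v' Zv'] := ghost_im char0 ZY CZ CY rho; rewrite -/G -/Z in Zv'.
  have [t' [t [_ _ Gt' rjE]]] := ker_im_split (ghost_ker2 char0 ZY CZ CY) (fun v _ => memvf (G v)) (memvf rj).
  rewrite -/G in Gt' rjE.
  have : G (G (D t + v')) = 0.
    rewrite -[RHS]GDZ zri Zv' [in RHS]rjE !homD DG -[G (D t')]DG Gt' hom0 add0r -!DG.
    by rewrite !(homD, DG).
  move=> /(ghost_ker2 char0 ZY CZ CY); rewrite -/G homD -Zv' -DG => /eqP.
  by rewrite addrC addr_eq0 => /eqP ->; rewrite rpredN; apply/bndP; exists (G t).
clear riA' sG wA AP; clear A.
case: i i1 gx hr hri hrp hrj hrq hr' hrho ghr hGD hGZ => [|[|j]] // _ gx hr hri hrp hrj hrq hr' hrho ghr hGD hGZ.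
pose iv : k := j.+2%:R^-1.
(* From [[z, y] = - c] one has [[z, [y, rho]] = - [c, rho] - [y, [z, rho]]], and [c = h - kk] acts
   on [rho] as [i] up to a boundary because [kk] is in [null]; hence the factor [- 1/i]. *)
pose Y0 := - iv *: ad L y rho.
have iv1 : iv * j.+2%:R = 1 by rewrite mulVf ?natf_neq0.
have eY0 : even Y0 by apply: rpredZ; apply: odd_odd.
have cY0 : Y0 \in cyc by apply: rpredZ; apply: (cyc_cyc ox0).
have hY0 : ad L h Y0 = j.+1%:R *: Y0.
  rewrite homZ jac_even // hy hrho adN homZ -(addn1 j.+1) natrD; vring.
have eY0b : ad L e Y0 = - iv *: ad L z rho.
  by rewrite homZ jac_even // ey erho hom0 addr0.
have zY0 : ad L z Y0 - rho \in bnd.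
  have -> : ad L z Y0 = iv *: (ad L c rho + ad L y (ad L z rho)).
    have := jac_odd rho oz oy; rewrite zy adN => e1.
    rewrite homZ scaleNr -scalerN; congr (_ *: _); apply/eqP; rewrite eqr_oppLR opprD e1.
    by rewrite addrK.
  have -> : ad L c rho = ad L h rho - ad L kk rho by rewrite /h adD addrK.
  rewrite hrho; have kn : kk \in null by case: Jn.
  have kb : ad L kk rho \in bnd by case/nullP: kn => _ _; apply.
  have -> : iv *: (j.+2%:R *: rho - ad L kk rho + ad L y (ad L z rho)) - rho =
    iv *: (ad L y (ad L z rho) - ad L kk rho) + (iv * j.+2%:R - 1) *: rho by vring.
  rewrite iv1 subrr scale0r addr0; apply: rpredZ; apply: rpredB => //.
  exact: (cyc_bnd ox0).
pose B := (homog L false :&: bnd)%VS.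
have BP v : (v \in B) = even v && (v \in bnd) by exact: memv_cap.
have sB X : even X -> X \in cyc -> stab (ad L X) B.
  by move=> eX cX v; rewrite !BP => /andP [ev bv]; rewrite even_even //=; apply: (cyc_bnd ox0).
have ef : even f by case: sum_triple.
have eYB : ad L e Y0 \in B by rewrite BP even_even //= eY0b rpredZ.
have heY : ad L h (ad L e Y0) = j.+3%:R *: ad L e Y0.
  by rewrite (sl2_HEv _ S) hY0 homZ -scalerDl -natrD addn2.
(* [[e, Y0]] is a multiple of the boundary [[z, rho]]. Solving within even boundaries makes the
   generator commute with [e] while keeping it a cycle and its bracket with [z] unchanged modulo
   boundaries. *)
have [w1 [w1B hw1 ew1]] := lefschetz_surj char0 S (sB e ee ec) (sB h eh hc) (sB f ef fc) eYB heY.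
move: w1B; rewrite BP => /andP [evw1 bw1].
pose Y1 := Y0 - w1.
have eY1 : even Y1 by rewrite rpredB.
have hY1 : ad L h Y1 = j.+1%:R *: Y1.
  rewrite homD homN hY0 hw1 -(addn2 j.+1) natrD; vring.
have eY10 : ad L e Y1 = 0 by rewrite homD homN ew1 subrr.
have DY1 : D Y1 = 0 by apply/eqP; rewrite -cycP rpredB //; apply: (bnd_cyc DD).
pose io := ad L z Y1 - rho.
have iob : io \in bnd.
  have -> : io = (ad L z Y0 - rho) - ad L z w1 by rewrite /io homD homN; vring.
  by apply: rpredB => //; apply: (cyc_bnd ox0).
have hzY : ad L h (ad L z Y1) = j.+2%:R *: ad L z Y1.
  by rewrite jac_even // hz hY1 homZ -(add1n j.+1) natrD; vring.
have oio : odd io by rewrite rpredB //; apply: odd_even.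
have eio : ad L e io = 0 by rewrite homD homN jac_even // ez eY10 erho !(ad0, hom0, oppr0, addr0).
have hio : ad L h io = j.+2%:R *: io by rewrite homD homN hzY hrho; vring.
have [x2 [ox2 sp near]] := gauge_apply eY1 hY1 eY10 ox xx.
have gY := hge_eig hY1 (leqnn _).
have Y1x : ad L Y1 x = - (rho + io) + ad L Y1 (b + r).
  rewrite xE -!addrA 2!homD (anti_even x0 eY1) DY1 oppr0 add0r (anti_even z eY1) /io.
  by rewrite (addrC rho) subrK.
have hbr : hge (ad L h) j.+3 (ad L Y1 (b + r)).
  have hbr2 : hge (ad L h) 2 (b + r) by apply: hgeD => //; apply: hge_le hr.
  by have := hge_ad gY hbr2; rewrite addn2.
have hYx : hge (ad L h) j.+2 (ad L Y1 x).
  rewrite Y1x; apply: hgeD; last exact: hge_le hbr.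
  apply: hgeN; apply: hgeD; [exact: hge_eig hrho _|exact: hge_eig hio _].
have hYY : hge (ad L h) j.+3 (ad L Y1 (ad L Y1 x)).
  by apply: hge_le (hge_ad gY hYx); rewrite addSnnS -[X in (X <= _)%N]add0n leq_add2r.
(* In weight [i] there remain the invariant [r'] and a boundary, the situation of [gauge_exact]. *)
have [x3 [b3 [r3 [g3 sp3]]]] : exists x3 b3 r3, gauged j.+3 x3 b3 r3 /\ (splits s x3 -> splits s x2).
  pose T := x2 - (x + ad L Y1 x).
  have hT : hge (ad L h) j.+3 (rp + (ad L Y1 (b + r) + T)).
    by apply: hgeD => //; apply: hgeD => //; apply: near.
  apply: (@gauge_exact j.+2 x2 b (r' + - io + (rp + (ad L Y1 (b + r) + T))) r' (- io) (rp + (ad L Y1 (b + r) + T))) => //.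
  - split=> //.
      by rewrite /T Y1x {1}xE rE riE -/rho; vring.
    apply: hgeD; last exact: hge_le hT.
    apply: hgeD; first exact: hge_eig hr' _.
    apply: hgeN; exact: hge_eig hio _.
  by split; rewrite ?rpredN // homN ?hio ?eio ?oppr0 //; vring.
by exists x3, b3, r3; split=> // /sp3 /sp.
Qed.

(** The balanced part is [x0 + b]. As [c = - [z, y]] kills the invariants, [kk] acts on the
    components of [b] by their [h]-weights, and J serves as the triple. Since [[b, b]] starts in
    weight four, the weight-two part of the equation for the square reads [[x0, w 2] = e'], which
    provides [be]. *)
Lemma gauge_finish i x b : gauged i x b 0 -> splits s x.
Proof.
move=> gx; have sq := gauged_square gx; have [[ox xx] [ob hb zb yb eb] xE _] := gx.
rewrite addr0 in xE.
pose A := (homog L true :&: (lker (ad L z) :&: lker (ad L y)))%VS.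
have AP v : (v \in A) = [&& odd v, ad L z v == 0 & ad L y v == 0] by rewrite !memv_cap !memv_ker.
have sA : stab (ad L h) A.
  move=> v; rewrite !AP => /and3P [ov /eqP zv /eqP yv]; rewrite even_odd //=.
  have e1 := jac_even z v eh; rewrite hz zv hom0 add0r in e1.
  have e2 := jac_even y v eh; rewrite hy adN yv oppr0 hom0 add0r in e2.
  by rewrite -e1 -e2 !eqxx.
have bA : b \in A by rewrite AP ob zb yb !eqxx.
have [N HN] := hge_top char0 (ad L h).
have comps M j v : v \in A -> hge (ad L h) j v -> (N <= j + M)%N -> exists w : nat -> L,
    v = \sum_(l < M) w (j + l)%N /\ forall l, w l \in A /\ ad L h (w l) = l%:R *: w l.
  elim: M j v => [|M IH] j v vA hv NM.
    exists (fun _ => 0); rewrite big_ord0; split; first by apply: HN hv; rewrite addn0 in NM.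
    by move=> l; rewrite mem0v hom0 scaler0.
  have [u [v' [[uA v'A] hu hv' vE]]] := hge_splitA char0 hv sA vA.
  have [|w [wE Hw]] := IH j.+1 v' v'A hv'; first by rewrite addSnnS.
  exists (fun l => if l == j then u else w l); split; last first.
    by move=> l; case: eqP => [->|_].
  rewrite big_ord_recl addn0 eqxx vE wE; congr (_ + _); apply: eq_bigr => l _.
  rewrite lift0 /= addnS -addSn; case: eqP => // e1.
  by have := leq_addr l j.+1; rewrite e1 ltnn.
have [|w [wE Hw]] := comps N.+1 2 b bA hb; first by rewrite (leq_trans (leqnSn N)) // leq_addl.
have wz l : ad L z (w l) = 0 /\ ad L y (w l) = 0.
  by have [] := Hw l; rewrite AP => /and3P [_ /eqP -> /eqP ->].
have wo l : odd (w l) by have [] := Hw l; rewrite AP => /and3P [].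
have cw l : ad L c (w l) = 0.
  have [w1 w2] := wz l; have := jac_odd (w l) oz oy; rewrite zy adN w1 w2 !hom0 addr0 => /eqP.
  by rewrite oppr_eq0 => /eqP.
have kE v : ad L kk v = ad L h v - ad L c v by rewrite /h adD addrAC subrr add0r.
have kw l : ad L kk (w l) = l%:R *: w l by rewrite kE cw subr0; case: (Hw l).
have [[ee' ekk efJ [ke _ _]] [_ _ _ [cK _ _]] [e'n kn fJn]] := And3 trJ trK Jn.
(* The entry of index 1 is zero because [b] has weights at least two. *)
pose bs (l : nat) := if l is 0 then x0 else if l is 1 then 0 else w l.
have bsE : \sum_(l < N.+3) bs l = x0 + b.
  by rewrite 2!big_ord_recl /= add0r wE; congr (_ + _); apply: eq_bigr.
have Dw2 : D (w 2%N) = e'.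
  pose v' := \sum_(l < N) w (l + 3)%N.
  have bE : b = w 2%N + v'.
    by rewrite wE big_ord_recl /=; congr (_ + _); apply: eq_bigr => l _; rewrite [in RHS]addnC.
  have hv' : hge (ad L h) 3 v'.
    by apply: hge_sum => l _; have [_ hl] := Hw (l + 3)%N; apply: hge_eig hl _; rewrite leq_addl.
  move: sq; rewrite !hom0 !addr0 scaler0 add0r => /esym/eqP; rewrite subr_eq0 => /eqP sq2.
  have ce' : ad L c e' = 0 by apply: JKx; rewrite !inE eqxx ?orbT.
  have he' : ad L h e' = 2%:R *: e' by rewrite /h adD ce' add0r.
  have hd : ad L h (e' - D (w 2%N)) = 2%:R *: (e' - D (w 2%N)).
    have [_ h2] := Hw 2%N.
    by rewrite homD homN he' (jac_even _ _ eh) hx0 ad0 add0r h2 homZ; vring.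
  have d0 : 2%:R *: (e' - D (w 2%N)) = 2%:R *: D v' + ad L b b.
    by rewrite -sq2 bE homD; vring.
  have : hge (ad L h) 3 (e' - D (w 2%N)).
    rewrite -[_ - _]scale1r -(mulVf two0) -scalerA d0; apply: hgeZ; apply: hgeD.
      by apply: hgeZ; apply: hge_comm => // v; rewrite (jac_even _ _ eh) hx0 ad0 add0r.
    by apply: hge_le (hge_ad hb hb).
  move=> h3; apply/esym/eqP; rewrite -subr_eq0; apply/eqP.
  exact: (hge_eig0 char0 h3 hd (ltnSn 2)).
exists z, y, eK, c, e', kk, fJ, (w 2%N), bs, N.+2; split.
- by split=> //; case=> [|[|l]] //=; rewrite mem0v.
- by split=> //; case: trK.
- split=> //; rewrite bsE homD zb addr0 (sym_odd oz ox0); by apply/eqP; rewrite -cycP.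
- by rewrite bsE xE addrA [z + x0]addrC.
split.
- case=> [|[|l]] /=; rewrite ?kw ?hom0 ?scaler0 // kill_x0 ?scale0r //; exact: null_cyc.
- split=> //=; try by apply/eqP; rewrite -cycP null_cyc.
- by [].
rewrite bsE !adE x00 (sym_odd ob ox0).
move: sq; rewrite !hom0 !addr0 scaler0 add0r => /esym/eqP; rewrite subr_eq0 => /eqP <-.
by vring.
Qed.

(** In weight one the error is a pure boundary, so [gauge_exact] applies at once with zero invariant
    part; from weight two on [gauge_step] is iterated up to the top weight. *)
Lemma gauge_main x r : odd x -> ad L x x = 2%:R *: (s + e) -> x = x0 + z + r ->
  (exists r1 r2, [/\ r = r1 + r2, r1 \in bnd, ad L h r1 = r1 & hge (ad L h) 2 r2]) -> splits s x.
Proof.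
move=> ox xx xE [r1 [r2 [rE r1b hr1 hr2]]].
have hr1' : ad L h r1 = 1%:R *: r1 by rewrite scale1r.
have g1 : gauged 1 x 0 r.
  split=> //; last by rewrite rE; apply: hgeD; [exact: hge_eig hr1' _|exact: hge_le hr2].
    by split; rewrite ?mem0v ?hom0 //; apply: hge0.
  by rewrite addr0.
have [or er] := gauged_kill g1.
have [N HN] := hge_top char0 (ad L h).
have loop : forall m i x b r, (N <= i + m)%N -> (1 < i)%N -> gauged i x b r -> splits s x.
  elim=> [|m IH] i x' b' r' NM i1 g.
    have r0 : r' = 0 by case: g => _ _ _ hr'; apply: HN hr'; rewrite addn0 in NM.
    by apply: (@gauge_finish i x' b'); rewrite -r0.
  have [x2 [b2 [r3 [g2 sp]]]] := gauge_step i1 g.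
  by apply/sp/(IH i.+1 x2 b2 r3) => //; [rewrite addSnnS|exact: ltnW].
pose A0 := (homog L true :&: lker (ad L e))%VS.
have A0P w : (w \in A0) = odd w && (ad L e w == 0) by rewrite memv_cap memv_ker.
have shA : stab (ad L h) A0.
  move=> w; rewrite !A0P => /andP [ow /eqP ew]; rewrite even_odd //=.
  by have := sl2_HEv w S; rewrite ew !hom0 scaler0 addr0 => <-.
have rA : r \in A0 by rewrite A0P or er eqxx.
have [_ _ _ hr] := g1.
have [u1 [u2 [[u1A u2A] hu1 hu2 uE]]] := hge_splitA char0 hr shA rA.
have eu : u1 = r1.
  have e12 : u1 - r1 = r2 - u2.
    by apply/eqP; rewrite subr_eq addrAC -[r2 + _]addrC -rE uE addrK.
  have h1 : hge (ad L h) 2 (u1 - r1) by rewrite e12; apply: hgeB.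
  have h2 : ad L h (u1 - r1) = 1%:R *: (u1 - r1) by rewrite homD homN hu1 hr1; vring.
  by apply/eqP; rewrite -subr_eq0 (hge_eig0 char0 h1 h2).
move: u1A; rewrite eu A0P => /andP [or1 /eqP er1].
have rE0 : r = 0 + r1 + u2 by rewrite add0r -eu.
have z0 : [/\ odd (0 : L), ad L h 0 = 1%:R *: (0 : L), ad L z 0 = 0, ad L y 0 = 0 & ad L e 0 = 0].
  by rewrite mem0v !hom0 scaler0.
have t0 : [/\ odd r1, ad L h r1 = 1%:R *: r1, r1 \in bnd & ad L e r1 = 0] by [].
have [x2 [b2 [r3 [g2 sp]]]] := gauge_exact (ltn0Sn 0) g1 rE0 z0 (fun _ => erefl) t0 hu2.
by apply/sp/(loop N 2 x2 b2 r3) => //; rewrite leq_addl.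
Qed.

End Gauge.

(** * The splitting when s is central *)

Lemma casimir_graded (k : closedFieldType) (V : vectType k) (E H F T : 'End(V)) :
  (forall v, T (E v) = E (T v) + 2%:R *: E v) -> (forall v, T (H v) = H (T v)) ->
  (forall v, T (F v) = F (T v) - 2%:R *: F v) -> forall v, T (casimir E H F v) = casimir E H F (T v).
Proof. by move=> tE tH tF v; rewrite !casimirE !(homD, homZ) tF !tE !tH !(homD, homZ); vring. Qed.

Lemma stab_cap (k : closedFieldType) (V : vectType k) (f : 'End(V)) A B : stab f A -> stab f B -> stab f (A :&: B)%VS.
Proof. by move=> sA sB v; rewrite !memv_cap => /andP [vA vB]; rewrite sA // sB. Qed.

Lemma stab_eigenv (k : closedFieldType) (V : vectType k) (f g : 'End(V)) c :
  (forall v, g (f v) = f (g v)) -> stab f (eigenv g c).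
Proof. by move=> gf v; rewrite !eigenvP => /eqP gv; rewrite gf gv homZ. Qed.

Section Splitting.
Variables (k : closedFieldType) (L : lieSuperalgebra k).
Hypothesis char0 : [pchar k] =i pred0.
Hypothesis JD : jordan_closed L.
Local Notation even u := (u \in homog L false).
Local Notation odd u := (u \in homog L true).
Implicit Types (u v w a b : L).

Let two0 : (2%:R : k) != 0 := natf_neq0 char0 1.

Lemma hge_bracket h i j u v : even h -> hge (ad L h) i u -> hge (ad L h) j v -> hge (ad L h) (i + j) (ad L u v).
Proof.
move=> eh [t [-> Ht]] hv; rewrite linear_sum sum_lfunE; apply: hge_sum => p /Ht [e1 le] /=.
have [w [-> Hw]] := hv; rewrite linear_sum; apply: hge_sum => q /Hw [e2 le2] /=.
apply: (@hge_eig _ _ _ _ (p.1 + q.1)); last exact: leq_add.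
by rewrite jac_even // e1 e2 adZ homZ natrD scalerDl.
Qed.

(** As [e] kills [x], only natural weights occur, and the equation [[x, x] = 2(s + e)] is compared
    in weights 0, 1 and 2. The term with [u], the weight-two component, is why [x1] squares to [e]
    only modulo boundaries. *)
Lemma weight_components s x e h f : even s -> (forall v, ad L s v = 0) -> triple e h f -> odd x ->
  ad L x x = 2%:R *: (s + e) ->
  exists x0 x1 x2 u, [/\ x = x0 + x1 + x2, [/\ odd x0, odd x1 & odd x2],
    [/\ ad L x0 x0 = 2%:R *: s, ad L e x0 = 0 & ad L h x0 = 0],
    [/\ ad L h x1 = x1, ad L x0 x1 = 0 & ad L x1 x1 + 2%:R *: ad L x0 u = 2%:R *: e] &
    hge (ad L h) 2 x2].
Proof.
move=> es s0 tr ox xx; have [ee eh ef [he e_f hf]] := tr; have S := triple_sl2 tr.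
have [HE EF _] := S.
have ex : ad L e x = 0.
  have := odd_cube char0 ox; rewrite xx adZ adD s0 add0r => /eqP.
  by rewrite scaler_eq0 (negPf two0) => /eqP.
pose A0 := (homog L true :&: lker (ad L e))%VS.
have A0P w : (w \in A0) = odd w && (ad L e w == 0) by rewrite memv_cap memv_ker.
have shA : stab (ad L h) A0.
  move=> w; rewrite !A0P => /andP [ow /eqP ew]; rewrite even_odd //=.
  by have := sl2_HEv w S; rewrite ew !hom0 scaler0 addr0 => <-.
have xA : x \in A0 by rewrite A0P ox ex eqxx.
have hx : hge (ad L h) 0 x.
  have [|s' [xs Hs]] := sl2_ker_hge char0 HE EF (sl2_nilp char0 S) shA xA (i := 0) (w := x) _ ex.
    by rewrite expr0 oneE.
  by exists s'; split=> // t /Hs [].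
have [x0 [y1 [[x0A y1A] hx0 hy1 xE]]] := hge_splitA char0 hx shA xA.
have [x1 [x2 [[x1A x2A] hx1 hx2 y1E]]] := hge_splitA char0 hy1 shA y1A.
have [u [x3 [hu hx3 x2E]]] := hge_split hx2.
move: x0A x1A x2A; rewrite !A0P => /andP [o0 /eqP e0] /andP [o1 /eqP e1] /andP [o2 /eqP e2].
rewrite scale0r in hx0.
have hs : ad L h s = 0 by rewrite (anti_even' h es) s0 oppr0.
have hD v : ad L h (ad L x0 v) = ad L x0 (ad L h v) by rewrite jac_even // hx0 ad0 add0r.
pose T0 := ad L x0 x0 - 2%:R *: s; pose T1 := 2%:R *: ad L x0 x1.
pose T2 := ad L x1 x1 + 2%:R *: ad L x0 u - 2%:R *: e.
pose T3 := 2%:R *: ad L x0 x3 + 2%:R *: ad L x1 x2 + ad L x2 x2.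
have sum0 : T0 + (T1 + (T2 + T3)) = 0.
  have : ad L x x - 2%:R *: (s + e) = 0 by rewrite xx subrr.
  rewrite xE y1E !(adD, homD) (sym_odd o1 o0) (sym_odd o2 o0) (sym_odd o2 o1) => <-.
  by rewrite /T0 /T1 /T2 /T3 [in ad L x0 x2]x2E homD; vring.
have w0 : ad L h T0 = 0%:R *: T0 by rewrite homD homN homZ hs hD hx0 !hom0 scaler0 subr0 scale0r.
have w1 : ad L h T1 = 1%:R *: T1 by rewrite homZ hD hx1 homZ; vring.
have w2 : ad L h T2 = 2%:R *: T2.
  by rewrite homD homD homN !homZ hD hu (jac_even _ _ eh) hx1 adZ !homZ he; vring.
have g1 : hge (ad L h) 1 x1 := hge_eig hx1 (leqnn 1).
have w3 : hge (ad L h) 3 T3.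
  apply: hgeD; first apply: hgeD.
  - apply: hgeZ; have [t [-> Ht]] := hx3; rewrite linear_sum; apply: hge_sum => p /Ht [e' le] /=.
    by apply: (hge_eig _ le); rewrite hD e' homZ.
  - by apply: hgeZ; apply: (hge_bracket eh g1 hx2).
  by apply: hge_le (hge_bracket eh hx2 hx2).
have sol i A B : ad L h A = i%:R *: A -> A + B = 0 -> hge (ad L h) i.+1 B -> A = 0.
  move=> hA /eqP; rewrite addr_eq0 => /eqP AB hB.
  by apply: (hge_eig0 char0 _ hA (ltnSn i)); rewrite AB; apply: hgeN.
have g23 : hge (ad L h) 2 (T2 + T3) by apply: hgeD; [exact: hge_eig w2 _|exact: hge_le w3].
have T00 : T0 = 0.
  by apply: sol w0 sum0 _; apply: hgeD; [exact: hge_eig w1 _|exact: hge_le g23].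
have sum1 : T1 + (T2 + T3) = 0 by rewrite -[RHS]sum0 T00 add0r.
have T10 : T1 = 0 by apply: sol w1 sum1 g23.
have sum2 : T2 + T3 = 0 by rewrite -[RHS]sum1 T10 add0r.
have T20 : T2 = 0 by apply: sol w2 sum2 w3.
exists x0, x1, x2, u; split=> //.
- by rewrite xE y1E addrA.
- by split=> //; apply/eqP; rewrite -subr_eq0 -/T0 T00.
split; first by rewrite hx1 scale1r.
- by apply: (scalerI two0); rewrite scaler0.
by apply/eqP; rewrite -subr_eq0 -/T2 T20.
Qed.

(* Corrects [x1] modulo boundaries so that it squares exactly to the nilpotent of the Levi triple. *)
Lemma osp_generator (x0 x1 u eK c fK e' kk fJ : L) (nn : {vspace L}) : odd x0 -> (forall v, ad L x0 (ad L x0 v) = 0) ->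
  triple eK c fK -> triple e' kk fJ ->
  [/\ eK \in cyc x0, c \in cyc x0 & fK \in cyc x0] -> [/\ e' \in null x0, kk \in null x0 & fJ \in null x0] ->
  (forall p q, p \in [:: e'; kk; fJ] -> q \in [:: eK; c; fK] -> ad L p q = 0) ->
  [/\ (nn <= null x0)%VS, forall n, n \in nn -> even n /\ nilp (ad L n),
      forall p n, p \in null x0 -> n \in nn -> ad L p n \in nn,
      forall p n, p \in [:: eK; c; fK] -> n \in nn -> ad L p n \in nn &
      forall p q a, p \in [:: eK; c; fK] -> q \in [:: eK; c; fK] -> a \in null x0 -> ad L p (ad L q a) \in nn] ->
  odd x1 -> ad L (c + kk) x1 = x1 -> x1 \in cyc x0 -> ad L x1 x1 + 2%:R *: ad L x0 u = 2%:R *: (eK + e') ->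
  exists z, [/\ odd z, z \in cyc x0, z - x1 \in bnd x0, ad L z z = 2%:R *: eK /\ ad L c z = z &
    forall p, p \in [:: e'; kk; fJ] -> ad L p z = 0].
Proof.
move=> ox0 DD trK trJ [eKc cc fKc] [e'n kn fJn] JK [nnsub nnE nnI nnK nnKK] ox1 hx1 x1c x11.
have [eeK ec efK [ceK eKfK cfK]] := trK; have [ee' ek efJ [ke' e'fJ kfJ]] := trJ.
have SJ := triple_sl2 trJ.
have mJ : [/\ e' \in [:: e'; kk; fJ], kk \in [:: e'; kk; fJ] & fJ \in [:: e'; kk; fJ]].
  by rewrite !inE !eqxx !orbT.
have mK : [/\ eK \in [:: eK; c; fK], c \in [:: eK; c; fK] & fK \in [:: eK; c; fK]].
  by rewrite !inE !eqxx !orbT.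
have [[m1 m2 m3] [k1 k2 k3]] := (mJ, mK).
have Jev p : p \in [:: e'; kk; fJ] -> even p /\ p \in null x0.
  by rewrite !inE => /or3P [] /eqP ->.
pose h := c + kk; have eh : even h by rewrite rpredD.
have KJ p q : p \in [:: e'; kk; fJ] -> q \in [:: eK; c; fK] -> ad L q p = 0.
  by move=> pJ qK; have [ep _] := Jev p pJ; rewrite (anti_even' q ep) JK // oppr0.
have he' : ad L h e' = 2%:R *: e' by rewrite /h adD KJ // add0r.
have hkk : ad L h kk = 0 by rewrite /h adD KJ // add0r even_self.
have hfJ : ad L h fJ = - 2%:R *: fJ by rewrite /h adD KJ // add0r.
pose Om := casimir (ad L e') (ad L kk) (ad L fJ).
have hOm v : ad L h (Om v) = Om (ad L h v).
  apply: casimir_graded => w; rewrite jac_even // ?he' ?hkk ?hfJ ?adZ ?ad0 ?add0r ?scaleNr //.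
  - by rewrite addrC.
  - by rewrite addrC.
pose A := (cyc x0 :&: (homog L true :&: eigenv (ad L h) 1))%VS.
have AP v : (v \in A) = [&& v \in cyc x0, odd v & ad L h v == v] by rewrite !memv_cap eigenvP scale1r.
have sOm : stab Om A.
  apply: stab_cap; first by apply: casimir_stab; apply: (cyc_stab ox0); apply: null_cyc.
  apply: stab_cap; first by apply: casimir_stab => w; apply: even_odd.
  exact: stab_eigenv.
have x1A : x1 \in A by rewrite AP x1c ox1 hx1 eqxx.
(* The kernel of the Casimir operator consists of J-invariants, and the correction [Om w] is a
   boundary because J lies in [null]. *)
have [z0 [w [z0A wA Omz0 x1E]]] := ker_im_split (fun v => casimir_ker2 char0 SJ (v := v)) sOm x1A.
have [e'z kz fz] := casimir_ker char0 SJ Omz0.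
have Jz0 p : p \in [:: e'; kk; fJ] -> ad L p z0 = 0 by rewrite !inE => /or3P [] /eqP ->.
move: z0A wA; rewrite !AP => /and3P [z0c oz0 /eqP hz0] /and3P [wc ow _].
pose io := Om w; have iob : io \in bnd x0.
  have nb p v : p \in null x0 -> v \in cyc x0 -> ad L p v \in bnd x0 by case/nullP=> _ _; apply.
  have cb v : v \in bnd x0 -> v \in cyc x0 := bnd_cyc DD (v := v).
  rewrite /io /Om casimirE; apply: rpredD; last by apply: rpredZ; apply: nb.
  apply: rpredD; last by apply/nb/cb/nb.
  by apply: rpredZ; apply/nb/cb/nb.
have oio : odd io.
  have -> : io = x1 - z0 by rewrite x1E addrAC subrr add0r.
  by rewrite rpredB.
have cz0 : ad L c z0 = z0.
  by have := hz0; rewrite /h adD kz addr0.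
(* [B] measures the failure of [z0] to square to [eK]. It is J-invariant, in [null] because it
   differs from [e'] by a boundary, and of [c]-weight two, so bracketing twice with [c] multiplies
   it by four and places it in [nn]. *)
pose B := 2%:R^-1 *: ad L z0 z0 - eK.
have eB : even B by rewrite rpredB // rpredZ //; apply: odd_odd.
have z00 : ad L z0 z0 = 2%:R *: (eK + B) by rewrite /B addrC subrK scalerA mulfV // scale1r.
have Be' : B - e' \in bnd x0.
  suff : 2%:R *: (B - e') \in bnd x0 by rewrite rpredZeq (negPf two0).
  have z0E : z0 = x1 - io by rewrite x1E addrK.
  have -> : 2%:R *: (B - e') = ad L io io - 2%:R *: ad L x1 io - 2%:R *: ad L x0 u.
    have e1 : ad L z0 z0 = ad L x1 x1 - 2%:R *: ad L x1 io + ad L io io.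
      by rewrite z0E !(adD, homD, adN, homN) (sym_odd oio ox1); vring.
    have e2 : ad L x1 x1 = 2%:R *: (eK + e') - 2%:R *: ad L x0 u by rewrite -x11 addrK.
    transitivity (2%:R *: (eK + B) - 2%:R *: (eK + e')); first by vring.
    by rewrite -z00 e1 e2; vring.
  rewrite !rpredB //; first exact: (cyc_bnd ox0 (bnd_cyc DD iob) iob).
    by apply: rpredZ; apply: (cyc_bnd ox0).
  by apply: rpredZ; apply/bndP; exists u.
have Bn : B \in null x0.
  by rewrite -[B](subrK e') rpredD // (bnd_null ox0 DD) // rpredB.
have cB : ad L c B = 2%:R *: B.
  by rewrite homD homN homZ jac_even // cz0 ceK /B; vring.
have JB p : p \in [:: e'; kk; fJ] -> ad L p B = 0.
  move=> pJ; have [ep _] := Jev p pJ.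
  by rewrite homD homN homZ jac_even // (Jz0 p pJ) (JK p eK pJ k1) !(ad0, hom0, addr0, scaler0, oppr0).
have Bnn : B \in nn.
  have -> : B = 4%:R^-1 *: ad L c (ad L c B).
    have four0 : (4%:R : k) != 0 := natf_neq0 char0 3.
    by apply: (scalerI four0); rewrite scalerA mulfV // scale1r cB homZ cB scalerA -natrM.
  by apply: rpredZ; apply: nnKK.
pose nJ := (nn :&: (lker (ad L e') :&: (lker (ad L kk) :&: lker (ad L fJ))))%VS.
have nJP n : n \in nJ <-> n \in nn /\ forall p, p \in [:: e'; kk; fJ] -> ad L p n = 0.
  rewrite !memv_cap !memv_ker; split.
    move=> /and4P [nn' /eqP a1 /eqP a2 /eqP a3]; split=> // p.
    by rewrite !inE => /or3P [] /eqP ->.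
  by move=> [-> H]; rewrite !H // !eqxx.
have nJst q : q \in [:: eK; c; fK] -> stab (ad L q) nJ.
  move=> qK n /nJP [nnn Hn]; apply/nJP; split=> [|p pJ]; first exact: nnK.
  by have [ep _] := Jev p pJ; rewrite jac_even // (JK p q pJ qK) (Hn p pJ) ad0 hom0 addr0.
(* [eK + B] is conjugate to [eK] by exponentials of J-invariants of [nn] of [c]-weight zero. These
   fix [c], J and [x0], hence keep the properties of [z0]. *)
have [|m n /nJP [mn Hm] /nJP [nnn Hn]||||||phi [psi [inn phiE]]] := @conj_triple _ _ char0 eK c fK nJ B trK.
- by move=> n /nJP [/nnE].
- apply/nJP; split=> [|p pJ]; first by apply: nnI => //; apply: (subvP nnsub).
  by have [ep _] := Jev p pJ; rewrite jac_even // (Hm p pJ) (Hn p pJ) ad0 hom0 addr0.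
- exact: nJst.
- exact: nJst.
- exact: nJst.
- exact/nJP.
- by [].
have [[pp ph] [qp qh] e1 e2 near] := inn.
have evn n : n \in nJ /\ ad L c n = 0 -> even n /\ n \in null x0.
  by move=> [/nJP [nnn _] _]; case: (nnE n nnn) => en _; split=> //; apply: (subvP nnsub).
have [_ gc] : phi c = c /\ psi c = c.
  by apply: (inner_fix inn) => n Hn; have [en _] := evn n Hn; rewrite (anti_even c en) (proj2 Hn) oppr0.
have gJ p : p \in [:: e'; kk; fJ] -> psi p = p.
  move=> pJ; have [|_ ->//] := inner_fix (v := p) inn _.
  by move=> n Hn; have [en _] := evn n Hn; have [/nJP [_ H] _] := Hn; rewrite (anti_even p en) H // oppr0.
have [_ g0] : phi x0 = x0 /\ psi x0 = x0.
  apply: (inner_fix inn) => n Hn; have [en nn0] := evn n Hn.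
  by have := null_cyc nn0; rewrite cycP (anti_even x0 en) => /eqP ->; rewrite oppr0.
exists (psi z0); split.
- exact: qp.
- by rewrite cycP -g0 -qh; move: z0c; rewrite cycP => /eqP ->; rewrite hom0.
- have -> : psi z0 - x1 = (psi z0 - z0) - io by rewrite x1E; vring.
  rewrite rpredB //.
  have [|n v Hn vc|_ //] := near (bnd x0) (cyc x0) _ _ z0 z0c.
    by move=> n Hn; apply: (bnd_stab ox0); apply: null_cyc; case: (evn n Hn).
  by have [_ /nullP [_ _]] := evn n Hn; apply.
- split; last by rewrite -{1}gc -qh cz0.
  by rewrite -qh z00 homZ -phiE -mulE e2 oneE.
by move=> p pJ; rewrite -{1}(gJ p pJ) -qh Jz0 // hom0.
Qed.

(** The Levi triple agrees with [e, h, f] only modulo [null]. The Casimir operator of K splits the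
    difference into a K-invariant and an element of its image, which lies in the nilpotent ideal
    [nn]; [conj_triple] absorbs the latter, and the invariants supply the triple J. *)
Lemma super_splitting s x e h f : even s -> (forall v, ad L s v = 0) -> triple e h f -> odd x ->
  ad L x x = 2%:R *: (s + e) -> splits s x.
Proof.
move=> es s0 tr ox xx; have [ee eh ef [he ef_h hf]] := tr; have S := triple_sl2 tr.
have [x0 [x1 [x2 [u [xE [ox0 ox1 ox2] [x00 ex0 hx0] [hx1 x01 x11] hx2]]]]] := weight_components es s0 tr ox xx.
have DD := DD char0 s0 ox0 x00.
(* [e] and [h] kill [x0], so the Casimir operator does, and therefore [f] as well. *)
have fx0 : ad L f x0 = 0.
  have cas0 : casimir (ad L e) (ad L h) (ad L f) x0 = 0.
    by rewrite casimirE ex0 hx0 !(hom0, scaler0, addr0).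
  by have [_ _ ->] := casimir_ker char0 S cas0.
have cycE a : even a -> ad L a x0 = 0 -> a \in cyc x0.
  by move=> ea a0; rewrite cycP (anti_even' x0 ea) a0 oppr0.
have [ec hc fc] : [/\ e \in cyc x0, h \in cyc x0 & f \in cyc x0] by split; apply: cycE.
have [eK [c [fK [trK [ne nc nf] [heK hcc hfK] kap]]]] := levi_exists ox0 DD char0 JD tr ec hc fc.
have [eeK ecc efK [ceK eKfK cfK]] := trK; have SK := triple_sl2 trK.
have near_cyc a b : a - b \in null x0 -> b \in cyc x0 -> a \in cyc x0.
  by move=> ab bc; rewrite -[a](subrK b) rpredD // null_cyc.
have [eKc c_c fKc] := And3 (near_cyc _ _ ne ec) (near_cyc _ _ nc hc) (near_cyc _ _ nf fc).
have [nn nnD] := nilrad_data char0 ox0 trK eKc c_c fKc kap.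
have [nnsub nnE nnI nnK nnKK] := nnD.
have [k1 k2 k3] : [/\ eK \in [:: eK; c; fK], c \in [:: eK; c; fK] & fK \in [:: eK; c; fK]].
  by rewrite !inE !eqxx !orbT.
pose Om := casimir (ad L eK) (ad L c) (ad L fK).
have hOm v : ad L h (Om v) = Om (ad L h v).
  apply: casimir_graded => w; rewrite jac_even // ?heK ?hcc ?hfK ?adZ ?ad0 ?add0r ?scaleNr //.
  - by rewrite addrC.
  - by rewrite addrC.
have nst a : even a -> a \in cyc x0 -> stab (ad L a) (null x0) by move=> ea ac v; apply: null_ideal.
have Omst d : stab Om (null x0 :&: eigenv (ad L h) d).
  by apply: stab_cap; [apply: casimir_stab; apply: nst|apply: stab_eigenv].
have splitOm d v : v \in null x0 -> ad L h v = d *: v -> exists v' w,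
    [/\ v' \in null x0 /\ w \in null x0, ad L h v' = d *: v' /\ ad L h w = d *: w,
        [/\ ad L eK v' = 0, ad L c v' = 0 & ad L fK v' = 0] & v = v' + Om w].
  move=> vn hv; have vA : v \in (null x0 :&: eigenv (ad L h) d)%VS by rewrite memv_cap eigenvP vn hv eqxx.
  have [v' [w [v'A wA Ov' ->]]] := ker_im_split (fun v => casimir_ker2 char0 SK (v := v)) (Omst d) vA.
  move: v'A wA; rewrite !memv_cap !eigenvP => /andP [v'n /eqP hv'] /andP [wn /eqP hw].
  by exists v', w; split=> //; apply: (casimir_ker char0 SK).
have Omnn w : w \in null x0 -> Om w \in nn.
  move=> wn; have e1 : ad L c w = ad L eK (ad L fK w) - ad L fK (ad L eK w).
    by rewrite (sl2_EFv _ SK) addrAC subrr add0r.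
  have e2 : ad L c w \in nn by rewrite e1 rpredB //; apply: nnKK.
  rewrite /Om casimirE; apply: rpredD; last by apply: rpredZ.
  by apply: rpredD; [apply: rpredZ|]; apply: nnKK.
have n_e : e - eK \in null x0 by rewrite -opprB rpredN.
have h_e : ad L h (e - eK) = 2%:R *: (e - eK) by rewrite homD homN he heK; vring.
have [e' [w [[e'n wn] [he' hw] [eKe' ce' fKe'] eE]]] := splitOm _ _ n_e h_e.
have nu_nn := Omnn w wn.
have nustab a b : a - b \in null x0 -> b \in [:: eK; c; fK] -> stab (ad L a) nn.
  by move=> abn bK n nnn; rewrite -[a](subrK b) adD rpredD //; [apply: nnI|apply: nnK].
have opp_null a b : a - b \in null x0 -> b - a \in null x0 by rewrite -opprB rpredN.
have nu2 : ad L h (- Om w) = 2%:R *: (- Om w) by rewrite homN hOm hw homZ scalerN.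
have nunn : - Om w \in nn by rewrite rpredN.
have nnB m n : m \in nn -> n \in nn -> ad L m n \in nn.
  by move=> /(subvP nnsub) mn; apply: nnI.
have [phi [psi [inn phiE]]] := conj_triple char0 tr nnE nnB (nustab _ _ n_e k1)
   (nustab _ _ (opp_null _ _ nc) k2) (nustab _ _ (opp_null _ _ nf) k3) nunn nu2.
have {}phiE : phi e = eK + e' by rewrite phiE -[e in LHS](subrK eK) eE; vring.
have [[pp ph] hpsi e1 e2 near] := inn.
have evn n : n \in nn /\ ad L h n = 0 -> even n /\ n \in null x0.
  by move=> [nnn _]; case: (nnE n nnn) => en _; split=> //; apply: (subvP nnsub).
have [gs gs'] : phi s = s /\ psi s = s.
  by apply: (inner_fix inn) => n _; rewrite (anti_even' n es) s0 oppr0.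
have [gh _] : phi h = h /\ psi h = h.
  by apply: (inner_fix inn) => n Hn; rewrite (anti_even' n eh) (proj2 Hn) oppr0.
have [g0 _] : phi x0 = x0 /\ psi x0 = x0.
  apply: (inner_fix inn) => n Hn; have [en nn0] := evn n Hn.
  by have := null_cyc nn0; rewrite cycP (anti_even x0 en) => /eqP ->; rewrite oppr0.
have hphi v : ad L h (phi v) = phi (ad L h v) by rewrite ph gh.
pose f2 := phi f; have ef2 : even f2 by apply: pp.
have n_f2 : f2 - fK \in null x0.
  have -> : f2 - fK = (f2 - f) + (f - fK) by vring.
  apply: rpredD; last exact: opp_null.
  have [|n v Hn vf|d _ //] := near (null x0) <[f]>%VS _ _ f (memv_line f).
    by move=> n Hn; have [en nn0] := evn n Hn; apply: nst => //; apply: null_cyc.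
  move: vf => /vlineP [r ->]; rewrite homZ rpredZ //; have [en nn0] := evn n Hn.
  exact: null_ideal'.
have h_f2 : ad L h (f2 - fK) = - 2%:R *: (f2 - fK).
  by rewrite homD homN hphi hf hfK homZ -/f2; vring.
have [fJ [w2 [[fJn w2n] [hfJ hw2] [eKf cf fKf] f2E]]] := splitOm _ _ n_f2 h_f2.
pose kk := h - c.
have kn : kk \in null x0 by apply: opp_null.
have [ee' efJ ekk] := And3 (null_even e'n) (null_even fJn) (null_even kn).
have Kh X d : even X -> ad L h X = d *: X -> ad L c X = d *: X -> ad L X kk = 0.
  by move=> eX hX cX; rewrite homD homN (anti_even h eX) (anti_even c eX) hX cX subrr.
have [eKk ck fKk] : [/\ ad L eK kk = 0, ad L c kk = 0 & ad L fK kk = 0].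
  split; [exact: (Kh _ 2%:R)|apply: (Kh _ 0) => //|exact: (Kh _ (- 2%:R))].
    by rewrite hcc scale0r.
  by rewrite even_self // scale0r.
have kE v : ad L kk v = ad L h v - ad L c v by rewrite /kk adD adN.
have ef2h : ad L (eK + e') f2 = h by rewrite -phiE -ph ef_h gh.
(* The difference is killed by K, being built from K-invariants, and it lies in the image of the
   Casimir operator of K; [casimir_ker2] makes it zero. *)
have e'fJ : ad L e' fJ = kk.
  have comm X : even X -> ad L X eK = 0 -> ad L X c = 0 -> ad L X fK = 0 -> forall v, ad L X (Om v) = Om (ad L X v).
    by move=> eX X1 X2 X3; apply: casimir_comm => v; rewrite jac_even // ?X1 ?X2 ?X3 ad0 add0r.
  have XE : kk - ad L e' fJ = Om (ad L eK w2 + ad L e' w2).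
    have f2E' : f2 = fK + (fJ + Om w2) by rewrite -f2E addrC subrK.
    have e'eK a : ad L a e' = 0 -> even a -> ad L e' a = 0 by move=> a0 ea; rewrite (anti_even' e' ea) a0 oppr0.
    have e'O : ad L e' (Om w2) = Om (ad L e' w2).
      by rewrite comm // (anti_even _ ee') ?eKe' ?ce' ?fKe' oppr0.
    have eKO : ad L eK (Om w2) = Om (ad L eK w2) by rewrite [in RHS]/Om (casimir_commE _ SK).
    rewrite /kk -ef2h f2E' adD !homD eKfK eKf e'O eKO (anti_even _ ee') fKe'.
    by vring.
  have OX : Om (kk - ad L e' fJ) = 0.
    have z q : even q -> ad L q kk = 0 -> ad L q e' = 0 -> ad L q fJ = 0 -> ad L q (kk - ad L e' fJ) = 0.
      by move=> eq q1 q2 q3; rewrite homD homN q1 jac_even // q2 q3 ad0 hom0 addr0 subrr.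
    by rewrite /Om casimirE (z eK) // (z c) // !(hom0, scaler0, addr0).
  rewrite XE in OX; have := casimir_ker2 char0 SK OX; rewrite -/Om -XE => /eqP.
  by rewrite subr_eq0 => /eqP.
have trJ : triple e' kk fJ by split=> //; split=> //; rewrite kE ?he' ?hfJ ?ce' ?cf subr0.
have JK p q : p \in [:: e'; kk; fJ] -> q \in [:: eK; c; fK] -> ad L p q = 0.
  move=> pJ qK.
  have eq : even q by move: qK; rewrite !inE => /or3P [] /eqP ->.
  rewrite (anti_even' p eq); apply/eqP; rewrite oppr_eq0.
  by move: pJ qK; rewrite !inE => /or3P [] /eqP -> /or3P [] /eqP ->; apply/eqP.
have ck_h : c + kk = h by rewrite /kk addrC subrK.
have x1c : phi x1 \in cyc x0 by rewrite cycP -g0 -ph x01 hom0.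
have hx1' : ad L (c + kk) (phi x1) = phi x1 by rewrite ck_h hphi hx1.
have x11' : ad L (phi x1) (phi x1) + 2%:R *: ad L x0 (phi u) = 2%:R *: (eK + e').
  by have := congr1 phi x11; rewrite homD !homZ !ph g0 phiE.
have [z [oz zc zb [zz cz] Jz]] := osp_generator ox0 DD trK trJ (And3 eKc c_c fKc) (And3 e'n kn fJn) JK nnD
  (pp _ _ ox1) hx1' x1c x11'.
have main := gauge_main char0 s0 es ox0 x00 trK trJ (And3 eKc c_c fKc) (And3 e'n kn fJn) JK oz zc zz cz Jz.
have : splits s (phi x).
  apply: (main _ (phi x - x0 - z)) => //.
  - exact: pp.
  - by rewrite -ph xx homZ homD gs phiE.
  - by vring.
  exists (phi x1 - z), (phi x2); split.
  - by rewrite xE !homD g0; vring.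
  - by rewrite -opprB rpredN.
  - rewrite homD homN hx1' {1}ck_h; congr (_ - _).
    have [_ kkm _] : [/\ true, kk \in [:: e'; kk; fJ] & true] by rewrite !inE eqxx orbT.
    by rewrite -ck_h adD cz Jz // addr0.
  rewrite ck_h; have [t [-> Ht]] := hx2; rewrite linear_sum; apply: hge_sum => p /Ht [e3 le] /=.
  by apply: (hge_eig _ le); rewrite hphi e3 homZ.
by move=> /(splits_hom hpsi); rewrite gs' -mulE e2 oneE.
Qed.

End Splitting.

(** * Regular maps on the even group and their differentials at the identity *)

Section Smooth.
Variables (k : closedFieldType) (G : supergroup k).
Local Notation L := (Lie G).
Local Notation G0 := (even_group G).
Local Notation O := (Defs.coord G0).
Local Notation tg := (@tangent k G).
Local Notation even u := (u \in homog L false).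
Implicit Types (g : G0) (a b : O) (X Y : L).

Lemma evD g a b : ev g (a + b) = ev g a + ev g b. Proof. exact: raddfD. Qed.
Lemma evZ g (c : k) a : ev g (c *: a) = c * ev g a. Proof. exact: linearZ. Qed.
Lemma evM g a b : ev g (a * b) = ev g a * ev g b. Proof. exact: rmorphM. Qed.
Lemma ev1 g : ev g 1 = 1. Proof. exact: rmorph1. Qed.
Lemma ev0 g : ev g 0 = 0. Proof. exact: raddf0. Qed.
Lemma ev_sum g (I : Type) (r : seq I) (F : I -> O) : ev g (\sum_(i <- r) F i) = \sum_(i <- r) ev g (F i).
Proof. exact: raddf_sum. Qed.

Lemma tgD X a b : tg X (a + b) = tg X a + tg X b. Proof. exact: raddfD. Qed.
Lemma tgZ X (c : k) a : tg X (c *: a) = c * tg X a. Proof. exact: linearZ. Qed.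
Lemma tg0 X : tg X 0 = 0. Proof. exact: raddf0. Qed.
Lemma tg_sum X (I : Type) (r : seq I) (F : I -> O) : tg X (\sum_(i <- r) F i) = \sum_(i <- r) tg X (F i).
Proof. exact: raddf_sum. Qed.
Lemma tgM X a b : even X -> tg X (a * b) = tg X a * ev 1%g b + ev 1%g a * tg X b.
Proof. by case: (tangentP G) => _ _ H _ _ eX; apply: H. Qed.
Lemma tg_lin (c : k) X Y a : even X -> even Y -> tg (c *: X + Y) a = c * tg X a + tg Y a.
Proof. by case: (tangentP G) => H _ _ _ _ eX eY; apply: H. Qed.
Lemma tg_inj X : even X -> (forall a, tg X a = 0) -> X = 0.
Proof. by case: (tangentP G) => _ H _ _ _ eX H'; apply: H. Qed.
Lemma tg_const X (c : k) : even X -> tg X (c *: 1) = 0.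
Proof.
move=> eX; rewrite tgZ; have := tgM 1 1 eX; rewrite mulr1 ev1 mulr1 mul1r => /eqP.
by rewrite -subr_eq0 opprD addNKr oppr_eq0 => /eqP ->; rewrite mulr0.
Qed.

(** [R] is a regular map and [dR] its differential at the identity. A single coordinate function
    witnesses both for each functional, so the differential can be computed from any formula for the
    map. *)
Definition smooth (V : vectType k) (R : G0 -> V) (dR : L -> V) := forall phi : 'Hom(V, k^o),
  exists a, (forall g, ev g a = phi (R g)) /\ (forall X, even X -> phi (dR X) = tg X a).

Section SmoothTheory.
Variables (V W U : vectType k).

Lemma smooth_ext (R R' : G0 -> V) dR dR' : smooth R dR -> (forall g, R g = R' g) ->
  (forall X, even X -> dR X = dR' X) -> smooth R' dR'.
Proof.
move=> sR RR dd phi; have [a [a1 a2]] := sR phi; exists a.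
by split=> [g|X eX]; rewrite ?a1 ?RR // -a2 // dd.
Qed.

Lemma smooth_lin (f : 'Hom(V, W)) R dR : smooth R dR -> smooth (fun g => f (R g)) (fun X => f (dR X)).
Proof.
move=> sR phi; have [a [a1 a2]] := sR (phi \o f)%VF; exists a.
by split=> [g|X eX]; rewrite -?a1 -?a2 ?a1 ?comp_lfunE // -a2 // comp_lfunE.
Qed.

Lemma smooth_cst (v : V) : smooth (fun _ => v) (fun _ => 0).
Proof.
move=> phi; exists (phi v *: 1); split=> [g|X eX]; first by rewrite evZ ev1 mulr1.
by rewrite tg_const // hom0.
Qed.

Lemma smoothD (R R' : G0 -> V) dR dR' : smooth R dR -> smooth R' dR' ->
  smooth (fun g => R g + R' g) (fun X => dR X + dR' X).
Proof.
move=> sR sR' phi; have [a [a1 a2]] := sR phi; have [b [b1 b2]] := sR' phi; exists (a + b).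
by split=> [g|X eX]; rewrite ?evD ?tgD homD ?a1 ?b1 ?a2 ?b2.
Qed.

Lemma smooth_sum (I : Type) (r : seq I) (R : I -> G0 -> V) dR : (forall i, smooth (R i) (dR i)) ->
  smooth (fun g => \sum_(i <- r) R i g) (fun X => \sum_(i <- r) dR i X).
Proof.
move=> H; elim: r => [|i r IH].
  by apply: (smooth_ext (smooth_cst 0)) => *; rewrite big_nil.
by apply: (smooth_ext (smoothD (H i) IH)) => *; rewrite big_cons.
Qed.

Lemma smooth_scale (m : O) (R : G0 -> V) dR : smooth R dR ->
  smooth (fun g => (ev g m : k) *: R g) (fun X => (tg X m : k) *: R 1%g + (ev 1%g m : k) *: dR X).
Proof.
move=> sR phi; have [a [a1 a2]] := sR phi; exists (m * a); split=> [g|X eX].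
  by rewrite evM homZ a1.
by rewrite tgM // homD !homZ -a1 a2.
Qed.

End SmoothTheory.

(** The Leibniz rule, by expanding the first argument in a basis with regular coefficients. *)
Lemma smooth_bilin (V W U : vectType k) (R : G0 -> V) dR (Q : G0 -> W) dQ (be : V -> 'Hom(W, U)) :
  (forall c u v w, be (c *: u + v) w = c *: be u w + be v w) -> smooth R dR -> smooth Q dQ ->
  smooth (fun g => be (R g) (Q g)) (fun X => be (dR X) (Q 1%g) + be (R 1%g) (dQ X)).
Proof.
move=> bl sR sQ; pose bs := vbasis {:V}.
have be0 w : be 0 w = 0.
  by have := bl (-1) 0 0 w; rewrite scaler0 addr0 scaleN1r addNr.
have be_sum (I : Type) (r : seq I) (c : I -> k) (u : I -> V) w :
    be (\sum_(i <- r) c i *: u i) w = \sum_(i <- r) c i *: be (u i) w.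
  by elim: r => [|i r IH]; rewrite ?big_nil // !big_cons bl IH.
have cf (i : 'I_(\dim {:V})) : {f : 'Hom(V, k^o) | forall v, f v = vector.coord bs i v}.
  by apply: mkhom => c u v; rewrite linearP.
pose f i := sval (cf i); have fE i v : f i v = vector.coord bs i v := svalP (cf i) v.
have vE v : v = \sum_i (f i v : k) *: bs`_i.
  by rewrite {1}(coord_vbasis (memvf v)); apply: eq_bigr => i _; rewrite fE.
pose m i := sval (constructive_indefinite_description _ (sR (f i))).
have mP i := svalP (constructive_indefinite_description _ (sR (f i))).
have s1 : smooth (fun g => \sum_i (ev g (m i) : k) *: be bs`_i (Q g))
   (fun X => \sum_i ((tg X (m i) : k) *: be bs`_i (Q 1%g) + (ev 1%g (m i) : k) *: be bs`_i (dQ X))).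
  by apply: smooth_sum => i; apply: smooth_scale; apply: smooth_lin.
apply: (smooth_ext s1) => [g|X eX].
  rewrite [in RHS](vE (R g)) be_sum; apply: eq_bigr => i _.
  by have [-> _] := mP i.
rewrite big_split /= [in RHS](vE (dR X)) [in RHS](vE (R 1%g)) !be_sum; congr (_ + _).
  by apply: eq_bigr => i _; have [_ H] := mP i; rewrite -H.
by apply: eq_bigr => i _; have [-> _] := mP i.
Qed.

(** Followed by [1 - projv A] the map is zero, hence so is its differential. In this way subspaces
    stable under the group become stable under its Lie algebra. *)
Lemma smooth_mem (V : vectType k) (R : G0 -> V) dR (A : {vspace V}) : smooth R dR -> (forall g, R g \in A) ->
  forall X, even X -> dR X \in A.
Proof.
move=> sR RA X eX; pose f : 'End(V) := 1 - projv A.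
have fA v : v \in A -> f v = 0 by move=> vA; rewrite /f addE oneE oppE projv_id // subrr.
have f0 v : f v = 0 -> v \in A.
  by rewrite /f addE oneE oppE => /eqP; rewrite subr_eq0 => /eqP ->; apply: memv_proj.
apply: f0; apply/eqP/negPn/negP => /functional_at [phi]; apply/negP; rewrite negbK.
have [a [a1 a2]] := smooth_lin f sR phi.
have a0 : a = 0 by apply: coord_fun => g; rewrite a1 fA // hom0 ev0.
by rewrite a2 // a0 tg0.
Qed.

Lemma smooth_end (V : vectType k) (R : G0 -> 'End(V)) (dR : L -> 'End(V)) :
  (forall v, smooth (fun g => R g v) (fun X => dR X v)) -> smooth R dR.
Proof.
move=> H; pose bs := vbasis {:V}.
have lam (i : 'I_(\dim {:V})) : {f : 'Hom(V, 'End(V)) | forall u v, f u v = vector.coord bs i v *: u}.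
  have e u : {f : 'End(V) | forall v, f v = vector.coord bs i v *: u}.
    by apply: mkhom => c v w; rewrite linearP scalerDl scalerA.
  have [|f fE] := @mkhom _ V 'End(V) (fun u => sval (e u)).
    move=> c u w; apply/lfunP => v; rewrite addE scaleE !(svalP (e _)).
    by rewrite scalerDr !scalerA mulrC.
  by exists f => u v; rewrite fE (svalP (e _)).
pose l i := sval (lam i); have lE i u v : l i u v = vector.coord bs i v *: u := svalP (lam i) u v.
have dec (f : 'End(V)) : f = \sum_i l i (f bs`_i).
  apply/lfunP => v; rewrite sum_lfunE {1}(coord_vbasis (memvf v)) linear_sum.
  by apply: eq_bigr => i _; rewrite lE linearZ.
have s1 : smooth (fun g => \sum_i l i (R g bs`_i)) (fun X => \sum_i l i (dR X bs`_i)).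
  by apply: smooth_sum => i; apply: (smooth_lin (l i) (H bs`_i)).
by apply: (smooth_ext s1) => *; rewrite -dec.
Qed.

Lemma smooth_rep (V : vectType k) (rho : G0 -> 'End(V)) (act : L -> V -> V) : rational_rep rho ->
  differential tg rho act -> forall v, smooth (fun g => rho g v) (fun X => act X v).
Proof.
move=> [_ _ H] d v phi; have [a aE] := H phi v; exists a; split=> // X eX.
exact: d.
Qed.

(** Differentiate the antipode identity, which says that the convolution of the identity with the
    antipode is constant. *)
Lemma ev_inv a b : (forall g, ev g b = ev (g^-1)%g a) -> forall X, even X -> tg X b = - tg X a.
Proof.
move=> bE X eX; have [r rE] := coord_comul a.
have anti p : exists c, forall g, ev g c = ev (g^-1)%g p := coord_antipode p.
pose S p := sval (constructive_indefinite_description _ (anti p)).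
have SE p h : ev h (S p) = ev (h^-1)%g p := svalP (constructive_indefinite_description _ (anti p)) h.
have c1 : \sum_(p <- r) p.1 * S p.2 = ev 1%g a *: 1.
  apply: coord_fun => h; rewrite ev_sum evZ ev1 mulr1 -(mulgV h) rE.
  by apply: eq_bigr => p _; rewrite evM SE.
have c2 : \sum_(p <- r) (ev 1%g p.2 : k) *: p.1 = a.
  apply: coord_fun => h; rewrite ev_sum -{2}[h]mulg1 rE; apply: eq_bigr => p _.
  by rewrite evZ mulrC.
have c3 : \sum_(p <- r) (ev 1%g p.1 : k) *: S p.2 = b.
  apply: coord_fun => h; rewrite ev_sum bE -[X in ev X a]mul1g rE; apply: eq_bigr => p _.
  by rewrite evZ SE.
have := tg_const (ev 1%g a) eX; rewrite -c1 tg_sum => e.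
apply/eqP; rewrite -addr_eq0 -c2 -c3 !tg_sum -big_split /= -[X in _ == X]e; apply/eqP; apply: eq_bigr => p _.
by rewrite tgM // !tgZ SE invg1 addrC mulrC.
Qed.

End Smooth.

Lemma hom_eq (k : closedFieldType) (V : vectType k) (u v : V) : (forall phi : 'Hom(V, k^o), phi u = phi v) -> u = v.
Proof.
move=> H; apply/eqP; rewrite -subr_eq0; apply/negPn/negP => /functional_at [phi].
by rewrite homD homN H subrr eqxx.
Qed.

(** Evaluation on a basis of [U] maps [V] to a space of smaller dimension, so it has a kernel. *)
Lemma dual_annihilator (k : closedFieldType) (V : vectType k) (U : {vspace 'Hom(V, k^o)}) :
  U != fullv -> exists2 v, v != 0 & forall phi, phi \in U -> phi v = 0.
Proof.
move=> Un; pose m := \dim U; pose X := vbasis U.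
have [|T TE] := @mkhom _ V 'rV[k]_m (fun v => \row_(i < m) (X`_i v)).
  by move=> c u v; apply/rowP => i; rewrite !mxE linearP.
have dV : (\dim {:V} = \dim {: 'Hom(V, k^o)})%N.
  by rewrite !dimvf /dim /= muln1.
have lt : (m < \dim {:V})%N.
  rewrite dV ltnNge; apply: contra Un => le; by rewrite eqEdim subvf.
have kn : (0 < \dim (lker T))%N.
  have := limg_ker_dim T fullv; rewrite capfv => e.
  have le : (\dim (limg T) <= m)%N by apply: leq_trans (dimvS (subvf _)) _; rewrite dimvf /dim /= mul1n.
  rewrite lt0n; apply/negP => /eqP d0; move: e lt; rewrite d0 add0n => <-.
  by rewrite ltnNge le.
exists (vpick (lker T)); first by rewrite vpick0 -dimv_eq0 -lt0n.
move=> phi pU; have := memv_pick (lker T); rewrite memv_ker TE => /eqP T0.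
rewrite (coord_vbasis pU) sum_lfunE; apply: big1 => i _; rewrite scale_lfunE.
by move/rowP/(_ i): T0; rewrite !mxE => ->; rewrite scaler0.
Qed.

(** * The adjoint representation of the even group *)

Section Adjoint.
Variables (k : closedFieldType) (G : supergroup k).
Local Notation L := (Lie G).
Local Notation G0 := (even_group G).
Local Notation O := (Defs.coord G0).
Local Notation tg := (@tangent k G).
Local Notation even u := (u \in homog L false).
Local Notation odd u := (u \in homog L true).
Implicit Types (g h : G0) (a b : O) (X Y : L).

Lemma conj_coord_sum a : exists r : seq (O * O * O), forall g h,
  ev (g * h * g^-1)%g a = \sum_(p <- r) ev g p.1.1 * ev h p.1.2 * ev (g^-1)%g p.2.
Proof.
have [r rE] := coord_comul a.
pose q p := sval (constructive_indefinite_description _ (@coord_comul k G0 p)).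
have qE p : forall g h, ev (g * h)%g p = \sum_(t <- q p) ev g t.1 * ev h t.2 :=
  svalP (constructive_indefinite_description _ (@coord_comul k G0 p)).
exists (flatten [seq [seq (p.1, t.1, t.2) | t <- q p.2] | p <- r]) => g h.
rewrite -mulgA rE big_flatten big_map; apply: eq_bigr => p _.
by rewrite big_map qE mulr_sumr; apply: eq_bigr => t _; rewrite mulrA.
Qed.

Lemma conj_coord_ex g a : exists b, forall h, ev h b = ev (g * h * g^-1)%g a.
Proof.
have [r rE] := conj_coord_sum a; exists (\sum_(p <- r) ((ev g p.1.1 : k) * ev (g^-1)%g p.2) *: p.1.2) => h.
by rewrite ev_sum rE; apply: eq_bigr => p _; rewrite evZ mulrAC.
Qed.

Definition cj g a := sval (constructive_indefinite_description _ (conj_coord_ex g a)).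
Lemma cjE g a h : ev h (cj g a) = ev (g * h * g^-1)%g a.
Proof. exact: (svalP (constructive_indefinite_description _ (conj_coord_ex g a)) h). Qed.

Lemma cj_lin g (c : k) a b : cj g (c *: a + b) = c *: cj g a + cj g b.
Proof. by apply: coord_fun => h; rewrite evD evZ !cjE evD evZ. Qed.

Lemma cj_mul g a b : cj g (a * b) = cj g a * cj g b.
Proof. by apply: coord_fun => h; rewrite evM !cjE evM. Qed.

(** [tg X] composed with conjugation is again a point derivation, hence comes from an even element.
    Outside the even part 0 is a default value. *)
Lemma Ad_ex g X : exists Y, even X -> even Y /\ forall a, tg Y a = tg X (cj g a).
Proof.
have [eX|nX] := boolP (even X); last by exists 0.
pose F (a : O) : k^o := tg X (cj g a).
have linF : linear F by move=> c a b; rewrite /F cj_lin tgD tgZ.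
pose flM := GRing.isLinear.Build _ _ _ _ F linF.
pose fL : {linear O -> k^o} := HB.pack F flM.
have [|Y eY YE] := (let: And5 _ _ _ H _ := tangentP G in H) fL.
  by move=> a b; rewrite /= /F cj_mul tgM // !cjE !mulg1 !mulgV.
by exists Y => _; split=> // a; rewrite -YE.
Qed.

Definition Ad g X := sval (constructive_indefinite_description _ (Ad_ex g X)).
Lemma AdP g X : even X -> even (Ad g X) /\ forall a, tg (Ad g X) a = tg X (cj g a).
Proof. exact: (svalP (constructive_indefinite_description _ (Ad_ex g X))). Qed.

Lemma tg_eq X Y : even X -> even Y -> (forall a, tg X a = tg Y a) -> X = Y.
Proof.
move=> eX eY H; apply/eqP; rewrite -subr_eq0; apply/eqP; apply: tg_inj; first by rewrite rpredB.
by move=> a; rewrite addrC -scaleN1r tg_lin // mulN1r H addNr.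
Qed.

(** Functionals of this form make up a subspace. A vector annihilated by all of them has no odd
    part, since functionals vanishing on the even part qualify, and no even part by injectivity of
    [tg]. *)
Lemma tg_dual (phi : 'Hom(L, k^o)) : exists a, forall X, even X -> phi X = tg X a.
Proof.
have [U UP] : exists U : {vspace 'Hom(L, k^o)}, forall psi, psi \in U <-> exists a, forall X, even X -> psi X = tg X a.
  apply: vspace_of_pred => [|c u v [a Ha] [b Hb]].
    by exists 0 => X _; rewrite zero_lfunE tg0.
  by exists (c *: a + b) => X eX; rewrite add_lfunE scale_lfunE Ha // Hb // tgD tgZ.
suff UT : U == fullv by apply/UP; rewrite (eqP UT) memvf.
apply/negPn/negP => /dual_annihilator [v v0 Hv]; move/eqP: v0; apply.
have [v0 [v1 [e0 o1 vE]]] := parity_split v.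
pose P := daddv_pi (homog L false) (homog L true).
have Pe X : even X -> P X = X by apply: daddv_pi_id; apply: homog_direct.
have Po X : odd X -> P X = 0.
  move=> oX; have := daddv_pi_add (homog_direct L) (w := X); rewrite homog_full memvf => /(_ isT).
  have d : (homog L true :&: homog L false = 0)%VS by rewrite capvC homog_direct.
  by rewrite (daddv_pi_id d oX) -[X in _ = X -> _]add0r => /addIr.
have Hpsi (psi : 'Hom(L, k^o)) : psi v1 = 0.
  have : (psi - (psi \o P)%VF) \in U.
    by apply/UP; exists 0 => X eX; rewrite add_lfunE opp_lfunE comp_lfunE Pe // subrr tg0.
  by move/Hv; rewrite vE add_lfunE opp_lfunE !homD !comp_lfunE Pe // Po // hom0 addr0 addrAC subrr add0r.
have v10 : v1 = 0 by apply: hom_eq => psi; rewrite Hpsi hom0.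
rewrite vE v10 addr0; apply: tg_inj => // a.
have [psi psiE] : exists psi : 'Hom(L, k^o), forall X, psi X = tg (P X) a.
  have [|psi psiE] := @mkhom _ L k^o (fun X => tg (P X) a); last by exists psi.
  by move=> c u w; rewrite linearP tg_lin //; apply: memv_pi.
have /UP/Hv : exists b, forall X, even X -> psi X = tg X b by exists a => X eX; rewrite psiE Pe.
by rewrite vE v10 addr0 psiE Pe.
Qed.

(** Functions are determined by their values, so the two tensors are compared with one variable
    evaluated and the other differentiated, one variable after the other. *)
Lemma tg_conv_indep X Y (r r' : seq (O * O)) : 
  (forall g h, \sum_(p <- r) ev g p.1 * ev h p.2 = \sum_(p <- r') ev g p.1 * ev h p.2) ->
  \sum_(p <- r) tg X p.1 * tg Y p.2 = \sum_(p <- r') tg X p.1 * tg Y p.2.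
Proof.
move=> H.
have e1 h : \sum_(p <- r) (ev h p.2 : k) *: p.1 = \sum_(p <- r') (ev h p.2 : k) *: p.1.
  apply: coord_fun => g; rewrite !ev_sum; have := H g h.
  under eq_bigr do rewrite mulrC; under [X in _ = X -> _]eq_bigr do rewrite mulrC.
  by move=> e; under eq_bigr do rewrite evZ; under [RHS]eq_bigr do rewrite evZ.
have e2 : \sum_(p <- r) (tg X p.1 : k) *: p.2 = \sum_(p <- r') (tg X p.1 : k) *: p.2.
  apply: coord_fun => h; rewrite !ev_sum; have := congr1 (tg X) (e1 h); rewrite !tg_sum.
  under eq_bigr do rewrite tgZ mulrC; under [X in _ = X -> _]eq_bigr do rewrite tgZ mulrC.
  by move=> e; under eq_bigr do rewrite evZ; under [RHS]eq_bigr do rewrite evZ.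
have := congr1 (tg Y) e2; rewrite !tg_sum.
by under eq_bigr do rewrite tgZ; under [X in _ = X -> _]eq_bigr do rewrite tgZ.
Qed.

(** In Sweedler notation, conjugating [a] by [g] gives [a_1(g) a_3(g^-1) a_2], so the coordinate
    function of the orbit is the sum of [tg X a_2] times [a_1 S(a_3)]. Its derivative along [Y],
    with [tg Y (S p) = - tg Y p], is the convolution commutator, that is the bracket of [Y] and
    [X]. *)
Lemma smooth_Ad X : even X -> smooth (fun g => Ad g X) (fun Y => ad L Y X).
Proof.
move=> eX phi; have [a aE] := tg_dual phi.
have [r rE] := coord_comul a.
pose q p := sval (constructive_indefinite_description _ (@coord_comul k G0 p)).
have qE p : forall g h, ev (g * h)%g p = \sum_(t <- q p) ev g t.1 * ev h t.2 :=
  svalP (constructive_indefinite_description _ (@coord_comul k G0 p)).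
pose S p := sval (constructive_indefinite_description _ (@coord_antipode k G0 p)).
have SE p : forall h, ev h (S p) = ev (h^-1)%g p := svalP (constructive_indefinite_description _ (@coord_antipode k G0 p)).
pose A := \sum_(p <- r) \sum_(t <- q p.2) (tg X t.1 : k) *: (p.1 * S t.2).
exists A; split=> [g|Y eY].
  have [eA AE] := AdP g eX; rewrite aE // AE.
  have -> : cj g a = \sum_(p <- r) \sum_(t <- q p.2) ((ev g p.1 : k) * ev (g^-1)%g t.2) *: t.1.
    apply: coord_fun => h; rewrite cjE -mulgA rE ev_sum; apply: eq_bigr => p _.
    rewrite qE ev_sum mulr_sumr; apply: eq_bigr => t _.
    by rewrite evZ mulrA mulrAC.
  rewrite /A ev_sum tg_sum; apply: eq_bigr => p _; rewrite ev_sum tg_sum; apply: eq_bigr => t _.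
  by rewrite evZ evM SE tgZ mulrC.
rewrite aE; last exact: even_even.
have [_ _ _ _ brkE] := tangentP G; rewrite (brkE Y X eY eX a r rE) sumrB.
rewrite /A tg_sum; under [RHS]eq_bigr do rewrite tg_sum.
have S1 p : tg Y (S p) = - tg Y p by apply: (ev_inv (a := p)) => //; apply: SE.
transitivity (\sum_(p <- r) \sum_(t <- q p.2) (tg Y p.1 * (tg X t.1 * ev 1%g t.2) - ev 1%g p.1 * (tg X t.1 * tg Y t.2))); last first.
  apply: eq_bigr => p _; apply: eq_bigr => t _; rewrite tgZ tgM // S1 SE invg1.
  by rewrite mulrDr mulrN mulrN mulrCA [X in _ = _ - X]mulrCA.
under [RHS]eq_bigr do rewrite sumrB; rewrite sumrB; congr (_ - _).
  apply: eq_bigr => p _; rewrite -mulr_sumr; congr (_ * _).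
  have p2E : p.2 = \sum_(t <- q p.2) (ev 1%g t.2 : k) *: t.1.
    by apply: coord_fun => h; rewrite ev_sum -{1}[h]mulg1 qE; apply: eq_bigr => t _; rewrite evZ mulrC.
  by rewrite {1}p2E tg_sum; apply: eq_bigr => t _; rewrite tgZ mulrC.
rewrite (tg_conv_indep X Y (r' := flatten [seq [seq ((ev 1%g p.1 : k) *: t.1, t.2) | t <- q p.2] | p <- r])).
  rewrite big_flatten big_map; apply: eq_bigr => p _; rewrite big_map; apply: eq_bigr => t _ /=.
  by rewrite tgZ mulrA.
move=> g h; rewrite -rE big_flatten big_map -[g]mul1g -mulgA rE; apply: eq_bigr => p _.
rewrite big_map qE mulr_sumr; apply: eq_bigr => t _ /=.
by rewrite evZ mul1g mulrA.
Qed.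

(** Both sides are differentials at the identity of [h |-> rho(g h g^-1) rho(g) v = rho(g) rho(h)
    v]. *)
Lemma Ad_equivariant (V : vectType k) (rho : G0 -> 'End(V)) (act : L -> V -> V) : rational_rep rho ->
  (forall v, smooth (fun g => rho g v) (fun X => act X v)) ->
  forall g X v, even X -> act (Ad g X) (rho g v) = rho g (act X v).
Proof.
move=> [r1 rM _] sm g X v eX; apply: hom_eq => phi.
have [eA AE] := AdP g eX.
have [a [a1 a2]] := sm (rho g v) phi; rewrite a2 // AE.
have [b [b1 b2]] := smooth_lin (rho g) (sm v) phi; rewrite b2 //.
congr (tg X _); apply: coord_fun => h; rewrite b1 cjE a1.
suff -> : rho (g * h * g^-1)%g (rho g v) = rho g (rho h v) by [].
by rewrite -[LHS]comp_lfunE -rM mulgVK rM comp_lfunE.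
Qed.

Lemma Ad_one X : even X -> Ad 1%g X = X.
Proof.
move=> eX; have [eA AE] := AdP 1%g eX; apply: tg_eq => // a; rewrite AE; congr (tg X _).
by apply: coord_fun => h; rewrite cjE mul1g invg1 mulg1.
Qed.

Lemma Ad_mul g h X : even X -> Ad (g * h)%g X = Ad g (Ad h X).
Proof.
move=> eX; have [e1 E1] := AdP (g * h)%g eX; have [e2 E2] := AdP h eX; have [e3 E3] := AdP g e2.
apply: tg_eq => // a; rewrite E1 E3 E2; congr (tg X _).
by apply: coord_fun => l; rewrite !cjE invgM !mulgA.
Qed.

Lemma Ad_lin g (c : k) X Y : even X -> even Y -> Ad g (c *: X + Y) = c *: Ad g X + Ad g Y.
Proof.
move=> eX eY; have eXY : even (c *: X + Y) by rewrite rpredD ?rpredZ.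
have [e1 E1] := AdP g eXY; have [e2 E2] := AdP g eX; have [e3 E3] := AdP g eY.
by apply: tg_eq => // [|a]; rewrite ?rpredD ?rpredZ // tg_lin // E1 E2 E3 tg_lin.
Qed.

(** [Ad] on the even part is glued to the given representation on the odd part. Compatibility with
    the bracket is obtained for an even first argument, from [Ad_equivariant]. *)
Lemma adjoint_rep : exists rho : G0 -> 'End(L), [/\ rational_rep rho,
  forall v, smooth (fun g => rho g v) (fun X => ad L X v),
  forall g p v, v \in homog L p -> rho g v \in homog L p &
  forall g X v, even X -> rho g (ad L X v) = ad L (rho g X) (rho g v)].
Proof.
have [rho1 rat1 diff1] := ad_odd_integrates G; have sm1 := smooth_rep rat1 diff1.
have [r1 rM _] := rat1.
pose P0 := daddv_pi (homog L false) (homog L true); pose P1 := daddv_pi (homog L true) (homog L false).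
have dc : (homog L true :&: homog L false = 0)%VS by rewrite capvC homog_direct.
have P01 v : P0 v + P1 v = v by apply: (daddv_pi_add (homog_direct L)); rewrite homog_full memvf.
have P0e v : even (P0 v) := memv_pi _ _ _.
have P1o v : odd (P1 v) := memv_pi _ _ _.
have P0i v : even v -> P0 v = v by apply: daddv_pi_id; apply: homog_direct.
have P1i v : odd v -> P1 v = v by apply: daddv_pi_id.
have P0z v : odd v -> P0 v = 0 by move=> ov; have := P01 v; rewrite (P1i v ov) -[X in _ = X -> _]add0r => /addIr.
have P1z v : even v -> P1 v = 0 by move=> ev'; have := P01 v; rewrite (P0i v ev') -[X in _ = X -> _]addr0 => /addrI.
have rex g : {f : 'End(L) | forall v, f v = Ad g (P0 v) + vsval (rho1 g (vsproj (homog L true) (P1 v)))}.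
  apply: mkhom => c u v; rewrite !linearP (Ad_lin _ _ (P0e u) (P0e v)); by vring.
pose rho g := sval (rex g); have rhoE g v := svalP (rex g) v; rewrite -/(rho _) in rhoE.
have rho_e g v : even v -> rho g v = Ad g v.
  by move=> ev'; rewrite rhoE P0i // P1z // !linear0 addr0.
have rho_o g v : odd v -> rho g v = vsval (rho1 g (vsproj (homog L true) v)).
  move=> ov; rewrite rhoE P0z // P1i // (_ : Ad g 0 = 0) ?add0r //.
  by have := Ad_lin g (-1) (mem0v _) (mem0v _); rewrite scaler0 addr0 scaleN1r addNr.
have par g p v : v \in homog L p -> rho g v \in homog L p.
  case: p => vp; first by rewrite rho_o //; apply: subvsP.
  by rewrite rho_e //; case: (AdP g vp).
have sm v : smooth (fun g => rho g v) (fun X => ad L X v).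
  have [incl inclE] : exists f : 'Hom(subvs_of (homog L true), L), forall w, f w = vsval w.
    by have [|f fE] := @mkhom k (subvs_of (homog L true)) L vsval; [move=> c u w; exact: linearP|exists f].
  apply: (smooth_ext (smoothD (smooth_Ad (P0e v)) (smooth_lin incl (sm1 (vsproj (homog L true) (P1 v)))))).
    by move=> g; rewrite inclE -rhoE.
  move=> X eX; rewrite inclE /brk [vsval (vsproj _ (P1 v))]vsprojK ?P1o //.
  by rewrite vsprojK ?even_odd // -homD P01.
have rat : rational_rep rho.
  split=> [|g h|phi v]; last by have [a [a1 _]] := sm v phi; exists a.
    apply/lfunP => v; rewrite id_lfunE rhoE Ad_one // r1 id_lfunE vsprojK //.
  apply/lfunP => v; rewrite comp_lfunE -{1 2}(P01 v) !homD !(rho_e _ (P0 v)) // !(rho_o _ (P1 v)) //.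
  rewrite rho_e; last by case: (AdP h (P0e v)).
  by rewrite rho_o ?subvsP // vsvalK Ad_mul // rM comp_lfunE.
exists rho; split=> // g X v eX; rewrite (rho_e _ _ eX).
by rewrite (Ad_equivariant rat sm).
Qed.

End Adjoint.

(** * Invariant complements from reductivity *)

Section Complements.
Variables (k : closedFieldType) (G : supergroup k).
Hypothesis qr : quasi_reductive G.
Local Notation L := (Lie G).
Local Notation G0 := (even_group G).
Local Notation even u := (u \in homog L false).

Lemma invariant_complement (V : vectType k) (rho : G0 -> 'End(V)) (act : L -> V -> V) (U : {vspace V}) :
  rational_rep rho -> (forall v, smooth (fun g => rho g v) (fun X => act X v)) ->
  (forall g v, v \in U -> rho g v \in U) ->
  (forall X v, even X -> v \in U -> act X v \in U) /\
  exists W : {vspace V}, [/\ forall g v, v \in W -> rho g v \in W,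
    forall X v, even X -> v \in W -> act X v \in W, (U + W = fullv)%VS & (U :&: W = 0)%VS].
Proof.
move=> rat sm sU; split=> [X v eX vU|].
  by apply: (smooth_mem (sm v)) => // g; apply: sU.
have [|W [sW UW UW0]] := qr rat (U := U); first by move=> g; apply/stabP => v; apply: sU.
have sW' g v : v \in W -> rho g v \in W by move=> vW; have /stabP := sW g; apply.
exists W; split=> // X v eX vW.
by apply: (smooth_mem (sm v)) => // g; apply: sW'.
Qed.

Lemma conj_rep (V : vectType k) (rho : G0 -> 'End(V)) (act : L -> 'End(V)) : rational_rep rho ->
  (forall v, smooth (fun g => rho g v) (fun X => act X v)) ->
  exists cr : G0 -> 'End('End(V)), [/\ rational_rep cr,
    forall g T, cr g T = rho g * T * rho (g^-1)%g &
    forall T, smooth (fun g => cr g T) (fun X => act X * T - T * act X)].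
Proof.
move=> [r1 rM rc] sm.
have cex g : {f : 'End('End(V)) | forall T, f T = rho g * T * rho (g^-1)%g}.
  by apply: mkhom => c T T'; rewrite mulrDr mulrDl mulEZr mulEZl.
pose cr g := sval (cex g); have crE g T : cr g T = rho g * T * rho (g^-1)%g := svalP (cex g) T.
have smE : smooth rho act by apply: smooth_end.
have smI : smooth (fun g => rho (g^-1)%g) (fun X => - act X).
  move=> phi; have [a [a1 a2]] := smE phi; have [b bE] := coord_antipode a.
  exists b; split=> [g|X eX]; first by rewrite bE a1.
  by rewrite homN a2 // (ev_inv bE).
have rho1 : rho 1%g = 1 by [].
have smC T : smooth (fun g => cr g T) (fun X => act X * T - T * act X).
  have mul (A : 'End(V)) : {f : 'Hom('End(V), 'End(V)) | forall B, f B = A * T * B}.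
    by apply: mkhom => c B B'; rewrite mulrDr mulEZr.
  pose be A := sval (mul A); have beE A B : be A B = A * T * B := svalP (mul A) B.
  have bl c u v w : be (c *: u + v) w = c *: be u w + be v w.
    by rewrite !beE !mulrDl !mulEZl.
  apply: (smooth_ext (smooth_bilin bl smE smI)) => [g|X eX]; first by rewrite beE crE.
  by rewrite !beE invg1 rho1 mulr1 mul1r mulrN.
exists cr; split=> //; split=> [|g h|phi T]; last by have [a [a1 _]] := smC T phi; exists a.
  by apply/lfunP => T; rewrite id_lfunE crE invg1 rho1 mul1r mulr1.
have rM' g' h' : rho (g' * h')%g = rho g' * rho h' := rM g' h'.
by apply/lfunP => T; rewrite comp_lfunE !crE invgM !rM' !mulrA.
Qed.

End Complements.

(** * Triples through a nilpotent endomorphism *)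

Section NilpotentTriple.
Variables (k : closedFieldType) (V : vectType k).

Lemma linear_extension (I : eqType) (s : seq I) (x y : I -> V) : basis_of {:V} (map x s) ->
  exists f : 'End(V), forall i, i \in s -> f (x i) = y i.
Proof.
move=> bs; have fr := basis_free bs; set X := map x s in bs fr.
have sz : size X = size s by rewrite size_map.
have [|f fE] := @mkhom _ V V (fun v => \sum_(j < size X) vector.coord (in_tuple X) j v *: (map y s)`_j).
  move=> c u v; rewrite scaler_sumr -big_split; apply: eq_bigr => j _.
  by rewrite linearP scalerDl scalerA.
exists f => i iS; rewrite fE.
have lt : (index i s < size X)%N by rewrite sz index_mem.
have xi : x i = X`_(Ordinal lt) by rewrite /= (nth_map i) ?index_mem // nth_index.
have cf j : vector.coord (in_tuple X) j X`_(Ordinal lt) = (Ordinal lt == j)%:R.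
  exact: (@coord_free _ _ _ (in_tuple X) (Ordinal lt) j fr).
rewrite xi (bigD1 (Ordinal lt)) //= cf eqxx scale1r big1 ?addr0 => [|j nj].
  by rewrite (nth_map i) ?index_mem // nth_index.
by rewrite cf eq_sym (negPf nj) scale0r.
Qed.

(** On a Jordan chain of length [n], [F] sends the [j]-th vector to [j(n-j)] times the previous one,
    which forces [H] to act on it by [2j - n + 1]. *)
Lemma nilp_triple (E : 'End(V)) : nilp E -> exists H F : 'End(V),
  H * E - E * H = 2%:R *: E /\ E * F - F * E = H.
Proof.
move=> [N EN]; have [|||sz [c [_ Hc bc]] _] := @jordan_chains k V E fullv predT.
- by move=> v _; rewrite memvf.
- by exists N => u _; rewrite -exprE EN zero_lfunE.
- by [].
pose I := flatten [seq [seq (p, j) | j <- iota 0 p.2] | p <- c].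
pose x (i : V * nat * nat) := iter i.2 E i.1.1.
pose y (i : V * nat * nat) := (i.2%:R * (i.1.2%:R - i.2%:R) : k) *: iter i.2.-1 E i.1.1.
have xI : map x I = flatten [seq [seq iter j E p.1 | j <- iota 0 p.2] | p <- c].
  rewrite /I map_flatten -map_comp; congr flatten; apply: eq_map => p /=.
  by rewrite -map_comp.
have bx : basis_of {:V} (map x I) by rewrite xI.
have memI p j : p \in c -> (j < p.2)%N -> (p, j) \in I.
  move=> pc jp; apply/flattenP; exists [seq (p, l) | l <- iota 0 p.2]; first exact: map_f.
  by apply: map_f; rewrite mem_iota.
have [F FE] := linear_extension y bx.
have FEj v n j : (v, n) \in c -> (j < n)%N ->
    F (iter j E v) = (j%:R * (n%:R - j%:R)) *: iter j.-1 E v.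
  by move=> vc jn; have := FE _ (memI _ _ vc jn).
have onI (f g : 'End(V)) : (forall v n j, (v, n) \in c -> (j < n)%N -> f (iter j E v) = g (iter j E v)) -> f = g.
  move=> H; apply: (eq_on_basis bx) => _ /mapP [i /flattenP [s /mapP [[v n] pc ->] /mapP [j jI ->]] ->].
  by apply: H pc _; move: jI; rewrite mem_iota.
have top v n : (v, n) \in c -> iter n E v = 0 by move=> /Hc [].
have [H HD] : exists H, H = E * F - F * E by eexists.
have HE v n j : (v, n) \in c -> (j < n)%N -> H (iter j E v) = (j%:R + j%:R - n%:R + 1) *: iter j E v.
  move=> vc jn; rewrite HD !endE (FEj v n) // homZ -iterS.
  have -> : F (E (iter j E v)) = ((j%:R + 1) * (n%:R - (j%:R + 1))) *: iter j E v.
    rewrite -iterS natr1; move: jn; rewrite leq_eqVlt => /orP [/eqP jn|jn].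
      by rewrite jn top // hom0 subrr mulr0 scale0r.
    by rewrite (FEj v n).
  case: j {jn} => [|j] /=; first by vring.
  by vring.
exists H, F; split=> //; apply: onI => v n j vc jn; rewrite !endE (HE v n) // homZ -iterS.
move: jn; rewrite leq_eqVlt => /orP [/eqP jn|jn]; first by rewrite jn top // hom0 !scaler0 subrr.
by rewrite (HE v n) // -natr1; vring.
Qed.

End NilpotentTriple.

(** * Correcting the lowering element of a triple *)

Section CompleteTriple.
Variables (k : closedFieldType) (L : lieSuperalgebra k).
Hypothesis char0 : [pchar k] =i pred0.
Local Notation even u := (u \in homog L false).

(** The defect [m] of the last relation is killed by [e], so its [h]-weights are natural numbers and
    [ad h + 2] can be inverted on it without leaving [A] or the kernel of [ad e]. *)
Lemma complete_triple (e h f : L) (A : {vspace L}) : even e -> even h -> even f -> (A <= homog L false)%VS ->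
  ad L h e = 2%:R *: e -> ad L e f = h -> ad L h f + 2%:R *: f \in A -> stab (ad L h) A ->
  exists2 w, w \in A & triple e h (f - w).
Proof.
move=> ee eh ef Aev he ef_h; set m := _ + _ => mA sA.
have HE : ad L h * ad L e - ad L e * ad L h = 2%:R *: ad L e by rewrite ad_comm // he linearZ.
have EF : ad L e * ad L f - ad L f * ad L e = ad L h by rewrite ad_comm // ef_h.
have em : ad L e m = 0.
  rewrite /m homD homZ jac_even // ef_h (anti_even h ee) he even_self // addr0 adN adZ ef_h.
  by vring.
have [|s' [mS Hs]] := sl2_ker_hge char0 HE EF (shift_nilp char0 HE (natf_neq0 char0 1)) sA mA (i := 0) (w := m) _ em.
  by rewrite expr0 oneE.
pose w := \sum_(y <- s') (y.1 + 2)%:R^-1 *: y.2.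
have n2 y : ((y + 2)%:R : k) != 0 by rewrite addn2; apply: natf_neq0.
have cw : ad L h w + 2%:R *: w = m.
  rewrite mS linear_sum scaler_sumr -big_split big_seq [RHS]big_seq /=; apply: eq_bigr => y /Hs [e' _ _ _] /=.
  rewrite homZ e' scalerA scalerA -scalerDl (_ : _ + _ = 1) ?scale1r //.
  by rewrite [_ * y.1%:R]mulrC -mulrDl -natrD mulfV.
have wA : w \in A by rewrite /w big_seq; apply: rpred_sum => y /Hs [_ _ yA _]; apply: rpredZ.
have ew : ad L e w = 0.
  by rewrite linear_sum big_seq; apply: big1 => y /Hs [_ _ _ e'] /=; rewrite homZ e' scaler0.
exists w => //; split=> //; first by rewrite rpredB // (subvP Aev).
split=> //; first by rewrite homD homN ew subr0.
rewrite homD homN (_ : ad L h f = m - 2%:R *: f); last by rewrite /m addrK.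
by rewrite -cw; vring.
Qed.

End CompleteTriple.

(** * Jordan decomposition and Jacobson-Morozov in the even part *)

Section ReductiveLie.
Variables (k : closedFieldType) (G : supergroup k).
Hypothesis char0 : [pchar k] =i pred0.
Hypothesis qr : quasi_reductive G.
Local Notation L := (Lie G).
Local Notation even u := (u \in homog L false).
Implicit Types (X Y a b d v w : L).

Lemma derived_exists : exists D : {vspace L}, forall v, v \in D <-> in_derived_even v.
Proof.
apply: vspace_of_pred => [|c u v [r Hr ->] [t Ht ->]]; first by exists [::]; rewrite ?big_nil.
exists ([seq (c *: p.1, p.2) | p <- r] ++ t) => [p|].
  by rewrite mem_cat => /orP [/mapP [q /Hr [e1 e2] ->]|/Ht //]; split=> //=; apply: rpredZ.
rewrite big_cat big_map /=; congr (_ + _); rewrite scaler_sumr; apply: eq_bigr => p _.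
by rewrite /brk adZ.
Qed.

Definition derived := sval (constructive_indefinite_description _ derived_exists).
Lemma derivedP v : v \in derived <-> in_derived_even v.
Proof. exact: (svalP (constructive_indefinite_description _ derived_exists) v). Qed.

Lemma derived_brk X Y : even X -> even Y -> ad L X Y \in derived.
Proof.
move=> eX eY; apply/derivedP; exists [:: (X, Y)]; last by rewrite big_seq1.
by move=> p; rewrite inE => /eqP ->.
Qed.

Lemma derived_even v : v \in derived -> even v.
Proof.
by move=> /derivedP [r Hr ->]; rewrite big_seq; apply: rpred_sum => p /Hr [e1 e2]; apply: even_even.
Qed.

Lemma derived_stab X : even X -> stab (ad L X) derived.
Proof. by move=> eX v /derived_even ev'; apply: derived_brk. Qed.

Lemma derived_Ad (rho : even_group G -> 'End(L)) g v :
  (forall g p v, v \in homog L p -> rho g v \in homog L p) ->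
  (forall g X v, even X -> rho g (ad L X v) = ad L (rho g X) (rho g v)) ->
  v \in derived -> rho g v \in derived.
Proof.
move=> par equi /derivedP [r Hr ->]; rewrite linear_sum big_seq; apply: rpred_sum => p /Hr [e1 e2] /=.
by rewrite equi //; apply: derived_brk; apply: par.
Qed.

(** A complement of the derived algebra, stable under the even group, is carried by even brackets
    both into itself and into the derived algebra, hence to zero. *)
Lemma center_split v : even v -> exists d w, [/\ d \in derived, even w, forall X, even X -> ad L X w = 0 & v = d + w].
Proof.
have [rho [rat sm par equi]] := adjoint_rep G; move=> ev'.
have [_ [W [_ sW DW DW0]]] := invariant_complement qr (U := derived) rat sm
  (fun g v => derived_Ad g par equi).
have : v \in (derived + W)%VS by rewrite DW memvf.
move=> /memv_addP [d dD [w wW vE]]; exists d, w; split=> //.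
  by rewrite -[w](addKr d) -vE rpredD // rpredN derived_even.
have ew : even w by rewrite -[w](addKr d) -vE rpredD // rpredN derived_even.
move=> X eX; apply/eqP; rewrite -memv0 -DW0 memv_cap derived_brk //=; exact: sW.
Qed.

(** Complete reducibility of the conjugation action on End(L) gives an equivariant projection onto
    the adjoint operators of derived elements. It turns solutions of equations in End(L) into
    elements of the Lie algebra. *)
Lemma derived_projection : exists p : 'End('End(L)),
  [/\ forall T, exists2 d, d \in derived & p T = ad L d,
      forall d, d \in derived -> p (ad L d) = ad L d &
      forall X T, even X -> p (ad L X * T - T * ad L X) = ad L X * p T - p T * ad L X].
Proof.
have [rho [rat sm par equi]] := adjoint_rep G; have [cr [crat crE crsm]] := conj_rep rat sm.
have [U UP] : exists U : {vspace 'End(L)}, forall T, T \in U <-> exists2 d, d \in derived & T = ad L d.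
  apply: vspace_of_pred => [|c _ _ [d dD ->] [d' d'D ->]]; first by exists 0; rewrite ?mem0v // linear0.
  by exists (c *: d + d'); rewrite ?rpredD ?rpredZ // linearP.
have [r1 rM _] := rat.
have sU g T : T \in U -> cr g T \in U.
  move=> /UP [d dD ->]; apply/UP; exists (rho g d); first exact: derived_Ad.
  rewrite crE; apply/lfunP => v; rewrite !mulE equi ?derived_even //.
  by rewrite -[rho g (rho _ v)]comp_lfunE -rM mulgV r1 id_lfunE.
have [actU [W [_ sW UW UW0]]] := invariant_complement qr crat crsm sU.
pose p := daddv_pi U W; exists p.
have pU T : p T \in U by apply: memv_pi.
have pid T : T \in U -> p T = T by apply: daddv_pi_id.
have WU0 : (W :&: U = 0)%VS by rewrite capvC.
have pW T : T \in W -> p T = 0.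
  move=> TW; have := daddv_pi_add UW0 (w := T); rewrite UW memvf => /(_ isT).
  by rewrite (daddv_pi_id WU0 TW) -[X in _ = X -> _]add0r => /addIr.
split=> [T|d dD|X T eX]; first exact/UP.
  by apply: pid; apply/UP; exists d.
pose q := daddv_pi W U; have Tq : T = p T + q T by rewrite (daddv_pi_add UW0) // UW memvf.
have qW : q T \in W by apply: memv_pi.
have e1 : ad L X * T - T * ad L X = (ad L X * p T - p T * ad L X) + (ad L X * q T - q T * ad L X).
  by rewrite {1 2}Tq mulrDr mulrDl opprD addrACA.
by rewrite e1 homD (pid _ (actU X _ eX (pU T))) (pW _ (sW X _ eX qW)) addr0.
Qed.

Definition commutant (c : 'End(L)) := [/\ nilp c, forall X, even X -> ad L X * c = c * ad L X &
  forall A : {vspace L}, (forall X, even X -> stab (ad L X) A) -> stab c A].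

(** The common kernel [K] of all these operators is stable under the group and has an invariant
    complement. On a minimal stable subspace [B] of the complement each of them, being nilpotent and
    commuting with the action, has a nonzero stable kernel, hence vanishes; so [B] lies in [K], a
    contradiction. *)
Lemma commutant0 c : commutant c -> c = 0.
Proof.
have [rho [rat sm par equi]] := adjoint_rep G; have [r1 rM _] := rat.
have rK g v : rho g (rho (g^-1)%g v) = v by rewrite -comp_lfunE -rM mulgV r1 id_lfunE.
have rVK g v : rho (g^-1)%g (rho g v) = v by rewrite -comp_lfunE -rM mulVg r1 id_lfunE.
have [K KP] : exists K : {vspace L}, forall v, v \in K <-> forall c, commutant c -> c v = 0.
  apply: vspace_of_pred => [c' _|r u v Hu Hv c' Hc]; first by rewrite hom0.
  by rewrite homD homZ Hu // Hv // scaler0 addr0.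
have conjC g c' : commutant c' -> commutant (rho (g^-1)%g * c' * rho g).
  move=> [nc cc pc]; split.
  - have [n cn] := nc; exists n.
    have -> : (rho (g^-1)%g * c' * rho g) ^+ n = rho (g^-1)%g * c' ^+ n * rho g.
      elim: n {cn} => [|n IH]; first by apply/lfunP => v; rewrite !expr0 mulr1 mulE rVK oneE.
      by apply/lfunP => v; rewrite !exprS IH !mulE rK.
    by rewrite cn mulr0 mul0r.
  - move=> X eX; apply/lfunP => v; rewrite !mulE equi //.
    have /lfunP/(_ (rho g v)) := cc _ (par g _ _ eX); rewrite !mulE => <-.
    by rewrite (equi (g^-1)%g) ?par // rVK.
  move=> A sA v vA; rewrite !mulE.
  have [B HB] : exists B : {vspace L}, forall v, v \in B <-> rho (g^-1)%g v \in A.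
    by apply: vspace_of_pred => [|r u w Hu Hw]; rewrite ?hom0 ?mem0v // homD homZ rpredD ?rpredZ.
  apply/HB; apply: (pc B); last by apply/HB; rewrite rVK.
  move=> X eX w /HB wB; apply/HB; rewrite equi //; apply: sA => //; exact: par.
have sK g v : v \in K -> rho g v \in K.
  move=> /KP vK; apply/KP => c' /(conjC g) /vK; rewrite !mulE => e1.
  by rewrite -[LHS](rK g) e1 hom0.
have [_ [W [_ sW KW KW0]]] := invariant_complement qr rat sm sK.
have [W0|W0] := eqVneq W 0%VS.
  by move=> Hc; apply/lfunP => v; rewrite zero_lfunE; apply: (KP v).1 => //; rewrite -[K]addv0 -W0 KW memvf.
have minA n : forall A : {vspace L}, (\dim A <= n)%N -> A != 0%VS -> (A <= W)%VS -> (forall X, even X -> stab (ad L X) A) ->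
    exists B : {vspace L}, [/\ B != 0%VS, (B <= W)%VS, forall X, even X -> stab (ad L X) B &
      forall B' : {vspace L}, (B' <= B)%VS -> B' != 0%VS -> (forall X, even X -> stab (ad L X) B') -> B' = B].
  elim: n => [|n IH] A dA A0 AW sA.
    by move: A0; rewrite -dimv_eq0 -leqn0 dA.
  have [[B [BA B0 sB nB]]|H] := classic (exists B : {vspace L}, [/\ (B <= A)%VS, B != 0%VS, forall X, even X -> stab (ad L X) B & B != A]).
    apply: (IH B) => //; last exact: subv_trans AW.
    rewrite -ltnS; apply: leq_trans dA; rewrite ltnNge; apply: contra nB => le; by rewrite eqEdim BA.
  exists A; split=> // B BA B0 sB; apply/eqP/negPn/negP => nB; by apply: H; exists B.
have [|B [B0 BW sB Bmin]] := minA _ W (leqnn _) W0 (subvv W); first by move=> X eX v vW; apply: sW.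
have BK : (B <= K)%VS.
  apply/subvP => v vB; apply/KP => c' [nc cc pc].
  have sBc := pc B sB.
  have [w wB w0] : exists2 w, w \in B & w \notin 0%VS.
    by exists (vpick B); rewrite ?memv_pick // memv0 vpick0.
  have [m [nz]] := nilp_leave nc w0; rewrite memv0 => /eqP z.
  have uB : iter m c' w \in B by rewrite -exprE; apply: stabX.
  have cu : c' (iter m c' w) = 0 by [].
  have e1 : (B :&: lker c')%VS = B.
    apply: Bmin; first exact: capvSl.
      apply/eqP => e; move: nz; rewrite memv0 => /eqP; apply; apply/eqP; rewrite -memv0 -e.
      by rewrite memv_cap uB memv_ker cu eqxx.
    move=> X eX u; rewrite !memv_cap !memv_ker => /andP [uB' /eqP c'u].
    by rewrite (sB X eX) //= -mulE -cc // mulE c'u hom0.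
  by move: vB; rewrite -e1 memv_cap memv_ker => /andP [_ /eqP].
move/eqP: B0; case; apply/eqP; rewrite -subv0 -KW0 subv_cap BK.
by [].
Qed.

Lemma trace_derived d (P : 'End(L)) : d \in derived -> (forall X, even X -> ad L X * P = P * ad L X) ->
  tr (ad L d * P) = 0.
Proof.
move=> /derivedP [r Hr ->] cP; rewrite linear_sum mulr_suml tr_sum big_seq; apply: big1 => p /Hr [e1 e2] /=.
rewrite -ad_comm // mulrBl trD trN -mulrA cP // mulrA trM mulrA subrr.
by [].
Qed.

(** The semisimple part [sg] of [ad a] is a derivation and a polynomial in [ad a]. After removal of
    the central part, the equivariant projection compares it with some [ad w]; the difference [c0]
    satisfies the three conditions of [commutant], so it is zero and [sg] is inner. *)
Lemma semisimple_part a : even a -> exists (p : {poly k}) b, [/\ p`_0 = 0, even b, ad L b = pact (ad L a) p, diagz (ad L b) &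
  nilp (ad L a - ad L b) /\ a - b \in derived].
Proof.
move=> ea; have [p [p0 ds ns Hp]] := jordan_chevalley (ad L a); set sg := pact (ad L a) p in ds ns Hp.
have [a' [aW [a'D eaW aWc aE]]] := center_split ea.
have [pr [prD prid preq]] := derived_projection.
have [w wD prw] := prD (sg - ad L aW); have ew := derived_even wD.
have sgX X : even X -> sg X \in derived.
  move=> eX; apply: pact_into => //; [exact: derived_stab|exact: derived_brk].
have der := replica_derivation (t := id) ea Hp (fun r s u v w _ _ _ _ _ _ => erefl).
pose c0 := sg - ad L aW - ad L w.
have comm X : even X -> ad L X * c0 = c0 * ad L X.
  move=> eX.
  have e1 : ad L X * (sg - ad L aW) - (sg - ad L aW) * ad L X = ad L (- sg X).
    have z : ad L X * ad L aW = ad L aW * ad L X by apply/eqP; rewrite -subr_eq0 ad_comm // aWc // linear0.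
    apply/lfunP => v; rewrite mulrBr mulrBl z !endE der adN; vring.
  have e2 : ad L X * ad L w - ad L w * ad L X = ad L (- sg X).
    by rewrite -prw -preq // e1 prid // rpredN sgX.
  apply/eqP; rewrite -subr_eq0 /c0 mulrBr mulrBl -[X in X == 0]addr0.
  have -> : ad L X * (sg - ad L aW) - ad L X * ad L w - ((sg - ad L aW) * ad L X - ad L w * ad L X) =
     (ad L X * (sg - ad L aW) - (sg - ad L aW) * ad L X) - (ad L X * ad L w - ad L w * ad L X) by vring.
  by rewrite e1 e2 subrr addr0.
have c0pres (A : {vspace L}) : (forall X, even X -> stab (ad L X) A) -> stab c0 A.
  move=> sA; apply: stabD; last by apply/stabN/sA.
  by apply: stabD; [apply/pact_stab/sA|apply/stabN/sA].
(* On the spectral projection [pi] for [r] the trace of [c0] is [r] times the rank of [pi]. It is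
   also zero: [c0] is the adjoint of a derived element minus a nilpotent operator commuting with
   [pi]. *)
have c0nil : nilp c0.
  have [rs [P [_ vE Pg Pid]]] := geigen_decomp c0.
  have zero r : r \in rs -> r != 0 -> pact c0 (P r) = 0.
    move=> rr r0; set pi := pact c0 (P r).
    have pic X : even X -> ad L X * pi = pi * ad L X.
      by move=> eX; rewrite /pi (pact_comm_with (P r) (esym (comm X eX))).
    have pipi : pi * pi = pi.
      by apply/lfunP => v; rewrite mulE; have := Pid r (pi v) (Pg r v rr); rewrite rr.
    have piX m : pi ^+ m.+1 = pi by elim: m => [|m IH]; rewrite ?expr1 // exprS IH.
    have pic0 : pi * c0 = c0 * pi by apply: pact_comm_with.
    pose N := (c0 - r *: (1 : 'End(L))) * pi.
    have Nn : nilp N.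
      apply: nilpP => v; have [M HM] := Pg r v rr; exists M.+1; rewrite -exprE /N exprMn_comm; last first.
        by rewrite /GRing.comm mulrBl mulrBr pic0 mulEZl mulEZr mul1r mulr1.
      by rewrite piX mulE exprS mulE -shift_powE HM hom0.
    have [m [trm m0]] := idem_tr pipi.
    have e1 : tr (c0 * pi) = r * m%:R.
      have : tr N = 0 by apply: nilp_tr.
      by rewrite /N mulrBl trD trN mulEZl mul1r trZ trm => /eqP; rewrite subr_eq0 => /eqP.
    have e2 : tr (c0 * pi) = 0.
      have z1 : tr ((ad L a - sg) * pi) = 0.
        apply: nilp_tr; apply: nilpM => //; rewrite mulrBl mulrBr pic //; congr (_ - _).
        by apply: pact_comm_with; apply: pic.
      have z2 : tr (ad L (a' - w) * pi) = 0 by apply: trace_derived => //; rewrite rpredB.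
      have adE2 : ad L (a' - w) = ad L a - ad L aW - ad L w by rewrite aE !linearB linearD /= addrK.
      have -> : c0 * pi = ad L (a' - w) * pi - (ad L a - sg) * pi.
        by rewrite -mulrBl adE2 /c0; congr (_ * _); vring.
      by rewrite trD trN z1 z2 subr0.
    apply: m0; move/eqP: e1; rewrite e2 eq_sym mulf_eq0 (negPf r0) /= => /eqP e3.
    by apply: (natf_inj char0); rewrite e3.
  apply: nilpP => v; have [r0|r0] := boolP (0 \in rs); last first.
    exists 0; rewrite /= (vE v) big_seq; apply: big1 => r rr; rewrite zero // ?zero_lfunE //.
    by apply: contraNneq r0 => <-.
  have e : geigen c0 0 v.
    rewrite [v]vE; have [M HM] := Pg 0 v r0; exists M; rewrite linear_sum big_seq; apply: big1 => r rr /=.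
    by have [->//|nr] := eqVneq r 0; rewrite zero // zero_lfunE hom0.
  by have [M] := e; rewrite shift_powE scale0r subr0 => HM; exists M; rewrite -exprE.
have c00 : c0 = 0 by apply: commutant0; split.
have sgE : sg = ad L (aW + w).
  by rewrite linearD /=; apply/eqP; rewrite -subr_eq0 opprD addrA -/c0 c00.
exists p, (aW + w); split=> //; first by rewrite rpredD.
  by rewrite -sgE.
split; first by rewrite -sgE.
have -> : a - (aW + w) = a' - w by rewrite aE; vring.
by rewrite rpredB.
Qed.

Lemma reductive_jordan : jordan_closed L.
Proof.
by move=> a /semisimple_part [p [b [p0 eb bE db [nb _]]]]; exists p, b.
Qed.

(** A triple for [ad e0] is found in End(L) and projected equivariantly to adjoints of derived
    elements; the resulting relations hold modulo elements acting by zero and are then made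
    exact. *)
Lemma jacobson_morozov a : even a -> exists s e h f (p : {poly k}), [/\ a = s + e, even s /\ diagz (ad L s),
  p`_0 = 0 /\ ad L s = pact (ad L a) p, triple e h f & [/\ ad L s e = 0, ad L s h = 0 & ad L s f = 0]].
Proof.
move=> ea; have [p [b [p0 eb bE db [nb abD]]]] := semisimple_part ea.
pose e0 := a - b; have ee0 : even e0 by rewrite rpredB.
have ade0 : ad L e0 = ad L a - ad L b by rewrite linearB.
have [|H' [F' [HE EF]]] := nilp_triple (E := ad L e0); first by rewrite ade0.
have [pr [prD prid preq]] := derived_projection.
have [h0 h0D prh] := prD H'; have [f0 f0D prf] := prD F'.
have ef0 := derived_even f0D.
pose h1 := ad L e0 f0; have eh1 : even h1 by apply: even_even.
have adh1 : ad L h1 = ad L h0.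
  by rewrite /h1 -ad_comm // -prf -preq // EF prh.
have h1e : ad L (ad L h1 e0) = 2%:R *: ad L e0.
  rewrite -ad_comm // adh1; have := preq e0 H' ee0; rewrite prh => e1.
  have e2 : ad L e0 * H' - H' * ad L e0 = - (2%:R *: ad L e0) by rewrite -HE opprB.
  by rewrite -[LHS]opprB -e1 e2 homN homZ prid // opprK.
(* [ze] acts by zero. Moving half of it from the semisimple to the nilpotent part makes [[h1, e] =
   2e] exact and changes no adjoint operator. *)
pose ze := ad L h1 e0 - 2%:R *: e0.
have eze : even ze by rewrite rpredB ?rpredZ //; apply: even_even.
have adze : ad L ze = 0 by rewrite linearB linearZ /= h1e subrr.
have ze0 v : ad L ze v = 0 by rewrite adze zero_lfunE.
have two0 : (2%:R : k) != 0 := natf_neq0 char0 1.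
pose e := e0 + 2%:R^-1 *: ze; pose s := b - 2%:R^-1 *: ze.
have ads : ad L s = ad L b by rewrite linearB linearZ /= adze scaler0 subr0.
have ade : ad L e = ad L e0 by rewrite linearD linearZ /= adze scaler0 addr0.
have ee : even e by rewrite rpredD ?rpredZ.
have es : even s by rewrite rpredB ?rpredZ.
have vze v : even v -> ad L v ze = 0 by move=> ev'; rewrite (anti_even' v eze) ze0 oppr0.
have h1e' : ad L h1 e = 2%:R *: e.
  rewrite /e homD homZ vze // scaler0 addr0 scalerDr scalerA mulfV // scale1r /ze.
  by rewrite addrC subrK.
have se : ad L s e = 0.
  rewrite ads /e homD homZ vze // scaler0 addr0 /e0 homD homN even_self // subr0.
  by rewrite bE (pact_kill p0) // even_self.
have ds : diagz (ad L s) by rewrite ads.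
(* Projecting [h1] and [f0] to the kernel of [ad s] makes them commute with [s]; the projection
   commutes with [ad e] because [[s, e] = 0]. *)
have [P [sP Pid Pc Pnear]] := ker_projector ds.
have Pe v : even v -> even (P v).
  move=> ev'; rewrite -[P v]opprK -[- P v](addKr v) rpredN rpredD ?rpredN //.
  by apply: Pnear => [w|]; apply: even_even.
have Pcome : P * ad L e = ad L e * P by apply: Pc; apply/eqP; rewrite -subr_eq0 ad_comm // se linear0.
have Pe1 v : P (ad L e v) = ad L e (P v) by rewrite -mulE Pcome mulE.
pose h := P h1; pose f1 := P f0.
have eh : even h by apply: Pe.
have ef1 : even f1 by apply: Pe.
have ef1h : ad L e f1 = h by rewrite /f1 -Pe1 ade.
have he : ad L h e = 2%:R *: e.
  by rewrite (anti_even e eh) /h -Pe1 (anti_even h1 ee) h1e' homN homZ (Pid _ se) opprK.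
pose A := (homog L false :&: lker (ad L s))%VS.
have AP v : (v \in A) = even v && (ad L s v == 0) by rewrite memv_cap memv_ker.
have sh : ad L s h = 0 by apply: sP.
have sA : stab (ad L h) A.
  by move=> v; rewrite !AP => /andP [ev' /eqP sv]; rewrite even_even //= jac_even // sh ad0 sv hom0 addr0.
have [||w wA tr] := complete_triple char0 ee eh ef1 (A := A) _ he ef1h _ sA.
- exact: capvSl.
- rewrite AP; apply/andP; split; first by rewrite rpredD ?rpredZ ?even_even.
  by rewrite homD homZ jac_even // sh ad0 sP !(hom0, scaler0, addr0).
exists s, e, h, (f1 - w), p; split=> //.
- by rewrite /s /e /e0; vring.
- by rewrite ads.
split=> //; rewrite homD homN sP; move: wA; rewrite AP => /andP [_ /eqP ->].
by rewrite subr0.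
Qed.

End ReductiveLie.

(** * Graded subalgebras as Lie superalgebras *)

Section Subalgebra.
Variables (k : closedFieldType) (L : lieSuperalgebra k) (U : {vspace L}).
Hypothesis U_brk : forall u v, u \in U -> v \in U -> ad L u v \in U.
Hypothesis U_even : forall u v, u \in homog L false -> v \in homog L true -> u + v \in U -> u \in U.

(** The subalgebra is made an object of its own because [super_splitting] is proved for an algebra
    on all of which [s] acts by zero. *)
Lemma lie_subalgebra : exists (K : lieSuperalgebra k) (i : 'Hom(K, L)),
  [/\ lie_hom i, injective i, forall v, i v \in U, forall v, v \in U -> exists w, i w = v &
      forall p w, i w \in homog L p -> w \in homog K p].
Proof.
have [|i iE] := @mkhom k (subvs_of U) L vsval; first by move=> c u v; exact: linearP.
have [ad1 ad1E] : exists f : 'Hom(subvs_of U, 'End(subvs_of U)),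
    forall u v, i (f u v) = ad L (i u) (i v).
  have e u : {g : 'End(subvs_of U) | forall v, g v = vsproj U (ad L (i u) (i v))}.
    by apply: mkhom => c v w; rewrite !linearP.
  have [|f fE] := @mkhom _ (subvs_of U) 'End(subvs_of U) (fun u => sval (e u)).
    move=> c u v; apply/lfunP => w.
    by rewrite addE scaleE !(svalP (e _)) homD homZ adD adZ linearP.
  exists f => u v; rewrite fE (svalP (e u)) !iE vsprojK //.
  by apply: U_brk; apply: subvsP.
have iI : injective i by move=> u v; rewrite !iE => /val_inj.
pose hom1 p := (i @^-1: homog L p)%VS.
have hom1E p v : (v \in hom1 p) = (i v \in homog L p) by rewrite -memv_preim.
have iU v : i v \in U by rewrite iE subvsP.
have Ui v : v \in U -> exists w, i w = v by move=> vU; exists (vsproj U v); rewrite iE vsprojK.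
have full : (hom1 false + hom1 true = fullv)%VS.
  apply/eqP; rewrite eqEsubv subvf; apply/subvP => v _.
  have [v0 [v1 [e0 e1 vE]]] := parity_split (i v).
  have v0U : v0 \in U by apply: (U_even e0 e1); rewrite -vE iU.
  have v1U : v1 \in U by rewrite -(addKr v0 v1) -vE rpredD ?rpredN.
  have [w0 w0E] := Ui _ v0U; have [w1 w1E] := Ui _ v1U.
  have -> : v = w0 + w1 by apply: iI; rewrite homD w0E w1E.
  by rewrite memv_add ?hom1E ?w0E ?w1E.
have direct : (hom1 false :&: hom1 true = 0)%VS.
  apply/eqP; rewrite -subv0; apply/subvP => v; rewrite memv_cap !hom1E => /andP [e o].
  by rewrite memv0; apply/eqP/iI; rewrite (parity0 e o) hom0.
pose S := Superspace full direct.
have h1 a b (x y : S) : x \in homog S a -> y \in homog S b -> ad1 x y \in homog S (a (+) b).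
  by rewrite /= !hom1E ad1E; exact: ad_homog.
have h2 a b (x y : S) : x \in homog S a -> y \in homog S b -> ad1 x y = - ((-1) ^+ (a && b) *: ad1 y x).
  by rewrite /= !hom1E => xa yb; apply: iI; rewrite homN homZ !ad1E (ad_antisym xa yb).
have h3 a b (x y z : S) : x \in homog S a -> y \in homog S b ->
    ad1 x (ad1 y z) = ad1 (ad1 x y) z + (-1) ^+ (a && b) *: ad1 y (ad1 x z).
  by rewrite /= !hom1E => xa yb; apply: iI; rewrite homD homZ !ad1E (ad_jacobi _ xa yb).
exists (@LieSuperalgebra k S ad1 h1 h2 h3), i; split=> //.
- by split=> [p v|u v]; [rewrite /= hom1E|rewrite ad1E].
by move=> p w; rewrite /= hom1E.
Qed.

End Subalgebra.

(** * Passage to the centralizer of the semisimple part *)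

Lemma pact_intertwine (k : fieldType) (V W : vectType k) (i : 'Hom(V, W)) (f : 'End(V)) (g : 'End(W)) p v :
  (forall v, i (f v) = g (i v)) -> i (pact f p v) = pact g p (i v).
Proof.
move=> H; elim/poly_ind: p v => [|p c IH] v; first by rewrite !pact0 !zero_lfunE hom0.
by rewrite !pactD !pactMX !pactC !endE homD homZ IH H.
Qed.

Section Centralizer.
Variables (k : closedFieldType) (L : lieSuperalgebra k).
Hypothesis JD : jordan_closed L.
Local Notation even u := (u \in homog L false).
Local Notation odd u := (u \in homog L true).

Lemma diagz_pullback (V W : vectType k) (i : 'Hom(V, W)) (f : 'End(V)) (g : 'End(W)) : injective i ->
  (forall v, i (f v) = g (i v)) -> diagz g -> diagz f.
Proof.
move=> iI H dg v; have sI : stab g (limg i).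
  by move=> _ /memv_imgP [w _ ->]; rewrite -H memv_img ?memvf.
have [|rs [w [u e Hw]]] := diag_eigsum (v := i v) dg sI; first by rewrite memv_img ?memvf.
have [w' w'E] : exists w' : k -> V, forall r, i (w' r) = w r.
  have H' r : exists t, i t = w r by have [_ /memv_imgP [t _ ->]] := Hw r; exists t.
  exists (fun r => sval (constructive_indefinite_description _ (H' r))) => r.
  exact: (svalP (constructive_indefinite_description _ (H' r))).
exists rs, w'; split=> // [|r]; first by apply: iI; rewrite e linear_sum; apply: eq_bigr => r _; rewrite -w'E.
split; last exact: memvf.
by apply: iI; rewrite H homZ w'E; case: (Hw r).
Qed.

(** [x] lies in the centralizer: [ad s] is a polynomial without constant term in the adjoint of half
    of [[x, x]], which kills [x]. For the same reason semisimple parts of elements of the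
    centralizer stay in it, so it is again [jordan_closed]. *)
Lemma splits_centralizer (char0 : [pchar k] =i pred0) (s x e h f : L) (p : {poly k}) : even s -> p`_0 = 0 ->
  ad L s = pact (ad L (s + e)) p -> triple e h f -> ad L s e = 0 -> ad L s h = 0 -> ad L s f = 0 ->
  odd x -> ad L x x = 2%:R *: (s + e) ->
  exists (K : lieSuperalgebra k) (i : 'Hom(K, L)) (s' x' : K),
  [/\ lie_hom i, s' \in homog K false, forall v, ad K s' v = 0, i s' = s /\ i x' = x & splits s' x'].
Proof.
move=> es p0 sp tr se sh sf ox xx.
pose U := lker (ad L s); have UP v : (v \in U) = (ad L s v == 0) by rewrite memv_ker.
have [||K [i [[ip ih] iI iU Ui pi]]] := @lie_subalgebra k L U.
- by move=> u v; rewrite !UP => /eqP su /eqP sv; rewrite jac_even // su ad0 sv hom0 addr0.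
- move=> u v eu ov; rewrite !UP homD => /eqP uv; apply/eqP/(@parity0 _ L).
    exact: even_even.
  by rewrite -[ad L s u](addrK (ad L s v)) uv add0r rpredN even_odd.
have get v : ad L s v = 0 -> exists w, i w = v by move=> sv; apply: Ui; rewrite UP sv.
have [s' s'E] := get s (even_self char0 es).
have [e' e'E] := get _ se; have [h' h'E] := get _ sh; have [f' f'E] := get _ sf.
have [|x' x'E] := get x.
  rewrite sp pact_kill //; have := odd_cube char0 ox; rewrite xx adZ => /eqP.
  by rewrite scaler_eq0 (negPf (natf_neq0 char0 1)) => /eqP.
have JK : jordan_closed K.
  move=> a ea; have [q [b [q0 eb bE db nb]]] := JD (ip _ _ ea).
  have ia w : i (ad K a w) = ad L (i a) (i w) by rewrite ih.
  have [|b' b'E] := get b.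
    rewrite (anti_even' s eb) // bE pact_kill ?oppr0 //.
    rewrite (anti_even' _ es) //.
    by have := iU a; rewrite UP => /eqP ->; rewrite oppr0.
  have bB w : i (ad K b' w) = ad L b (i w) by rewrite ih b'E.
  exists q, b'; split=> //.
  - by apply: pi; rewrite b'E.
  - by apply/lfunP => w; apply: iI; rewrite bB bE (pact_intertwine _ _ ia).
  - exact: (diagz_pullback iI bB).
  have [n nn] := nb; exists n; apply/lfunP => w; apply: iI; rewrite zero_lfunE hom0.
  transitivity (((ad L (i a) - ad L b) ^+ n) (i w)); last by rewrite nn zero_lfunE.
  rewrite !exprE; elim: n {nn} => [//|n IH]; rewrite !iterS -IH !endE homD homN ia bB.
  by [].
exists K, i, s', x'; split=> // [|v|].
- by apply: pi; rewrite s'E.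
- by apply: iI; rewrite ih s'E hom0; have := iU v; rewrite UP => /eqP.
have [ee eh ef [he e_f hf]] := tr.
apply: (super_splitting char0 JK (e := e') (h := h') (f := f')).
- by apply: pi; rewrite s'E.
- by move=> v; apply: iI; rewrite ih s'E hom0; have := iU v; rewrite UP => /eqP.
- split; try by apply: pi; rewrite ?e'E ?h'E ?f'E.
  by split; apply: iI; rewrite ?homZ ih ?e'E ?h'E ?f'E.
- by apply: pi; rewrite x'E.
by apply: iI; rewrite homZ homD ih x'E s'E e'E.
Qed.

End Centralizer.

(** * Neat and balanced operators from a splitting *)

Section SplitRepresentation.
Variables (k : closedFieldType) (K : lieSuperalgebra k) (V : vectType k) (rho : {linear K -> 'End(V)}).
Hypothesis char0 : [pchar k] =i pred0.
Hypothesis rhoB : forall a b u w v, u \in homog K a -> w \in homog K b ->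
  rho (ad K u w) v = rho u (rho w v) - (-1) ^+ (a && b) *: rho w (rho u v).
Local Notation even u := (u \in homog K false).
Local Notation odd u := (u \in homog K true).

Lemma rho_even u w v : even u -> rho (ad K u w) v = rho u (rho w v) - rho w (rho u v).
Proof.
move=> eu; have [w0 [w1 [e0 e1 ->]]] := parity_split w.
rewrite homD !linearD !endE (rhoB v eu e0) (rhoB v eu e1) /= expr0 !scale1r homD; vring.
Qed.

Lemma rho_odd u w v : odd u -> odd w -> rho (ad K u w) v = rho u (rho w v) + rho w (rho u v).
Proof. by move=> ou ow; rewrite (rhoB v ou ow) /= expr1 scaleN1r opprK. Qed.

Lemma rho_even_comm u w : even u -> rho (ad K u w) = rho u * rho w - rho w * rho u.
Proof. by move=> eu; apply/lfunP => v; rewrite !endE rho_even. Qed.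

Lemma rho_square u w : odd u -> ad K u u = 2%:R *: w -> forall v, rho u (rho u v) = rho w v.
Proof.
move=> ou uu v; apply: (scalerI (natf_neq0 char0 1)).
by have := rho_odd v ou ou; rewrite uu linearZ /= scaleE => ->; rewrite scaler_nat mulr2n.
Qed.

Lemma neat_rep z y ez c : odd z -> odd y -> even ez -> even c ->
  ad K z z = 2%:R *: ez -> ad K ez y = z -> ad K c ez = 2%:R *: ez -> neat_on (rho z) fullv.
Proof.
move=> oz oy eez ec zz ezy cez; have zzv := rho_square oz zz.
have [n nn] : nilp (rho ez).
  by apply: (shift_nilp char0 (h := rho c) (c := 2%:R)); rewrite ?natf_neq0 // -rho_even_comm // cez linearZ.
apply: (neat_crit (Y := rho y)) => // [v|].
  by rewrite !zzv -rho_even // ezy.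
exists n.*2.
have -> : (rho z) ^+ n.*2 = (rho ez) ^+ n; last by [].
rewrite -muln2 mulnC exprM; congr (_ ^+ n); apply/lfunP => v; by rewrite expr2 mulE zzv.
Qed.

(** The kernel of [s] is stable because [s] is central, and on it the square of the sum is [E]
    alone, as [balanced_crit] requires. *)
Lemma balanced_rep s E H F be (b : nat -> K) N : even s -> (forall v, ad K s v = 0) -> triple E H F -> odd be ->
  (forall j, odd (b j)) -> (forall j, ad K H (b j) = j%:R *: b j) ->
  ad K (b 0%N) E = 0 -> ad K (b 0%N) F = 0 -> ad K (b 0%N) be = E -> ad K H be = 2%:R *: be ->
  ad K (\sum_(j < N.+1) b j) (\sum_(j < N.+1) b j) = 2%:R *: (s + E) ->
  balanced_on (rho (\sum_(j < N.+1) b j)) (lker (rho s)).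
Proof.
move=> es s0 [eE eH eF [HE EF HF]] obe ob Hb bE bF bbe Hbe BB.
have UP v : (v \in lker (rho s)) = (rho s v == 0) by rewrite memv_ker.
have st u : stab (rho u) (lker (rho s)).
  move=> v; rewrite !UP => /eqP sv; have := rho_even u v es; rewrite s0 linear0 zero_lfunE sv hom0 subr0.
  by move=> <-.
have oB : odd (\sum_(j < N.+1) b j) by apply: rpred_sum.
have BBv := rho_square oB BB.
apply: (balanced_crit char0 (E := rho E) (H := rho H) (F := rho F) (b := rho be) (bs := fun j => rho (b j)) (N := N)) => //.
- by split; rewrite -rho_even_comm // ?HE ?EF ?HF ?linearZ.
- by move=> v _; rewrite linear_sum sum_lfunE.
- by move=> v; rewrite UP BBv linearD addE => /eqP ->; rewrite add0r.
- move=> j v; have := rho_even (b j) v eH; rewrite Hb linearZ /= scaleE => ->.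
  by rewrite addrC subrK.
- move=> v; have := rho_even (b 0%N) v eE; rewrite (anti_even _ eE) bE oppr0 linear0 zero_lfunE.
  by move=> /eqP; rewrite eq_sym subr_eq0 => /eqP.
- move=> v; have := rho_even (b 0%N) v eF; rewrite (anti_even _ eF) bF oppr0 linear0 zero_lfunE.
  by move=> /eqP; rewrite eq_sym subr_eq0 => /eqP.
- by move=> v; rewrite -rho_odd // bbe.
move=> v; have := rho_even be v eH; rewrite Hbe linearZ /= scaleE => ->.
by rewrite addrC subrK.
Qed.

End SplitRepresentation.

(** * Semisimple and nilpotent elements of the even part *)

Section JordanElements.
Variables (k : closedFieldType) (L : lieSuperalgebra k).
Hypothesis char0 : [pchar k] =i pred0.
Local Notation even u := (u \in homog L false).

Lemma free_subseq (V : vectType k) (X : seq V) :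
  exists Y : seq V, [/\ {subset Y <= X}, free Y & <<Y>>%VS = <<X>>%VS].
Proof.
elim: X => [|v X [Y [YX fY sY]]]; first by exists [::]; rewrite nil_free.
have [vY|vY] := boolP (v \in <<Y>>%VS).
  exists Y; split=> // [u /YX uX|]; first by rewrite inE uX orbT.
  by rewrite span_cons -sY; apply/esym/addv_idPr; rewrite -memvE.
exists (v :: Y); split; last by rewrite !span_cons sY.
  by move=> u; rewrite !inE => /orP [->|/YX ->]; rewrite ?orbT.
by rewrite free_cons vY.
Qed.

Lemma diagz_basis (V : vectType k) (f : 'End(V)) A : diagz f -> stab f A ->
  exists2 b, basis_of A b & forall v, v \in b -> exists c, f v = c *: v.
Proof.
move=> df sA; pose eig v := v \in A /\ exists c, f v = c *: v.
have gen (X : seq V) : {subset X <= A} ->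
    exists Y, (forall v, v \in Y -> eig v) /\ (<<X>> <= <<Y>>)%VS.
  elim: X => [|v X IH] XA; first by exists [::]; rewrite span_nil sub0v.
  have [|Y [eY XY]] := IH; first by move=> u uX; apply: XA; rewrite inE uX orbT.
  have [|rs [w [_ vE Hw]]] := diag_eigsum df sA (v := v); first by apply: XA; rewrite mem_head.
  exists ([seq w r | r <- rs] ++ Y); split.
    move=> u; rewrite mem_cat => /orP [/mapP [r _ ->]|]; last exact: eY.
    by have [fw wA] := Hw r; split=> //; exists r.
  rewrite span_cons span_cat addvS // -memvE vE big_seq; apply: rpred_sum => r rr.
  by apply: memv_span; apply: map_f.
have [|Y [eY AY]] := gen (vbasis A); first by move=> v; apply: vbasis_mem.
have [B [BY fB sB]] := free_subseq Y; exists B; last by move=> v /BY /eY [].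
rewrite basisEfree fB sB /=; apply/andP; split.
  by apply/span_subvP => v /eY [].
by move: AY; rewrite (span_basis (vbasisP A)) => /dimvS; rewrite -sB (eqP fB).
Qed.

Lemma diagz_semisimple s : even s -> diagz (ad L s) -> semisimple_elt s.
Proof.
move=> es ds; split=> //.
by have [|b bb be] := diagz_basis ds (A := homog L false); [move=> v; apply: even_even|exists b].
Qed.

Lemma semisimple_elt0 : semisimple_elt (0 : L).
Proof.
split; first exact: mem0v.
by exists (vbasis (homog L false)); [exact: vbasisP|move=> v _; exists 0; rewrite /brk ad0 scale0r].
Qed.

(** The relation [[h, e] = 2e] gives both conditions: [e] is the bracket of [h / 2] with itself, and
    [shift_nilp] makes [ad e] nilpotent. *)
Lemma weight2_nilpotent (h e : L) : even h -> even e -> ad L h e = 2%:R *: e -> nilpotent_elt e.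
Proof.
move=> eh ee he; have two0 : (2%:R : k) != 0 := natf_neq0 char0 1; split.
  exists [:: (2%:R^-1 *: h, e)] => [p|].
    by rewrite inE => /eqP -> /=; rewrite rpredZ.
  by rewrite big_seq1 /brk adZ he scalerA mulVf // scale1r.
have [n nn] : nilp (ad L e).
  by apply: (shift_nilp char0 _ two0 (h := ad L h)); rewrite ad_comm // he linearZ.
by exists n => y _; have := exprE (ad L e) n y; rewrite nn zero_lfunE.
Qed.

Lemma half_squareE (G : supergroup k) (x a : Lie G) : ad (Lie G) x x = 2%:R *: a -> half_square x = a.
Proof. by move=> xx; rewrite /half_square /brk xx scalerA mulVf ?scale1r // natf_neq0. Qed.

End JordanElements.

Theorem theorem1 (k : closedFieldType) (char0 : [pchar k] =i pred0)
    (G : supergroup k) (qr : quasi_reductive G)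
    (x : Lie G) (x_odd : x \in homog (Lie G) true) :
  exists x_bal x_neat : Lie G,
    [/\ x_bal \in homog (Lie G) true /\ x_neat \in homog (Lie G) true,
        x = x_bal + x_neat,
        balanced x_bal,
        neat x_neat &
        brk x_bal x_neat = 0].
Proof.
have two0 : (2%:R : k) != 0 := natf_neq0 char0 1.
have ea : half_square x \in homog (Lie G) false by rewrite rpredZ // odd_odd.
have [s [e [h [f [p [aE [es ds] [p0 sp] tr [se sh sf]]]]]]] := jacobson_morozov char0 qr ea.
rewrite aE in sp.
have xx : ad (Lie G) x x = 2%:R *: (s + e) by rewrite -aE scalerA mulfV // scale1r.
have [K [i [s' [x' [[ip ih] es' s'0 [s'E x'E]]]]]] :=
  splits_centralizer (reductive_jordan char0 qr) char0 es p0 sp tr se sh sf x_odd xx.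
move=> [z [y [ez [c [E [H [F [be [b [N]]]]]]]]]].
move=> [[oz oy obe ob] [eez ec tE] [zz ezy cez zb] xE [Hb [bE bF bbe Hbe] bb BB]].
have [eE eH eF [HE EF HF]] := tE.
pose B := \sum_(j < N.+1) b j; have oB : B \in homog K true by apply: rpred_sum.
(* Modules are restricted to the centralizer [K] of [s]: the identities of the splitting hold there,
   and the embedding preserves parities and brackets. *)
pose rho (M : Rep G) : {linear K -> 'End(M)} := act M \o i.
have rhoB (M : Rep G) a a' u w v : u \in homog K a -> w \in homog K a' ->
    rho M (ad K u w) v = rho M u (rho M w v) - (-1) ^+ (a && a') *: rho M w (rho M u v).
  by move=> uK wK; rewrite /= ih; apply: act_brk; apply: ip.
exists (i B), (i z); split.
- by split; apply: ip.
- by rewrite -homD addrC -xE x'E.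
- exists s, (i E); split=> [|M].
    split; first exact: diagz_semisimple.
    + by apply: (weight2_nilpotent char0 (h := i H)); rewrite ?ip // -ih HE homZ.
    + by rewrite /brk -s'E -ih s'0 hom0.
    + by apply: half_squareE => //; rewrite -ih BB homZ homD s'E.
  have := balanced_rep char0 (rhoB M) es' s'0 tE obe ob Hb bE bF bbe Hbe BB.
  by rewrite /= s'E.
- split=> [|M]; last exact: (neat_rep char0 (rhoB M) oz oy eez ec zz ezy cez).
  exists (i ez); split.
  + exact: semisimple_elt0.
  + by apply: (weight2_nilpotent char0 (h := i c)); rewrite ?ip // -ih cez homZ.
  + by rewrite /brk ad0.
  + by rewrite add0r; apply: half_squareE => //; rewrite -ih zz homZ.
by rewrite /brk -ih sym_odd // zb hom0.
Qed.
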